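(* Let $\Lambda$ be an amenable subgroup of a discrete countable group $\Gamma$. The following are equivalent. \begin{enumerate} \item $\Lambda$ is a singular subgroup of $\Gamma$; \item every $\Lambda$-invariant state on $C^*_r(\Gamma)$ vanishes on $\lambda(\Gamma \setminus \Lambda)$; \item for every $g \in \Gamma \setminus \Lambda$, we have $0 \in \overline{\operatorname{conv}}^{\Vert \cdot \Vert}(\{\lambda(tgt^{-1}) \, : \, t \in \Lambda\}) \subset B(\ell^2\Gamma)$; \item for any net $(\xi_n)$ of almost $\Lambda$-invariant unit vectors in $\ell^2\Gamma$ and all $g \in \Gamma \setminus \Lambda$, the inner product $\langle \lambda_g\xi_n,\xi_n\rangle$ goes to $0$. \end{enumerate}
   Context: Singular subgroup: Let $\Lambda$ be an amenable subgroup of a discrete countable group $\Gamma$, and suppose that $\Gamma$ acts continuously on a (nonempty, Hausdorff) compact space $X$. Let $\operatorname{Prob}_\Lambda(X)$ denote the set of $\Lambda$-invariant (regular) Borel probability measures on $X$. The subgroup $\Lambda$ is singular in $\Gamma$ with respect to $X$ if for every $\mu \in \operatorname{Prob}_\Lambda(X)$ and every $g \in \Gamma\setminus\Lambda$, the measures $g\cdot\mu$ and $\mu$ are mutually singular ($g \cdot \mu \perp \mu$). The subgroup $\Lambda$ is singular in $\Gamma$ if it is singular with respect to some compact space $X$ with a continuous $\Gamma$-action. Here $\lambda: g\mapsto\lambda_g=\lambda(g)$ is the left regular representation of $\Gamma$ on $\ell^2\Gamma$ and $C^*_r(\Gamma)\subset B(\ell^2\Gamma)$ is the reduced C$^*$-algebra,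 generated by $\lambda(\Gamma)$. A state $\varphi$ on $C^*_r(\Gamma)$ is $\Lambda$-invariant if $\varphi\circ \operatorname{Ad}(\lambda_t)=\varphi$ for all $t\in\Lambda$. The closure $\overline{\operatorname{conv}}^{\Vert\cdot\Vert}$ is the operator norm closure of the convex hull. A net $(\xi_n)$ of unit vectors in $\ell^2\Gamma$ is almost $\Lambda$-invariant if $\Vert \lambda_t\xi_n-\xi_n\Vert_2\to 0$ for every $t\in\Lambda$. *)

(* Defs.v *)
From HB Require Import structures.
From mathcomp Require Import all_boot all_order all_algebra.
From mathcomp Require Import complex.
From mathcomp Require Import all_classical all_reals all_analysis.
From mathcomp Require Import ring lra.
From mathcomp.analysis.showcase Require summability.

Set Implicit Arguments.
Unset Strict Implicit.
Unset Printing Implicit Defensive.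
Import Order.TTheory GRing.Theory Num.Theory.
Import numFieldNormedType.Exports.
Import Normc.

Local Open Scope classical_set_scope.
Local Open Scope ring_scope.
Local Open Scope complex_scope.

Section SumOfSquares.
Variables (R : realType) (T : choiceType).
Implicit Types f g h : T -> R[i].

(* normc is the R-valued modulus; the norm `|z| of R[i] is (normc z)%:C. *)
Definition sumsq f : \bar R := (\esum_(x in [set: T]) (normc (f x) ^+ 2)%:E)%E.

Lemma normc_ge0 (z : R[i]) : 0 <= normc z.
Proof. by case: z => a b; exact: sqrtr_ge0. Qed.

Lemma sumsq_ge0 f : (0 <= sumsq f)%E.
Proof. by apply: esum_ge0 => x _; rewrite lee_fin sqr_ge0. Qed.

Lemma sumsq_ler (a b : R) f g h : 0 <= a -> 0 <= b ->
  (forall x, normc (h x) ^+ 2 <= a * normc (f x) ^+ 2 + b * normc (g x) ^+ 2) ->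
  (sumsq h <= a%:E * sumsq f + b%:E * sumsq g)%E.
Proof.
move=> a0 b0 H; apply: ge_ereal_sup => _ [X [finX _] <-].
apply: (@le_trans _ _ (a%:E * (\sum_(x \in X) (normc (f x) ^+ 2)%:E) +
                       b%:E * (\sum_(x \in X) (normc (g x) ^+ 2)%:E))%E).
  rewrite !ge0_mule_fsumr; do 2?by move=> x; rewrite lee_fin sqr_ge0.
  rewrite -fsbig_split//=; apply: lee_fsum => // x _.
  by rewrite -!EFinM -EFinD lee_fin.
have le_s k : (\sum_(x \in X) (normc (k x) ^+ 2)%:E <= sumsq k)%E.
  by apply: ereal_sup_ubound; exists X.
by apply: leeD; apply: lee_wpmul2l; rewrite ?lee_fin.
Qed.

End SumOfSquares.

Section L2.
Variables (R : realType) (G : choiceType).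

Definition square_summable (f : G -> R[i]^o) : bool := (sumsq f < +oo)%E.

Record l2 := L2 { l2_fun :> G -> R[i]^o; l2_summable : square_summable l2_fun }.

HB.instance Definition _ := [isSub for l2_fun].
HB.instance Definition _ := [Choice of l2 by <:].

Lemma normc_sqrD (y z : R[i]) (t : R) : 0 < t ->
  normc (y + z) ^+ 2 <= (1 + t) * normc y ^+ 2 + (1 + t^-1) * normc z ^+ 2.
Proof.
move=> t0; apply: (@le_trans _ _ ((normc y + normc z) ^+ 2)).
  by rewrite ler_sqr ?nnegrE ?addr_ge0 ?normc_ge0 ?le_normcD.
move: (normc y) (normc z) => a b.
have : 0 <= t^-1 * (t * a - b) ^+ 2.
  by rewrite mulr_ge0 ?sqr_ge0 ?invr_ge0 ?ltW.
have -> : t^-1 * (t * a - b) ^+ 2 = t * a ^+ 2 - 2 * a * b + t^-1 * b ^+ 2.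
  by field; rewrite gt_eqF.
by nra.
Qed.

Lemma sumsqD (f g : G -> R[i]^o) (t : R) : 0 < t ->
  (sumsq (f + g)%R <= (1 + t)%:E * sumsq f + (1 + t^-1)%:E * sumsq g)%E.
Proof.
move=> t0; apply: sumsq_ler; rewrite ?addr_ge0 ?invr_ge0 ?(ltW t0)//.
by move=> x; exact: normc_sqrD.
Qed.

Lemma sumsqZ (a : R[i]) (f : G -> R[i]^o) :
  (sumsq (a *: f)%R <= (normc a ^+ 2)%:E * sumsq f)%E.
Proof.
rewrite -[leRHS]adde0 -[X in (_ + X)%E](mul0e (sumsq f)).
apply: sumsq_ler; rewrite ?sqr_ge0// => x.
by rewrite mul0r addr0 -exprMn -normcM.
Qed.

Lemma sumsq0 : sumsq (0 : G -> R[i]^o) = 0%E.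
Proof. by apply: esum1 => x _; rewrite normc0 expr0n. Qed.

Lemma square_summable_submod : submod_closed square_summable.
Proof.
split=> [|a u v]; rewrite /square_summable !unfold_in /=; first by rewrite sumsq0.
move=> fu fv; apply: le_lt_trans (sumsqD (a *: u) v ltr01) _.
have fin (c : R) x : 0 <= c -> (x < +oo -> c%:E * x < +oo)%E.
  by move=> c0 xoo; apply: lte_mul_pinfty.
have fau : (sumsq (a *: u)%R < +oo)%E.
  by apply: le_lt_trans (sumsqZ _ _) _; apply: fin; rewrite ?sqr_ge0.
by apply: lte_add_pinfty; apply: fin; rewrite ?addr_ge0 ?invr_ge0.
Qed.

HB.instance Definition _ :=
  GRing.SubChoice_isSubLmodule.Build R[i] (G -> R[i]^o) square_summable l2
    square_summable_submod.

Definition l2norm (f : l2) : R := Num.sqrt (fine (sumsq f)).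

Lemma sumsq_fin_num (f : l2) : sumsq f \is a fin_num.
Proof. by rewrite ge0_fin_numE ?sumsq_ge0//; exact: l2_summable. Qed.

Lemma l2norm_ge0 (f : l2) : 0 <= l2norm f.
Proof. exact: sqrtr_ge0. Qed.

Lemma sqr_l2norm (f : l2) : (l2norm f ^+ 2)%:E = sumsq f.
Proof.
by rewrite sqr_sqrtr ?fine_ge0 ?sumsq_ge0// fineK// sumsq_fin_num.
Qed.

Lemma l2norm_eq0 (f : l2) : l2norm f = 0 -> f = 0.
Proof.
move=> f0; apply/val_inj/funext => x /=; apply: eq0_normc.
have : (sumsq f <= 0)%E by rewrite -sqr_l2norm f0 expr0n.
move=> /(le_trans _) -/(_ (normc (f x) ^+ 2)%:E) H.
have {H} : (normc (f x) ^+ 2 <= 0)%R.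
  rewrite -lee_fin; apply: H; apply: ereal_sup_ubound; exists [set x] => //.
  by rewrite fsbig_set1.
by rewrite le_eqVlt ltNge sqr_ge0 orbF sqrf_eq0 => /eqP.
Qed.

Lemma l2norm0 : l2norm 0 = 0.
Proof. by rewrite /l2norm sumsq0 sqrtr0. Qed.

Lemma l2norm_le (f : l2) (c : R) : 0 <= c ->
  (sumsq f <= (c ^+ 2)%:E)%E -> l2norm f <= c.
Proof. by move=> c0; rewrite -sqr_l2norm lee_fin ler_sqr// nnegrE l2norm_ge0. Qed.

Lemma ler_l2normD (f g : l2) : l2norm (f + g) <= l2norm f + l2norm g.
Proof.
have [/eqP/l2norm_eq0 ->|f0] := boolP (l2norm f == 0).
  by rewrite add0r l2norm0 add0r.
have [/eqP/l2norm_eq0 ->|g0] := boolP (l2norm g == 0).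
  by rewrite addr0 l2norm0 addr0.
have {}f0 : 0 < l2norm f by rewrite lt_def f0 l2norm_ge0.
have {}g0 : 0 < l2norm g by rewrite lt_def g0 l2norm_ge0.
apply: l2norm_le; first by rewrite addr_ge0 ?l2norm_ge0.
apply: le_trans (sumsqD f g (divr_gt0 g0 f0)) _.
rewrite -!sqr_l2norm -!EFinM -EFinD lee_fin le_eqVlt; apply/orP; left.
by apply/eqP; field; rewrite !gt_eqF.
Qed.

Lemma l2normZ_le (a : R[i]) (f : l2) : l2norm (a *: f) <= normc a * l2norm f.
Proof.
apply: l2norm_le; first by rewrite mulr_ge0 ?normc_ge0 ?l2norm_ge0.
by rewrite exprMn EFinM sqr_l2norm; exact: sumsqZ.
Qed.

Lemma l2normZ (a : R[i]) (f : l2) : l2norm (a *: f) = normc a * l2norm f.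
Proof.
have [->|a0] := eqVneq a 0; first by rewrite scale0r normc0 mul0r l2norm0.
apply/eqP; rewrite eq_le l2normZ_le/=.
have na : 0 < normc a.
  rewrite lt_def normc_ge0 andbT; apply: contra a0 => /eqP/eq0_normc ->.
  exact: eqxx.
rewrite -ler_pdivlMl// -normcV -{1}[f]scale1r -(mulVf a0) -scalerA.
exact: l2normZ_le.
Qed.

(* Norms of complex normed modules take values in R[i], hence the injection. *)
Let normC (f : l2) : R[i] := (l2norm f)%:C.

Let normCD f g : normC (f + g) <= normC f + normC g.
Proof. by rewrite /normC -rmorphD lecR ler_l2normD. Qed.

Let normCZ a f : normC (a *: f) = `|a| * normC f.
Proof. by rewrite /normC l2normZ rmorphM. Qed.

Let normC_eq0 f : normC f = 0 -> f = 0.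
Proof. by move=> [/l2norm_eq0]. Qed.

HB.instance Definition _ :=
  Lmodule_isNormed.Build R[i] l2 normCD normCZ normC_eq0.

Lemma l2normE (f : l2) : `|f| = (l2norm f)%:C.
Proof. by []. Qed.

(* Unordered sum of an absolutely summable family, linear in the first
   argument. *)
Definition inner (f g : l2) : R[i] :=
  summability.sum (fun x => f x * (g x)^* : R[i]^o).

End L2.

Section BoundedOperators.
Variables (R : realType) (G : choiceType).
Local Notation H := (l2 R G).

Definition bounded_operator (T : H -> H) : Prop :=
  linear T /\ exists M : R, forall x, l2norm (T x) <= M * l2norm x.

(* B(l2 G), made below a normed module for the operator norm: closed and
   closure on bop refer to the norm topology. *)
Record bop := Bop {
  bop_fun :> H -> H;
  bop_proof : `[< bounded_operator bop_fun >] }.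

HB.instance Definition _ := [isSub for bop_fun].
HB.instance Definition _ := [Choice of bop by <:].

Lemma bopP (T : bop) : bounded_operator T.
Proof. exact/asboolP/bop_proof. Qed.

HB.instance Definition _ (T : bop) :=
  GRing.isLinear.Build R[i] H H *:%R T (bopP T).1.

Lemma bounded_operator_submod :
  submod_closed (fun T : H -> H => `[< bounded_operator T >]).
Proof.
split=> [|a S T]; rewrite !unfold_in /=.
  apply/asboolP; split; first by move=> a x y; rewrite /GRing.zero/= scaler0 addr0.
  by exists 0 => x; rewrite mul0r /GRing.zero/= l2norm0.
move=> /asboolP[lS [M SM]] /asboolP[lT [N TN]]; apply/asboolP; split.
  move=> b x y; rewrite !fctE lS lT !scalerDr !scalerA [a * b]mulrC.
  by rewrite !addrA; congr (_ + _); rewrite -!addrA; congr (_ + _); exact: addrC.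
exists (normc a * M + N) => x.
apply: le_trans (ler_l2normD _ _) _; rewrite mulrDl lerD//.
by rewrite l2normZ -mulrA ler_wpM2l// normc_ge0.
Qed.

HB.instance Definition _ :=
  GRing.SubChoice_isSubLmodule.Build R[i] (H -> H)
    (fun T : H -> H => `[< bounded_operator T >]) bop bounded_operator_submod.

Definition opnorm (T : bop) : R :=
  sup [set l2norm (T x) | x in [set x : H | l2norm x <= 1]].

Let opset (T : bop) := [set l2norm (T x) | x in [set x : H | l2norm x <= 1]].

Lemma has_sup_opnorm (T : bop) : has_sup (opset T).
Proof.
split; first by exists (l2norm (T 0)), 0 => //=; rewrite l2norm0.
have [_ [M TM]] := bopP T; exists `|M| => _ [x x1 <-].
apply: le_trans (TM x) _; apply: (@le_trans _ _ (`|M| * l2norm x)).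
  by rewrite ler_wpM2r ?l2norm_ge0 ?ler_norm.
by rewrite -[leRHS]mulr1 ler_wpM2l.
Qed.

Lemma opnorm_ge0 (T : bop) : 0 <= opnorm T.
Proof.
apply: (@le_trans _ _ (l2norm (T 0))); first exact: l2norm_ge0.
by apply: (ub_le_sup (has_sup_opnorm T).2); exists 0 => //=; rewrite l2norm0.
Qed.

Lemma le_opnorm (T : bop) (x : H) : l2norm (T x) <= opnorm T * l2norm x.
Proof.
have [/eqP/l2norm_eq0 ->|x0] := boolP (l2norm x == 0).
  by rewrite linear0 l2norm0 mulr0.
have {}x0 : 0 < l2norm x by rewrite lt_def x0 l2norm_ge0.
have nx : normc ((l2norm x)^-1)%:C = (l2norm x)^-1.
  by rewrite /= expr0n addr0 sqrtr_sqr ger0_norm// invr_ge0 ltW.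
rewrite mulrC -ler_pdivrMl// -nx -l2normZ -linearZ.
apply: (ub_le_sup (has_sup_opnorm T).2).
by exists (((l2norm x)^-1)%:C *: x) => //=; rewrite l2normZ nx mulVf// gt_eqF.
Qed.

Lemma opnorm_le (T : bop) (c : R) : 0 <= c ->
  (forall x, l2norm (T x) <= c * l2norm x) -> opnorm T <= c.
Proof.
move=> c0 Tc; apply: ge_sup; first exact: (has_sup_opnorm T).1.
move=> _ [x x1 <-]; apply: le_trans (Tc x) _.
by rewrite -[leRHS]mulr1 ler_wpM2l.
Qed.

Lemma ler_opnormD (S T : bop) : opnorm (S + T) <= opnorm S + opnorm T.
Proof.
apply: opnorm_le; first by rewrite addr_ge0 ?opnorm_ge0.
move=> x; apply: le_trans (ler_l2normD _ _) _.
by rewrite mulrDl lerD ?le_opnorm.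
Qed.

Lemma opnormZ_le (a : R[i]) (T : bop) : opnorm (a *: T) <= normc a * opnorm T.
Proof.
apply: opnorm_le; first by rewrite mulr_ge0 ?opnorm_ge0 ?normc_ge0.
by move=> x; rewrite l2normZ -mulrA ler_wpM2l ?normc_ge0 ?le_opnorm.
Qed.

Lemma opnorm_eq0 (T : bop) : opnorm T = 0 -> T = 0.
Proof.
move=> T0; apply/val_inj/funext => x /=; apply: l2norm_eq0; apply/eqP.
by rewrite eq_le l2norm_ge0 andbT -(mul0r (l2norm x)) -T0 le_opnorm.
Qed.

Lemma opnormZ (a : R[i]) (T : bop) : opnorm (a *: T) = normc a * opnorm T.
Proof.
apply/eqP; rewrite eq_le opnormZ_le/=.
have [->|a0] := eqVneq a 0; first by rewrite normc0 mul0r opnorm_ge0.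
have na : 0 < normc a.
  rewrite lt_def normc_ge0 andbT; apply: contra a0 => /eqP/eq0_normc ->.
  exact: eqxx.
rewrite -ler_pdivlMl// -normcV -{1}[T]scale1r -(mulVf a0) -scalerA.
exact: opnormZ_le.
Qed.

Let normC (T : bop) : R[i] := (opnorm T)%:C.

Let normCD S T : normC (S + T) <= normC S + normC T.
Proof. by rewrite /normC -rmorphD lecR ler_opnormD. Qed.

Let normCZ a T : normC (a *: T) = `|a| * normC T.
Proof. by rewrite /normC opnormZ rmorphM. Qed.

Let normC_eq0 T : normC T = 0 -> T = 0.
Proof. by move=> [/opnorm_eq0]. Qed.

HB.instance Definition _ :=
  Lmodule_isNormed.Build R[i] bop normCD normCZ normC_eq0.

Lemma opnormE (T : bop) : `|T| = (opnorm T)%:C.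
Proof. by []. Qed.

Lemma bop_id_proof : `[< bounded_operator (@id H) >].
Proof. by apply/asboolP; split=> //; exists 1 => x; rewrite mul1r. Qed.

Definition bop_id : bop := Bop bop_id_proof.

Lemma bop_comp_proof (S T : bop) : `[< bounded_operator (S \o T) >].
Proof.
apply/asboolP; split; first by move=> a x y /=; rewrite !linearP.
exists (opnorm S * opnorm T) => x /=; apply: le_trans (le_opnorm _ _) _.
by rewrite -mulrA ler_wpM2l ?opnorm_ge0 ?le_opnorm.
Qed.

Definition bop_comp (S T : bop) : bop := Bop (bop_comp_proof S T).

Definition adjoint (T T' : bop) : Prop :=
  forall x y : H, inner (T x) y = inner x (T' y).

Definition cstar_subalgebra (A : set bop) : Prop :=
  [/\ closed A,
      A 0 /\ (forall (a : R[i]) S T, A S -> A T -> A (a *: S + T)),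
      forall S T, A S -> A T -> A (bop_comp S T)
    & forall T T', A T -> adjoint T T' -> A T'].

Definition cstar_generated (S : set bop) : set bop :=
  smallest cstar_subalgebra S.

(* phi : bop -> R[i] stands for its restriction to the unital C*-algebra A: no
   condition is put on its values outside A. The inequality in R[i] says that
   phi (T'T) is a nonnegative real number; T' is in A as A is *-closed. *)
Definition state (A : set bop) (phi : bop -> R[i]) : Prop :=
  [/\ forall (a : R[i]) S T, A S -> A T ->
        phi (a *: S + T) = a * phi S + phi T,
      forall T T', A T -> adjoint T T' -> 0 <= phi (bop_comp T' T)
    & phi bop_id = 1].

End BoundedOperators.

Section LeftRegular.
Variables (R : realType) (G : groupType).
Local Notation H := (l2 R G).

Lemma sumsq_translate (g : G) (f : G -> R[i]^o) :
  sumsq (fun x => f (g^-1 * x)%g) = sumsq f.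
Proof.
rewrite /sumsq [RHS](reindex_esum [set: G] [set: G] (fun x => g^-1 * x)%g)//.
split=> //; last by move=> x _; exists (g * x)%g => //; rewrite mulKg.
by move=> x y _ _ /mulgI.
Qed.

Lemma translate_proof (g : G) (f : H) :
  square_summable (fun x => f (g^-1 * x)%g).
Proof. by rewrite /square_summable sumsq_translate; exact: l2_summable. Qed.

Definition translate (g : G) (f : H) : H := L2 (translate_proof g f).

Lemma l2norm_translate (g : G) (f : H) : l2norm (translate g f) = l2norm f.
Proof. by rewrite /l2norm sumsq_translate. Qed.

Lemma lambda_proof (g : G) : `[< bounded_operator (translate g) >].
Proof.
apply/asboolP; split; first by move=> a x y; apply/val_inj/funext.
by exists 1 => x; rewrite l2norm_translate mul1r.
Qed.

Definition lambda (g : G) : bop R G := Bop (lambda_proof g).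

Definition Cstar_r : set (bop R G) := cstar_generated (range lambda).

(* Ad (lambda t) T = lambda t \o T \o lambda t^-1 *)
Definition invariant_state (L : groupClosed G) (phi : bop R G -> R[i]) : Prop :=
  state Cstar_r phi /\
  forall t, t \in L -> forall T, Cstar_r T ->
    phi (bop_comp (lambda t) (bop_comp T (lambda t^-1%g))) = phi T.

End LeftRegular.

Definition conv_hull (K : numDomainType) (M : lmodType K) (A : set M) : set M :=
  smallest (@convex_set K M) A.

Section Amenability.
Variable R : realType.

Definition invariant_mean (G : groupType) (m : (G -> R^o) -> R) : Prop :=
  [/\ forall (a : R) (f g : G -> R^o), bounded_fun f -> bounded_fun g ->
        m (a *: f + g) = a * m f + m g,
      forall f : G -> R^o, bounded_fun f -> (forall x, 0 <= f x) -> 0 <= m f,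
      m (cst 1) = 1
    & forall (f : G -> R^o) (h : G), bounded_fun f -> m (fun x => f (h^-1 * x)%g) = m f].

Definition amenable (G : groupType) : Prop :=
  exists m : (G -> R^o) -> R, invariant_mean m.

End Amenability.

Section SubgroupType.
Variables (G : groupType) (L : groupClosed G).

Record subgroup_of := SubgroupOf {
  subgroup_val :> G;
  subgroupP : subgroup_val \in L }.

HB.instance Definition _ := [isSub for subgroup_val].
HB.instance Definition _ := [Choice of subgroup_of by <:].

Lemma subgroup_of_closed : group_closed (fun x => x \in L).
Proof. by split=> [|x y xL yL]; [exact: gpred1|exact: gpredF]. Qed.

HB.instance Definition _ :=
  SubChoice_isSubGroup.Build G (fun x => x \in L) subgroup_of subgroup_of_closed.

End SubgroupType.

Section Singular.
Variable R : realType.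

(* Measurable types are pointed, so X is nonempty by construction. *)
Definition borel (X : ptopologicalType) := g_sigma_algebraType (@open X).

(* G is discrete, so joint continuity amounts to continuity of each act g. *)
Definition continuous_action (G : groupType) (X : topologicalType)
    (act : G -> X -> X) : Prop :=
  [/\ forall x, act 1%g x = x,
      forall g h x, act (g * h)%g x = act g (act h x)
    & forall g, continuous (act g)].

Definition regular_measure (X : ptopologicalType)
    (mu : set (borel X) -> \bar R) : Prop :=
  forall A : set (borel X), measurable A ->
    mu A = ereal_inf [set mu U | U in [set U : set X | open U /\ A `<=` U]] /\
    mu A = ereal_sup [set mu K | K in [set K : set X | compact K /\ K `<=` A]].

Definition mutually_singular (d : measure_display) (T : measurableType d)
    (mu nu : set T -> \bar R) : Prop :=
  exists A, [/\ measurable A, mu A = 0%E & nu (~` A) = 0%E].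

(* (g . mu) A = mu (g^-1 A), and g^-1 A is the preimage of A by act g. *)
Definition translate_measure (G : groupType) (X : ptopologicalType)
    (act : G -> X -> X) (g : G) (mu : set (borel X) -> \bar R) :
    set (borel X) -> \bar R :=
  pushforward mu (act g : borel X -> borel X).

Definition Prob_inv (G : groupType) (L : groupClosed G) (X : ptopologicalType)
    (act : G -> X -> X) : set (probability (borel X) R) :=
  [set mu | regular_measure mu /\
    forall t, t \in L -> forall A, measurable A ->
      translate_measure act t mu A = mu A].

Definition singular_wrt (G : groupType) (L : groupClosed G)
    (X : ptopologicalType) (act : G -> X -> X) : Prop :=
  forall mu, Prob_inv L act mu -> forall g, g \notin L ->
    mutually_singular (translate_measure act g mu) mu.

Definition singular_subgroup (G : groupType) (L : groupClosed G) : Prop :=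
  exists (X : ptopologicalType) (act : G -> X -> X),
    [/\ compact [set: X], hausdorff_space X, continuous_action act
      & singular_wrt L act].

End Singular.

Section Nets.

Definition directed (I : Type) (le : I -> I -> Prop) : Prop :=
  [/\ [set: I] !=set0,
      forall i, le i i,
      forall i j k, le i j -> le j k -> le i k
    & forall i j, exists k, le i k /\ le j k].

Definition tails (I : Type) (le : I -> I -> Prop) : set_system I :=
  filter_from setT (fun i => [set j | le i j]).

Variables (R : realType) (G : groupType).

Definition almost_invariant (L : groupClosed G) (I : Type)
    (le : I -> I -> Prop) (xi : I -> l2 R G) : Prop :=
  (forall n, l2norm (xi n) = 1) /\
  forall t, t \in L -> l2norm (lambda R t (xi n) - xi n) @[n --> tails le] --> 0.

End Nets.

(* Main.v *)
Require Import Defs.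
From HB Require Import structures.
From mathcomp Require Import all_boot all_order all_algebra.
From mathcomp Require Import complex.
From mathcomp Require Import all_classical all_reals all_analysis.
From mathcomp Require Import ring lra finmap measurable_realfun.
From mathcomp.analysis.showcase Require summability.

Set Implicit Arguments.
Unset Strict Implicit.
Unset Printing Implicit Defensive.
Import Order.TTheory GRing.Theory Num.Theory.
Import numFieldNormedType.Exports.
Import Normc.

(** Fix g outside Λ. The proof goes through a combinatorial property, stronger at
    first sight than the four conditions: for every eps > 0 there are a function
    f : Γ -> [0, 1] and a finitely supported probability c on Λ such that both
    averages Σ_s c(s) f(s y) and Σ_s c(s) (1 - f(g s y)) are at most eps, for all
    y in Γ ([separating]).

    Vanishing coefficients produce separating functions
    ([vanishing_separating]). If there is none for some eps, a minimax argument
    exchanges the quantifiers over f and over probabilities on Γ: combined with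
    the amenability of Λ, it gives finitely supported probabilities p on Γ that
    are almost invariant under any finite part of Λ, and whose overlap
    Σ_x min (p(x), p(g^-1 x)) stays above eps / 3
    ([almost_invariant_overlap]). The vectors √p are then almost invariant, with
    coefficients at g bounded below. Amenability enters as Reiter's condition,
    which the same minimax principle ([cube_minimax]) deduces from an invariant
    mean.

    Separating functions give back the other conditions. Cauchy-Schwarz bounds
    the norm of Σ_s c(s) λ(s^-1 g s) by 2 √eps ([separating_opnorm]), so 0 is in
    the closed convex hull. Rounded to subsets of Γ, they give a singular action
    ([separating_singular]): the families of subsets that satisfy the same
    inequalities form a compact space on which Γ acts by right translations, and
    for an invariant measure the averaged inequalities become estimates on single
    events, to which the Borel-Cantelli lemma applies.

    If 0 is in the closed convex hull, invariant states vanish at λ(g), because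
    they are constant on the hull and bounded ([conv_hull_state_vanish]). States
    are only assumed positive on elements T'T, so boundedness requires square
    roots of elements 1 - x with x a self-adjoint strict contraction; they come
    from a fixed point iteration ([sqrt_one_minus]).

    Finally, both conditions on states and on measures imply vanishing
    coefficients, by a limit along an ultrafilter. The limit of the vector states
    of an almost invariant net is an invariant state
    ([state_vanish_coefficients]). The limit of the probabilities |ξ_n|^2, carried
    to an orbit in X, is a finitely additive invariant probability, from which a
    regular invariant measure is built as in the Riesz representation theorem; its
    singularity yields a subset of Γ that separates ξ_n from λ(g) ξ_n
    ([singular_vanishing]). *)

Local Open Scope classical_set_scope.
Local Open Scope ring_scope.
Local Open Scope complex_scope.

(** * Minimax on a cube *)

(** A finitely supported probability is kept as a weight function together with a
    duplicate-free list carrying it: the weights can then be evaluated, and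
    compared with their translates, at every point. *)
Definition prob_weights (R : realType) (S : choiceType) (r : seq S) (p : S -> R) :=
  [/\ uniq r, forall s, 0 <= p s, forall s, s \notin r -> p s = 0
    & \sum_(s <- r) p s = 1].

(* Makes the open cover form of compactness apply to products of pointed spaces. *)
HB.instance Definition _ (I : Type) (T : I -> ptopologicalType) :=
  isPointed.Build (prod_topology T) (fun=> point).

Section Continuity.
Variables (R : realType) (T : topologicalType).

Lemma cont_cst (c : R) : continuous (fun _ : T => c).
Proof. by move=> w; apply: cvg_cst. Qed.

Lemma contD (a b : T -> R) : continuous a -> continuous b ->
  continuous (fun w => a w + b w).
Proof. by move=> ha hb w; apply: cvgD; [exact: ha|exact: hb]. Qed.

Lemma contZ (c : R) (a : T -> R) : continuous a -> continuous (fun w => c * a w).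
Proof. by move=> ha w; apply: (@continuousM R T (cst c) a);
  [exact: cvg_cst|exact: ha]. Qed.

Lemma cont_sum (I : Type) (r : seq I) (a : I -> T -> R) :
  (forall i, continuous (a i)) -> continuous (fun w => \sum_(i <- r) a i w).
Proof.
move=> ha; apply: (@continuous_big R I +%R 0 xpredT (@add_continuous R)) => i _.
exact: ha.
Qed.

Lemma cont_max0_sqr (a : T -> R) (alpha : R) : continuous a ->
  continuous (fun w => Num.max (a w - alpha) 0 ^+ 2).
Proof.
move=> ca; pose b w := Num.max (a w - alpha) 0.
have cb : continuous b.
  move=> w; apply: (@continuous_max R T (fun w => a w - alpha) (cst 0)).
    by apply: cvgB; [exact: ca|exact: cvg_cst].
  exact: cvg_cst.
by move=> w; exact: (@continuousM R T b b w (cb w) (cb w)).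
Qed.

End Continuity.

Section Minimax.
Variables (R : realType) (S J : choiceType).
Local Notation W := (prod_topology (fun _ : J => R^o)).

Definition cube : set W := [set w | forall j, `|w j| <= 1].

Lemma compact_cube : compact cube.
Proof.
have -> : cube = [set w | forall j, `[-1, 1]%classic (w j)].
  by apply/seteqP; split => w H j; have := H j; rewrite /= in_itv/= ler_norml.
by apply: (@tychonoff J (fun=> R^o) (fun=> `[-1, 1]%classic)) => j;
  apply: segment_compact.
Qed.

Definition affine_on (a : W -> R) := forall w w' t,
  a (fun j => w j + t * (w' j - w j)) = a w + t * (a w' - a w).

Lemma cube_convex w w' t : cube w -> cube w' -> 0 <= t -> t <= 1 ->
  cube (fun j => w j + t * (w' j - w j)).
Proof.
move=> cw cw' t0 t1 j.
have := cw j; have := cw' j; rewrite !ler_norml => /andP[? ?] /andP[? ?].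
by apply/andP; split; nra.
Qed.

(** The squared positive part has derivative twice the positive part and second
    derivative at most 2; this is the resulting quadratic upper bound. *)
Lemma sqr_max0_le (x d : R) :
  Num.max (x + d) 0 ^+ 2 <= Num.max x 0 ^+ 2 + 2 * Num.max x 0 * d + d ^+ 2.
Proof.
case: (lerP x 0) => hx; case: (lerP (x + d) 0) => hd;
  rewrite ?expr0n /= ?mulr0 ?mul0r ?add0r.
- exact: sqr_ge0.
- nra.
- nra.
- by nra.
Qed.

(** First-order condition at a minimum, without derivatives. *)
Lemma quad_slope_ge0 (b c : R) : 0 <= c ->
  (forall t, 0 <= t -> t <= 1 -> 0 <= t * b + t ^+ 2 * c) -> 0 <= b.
Proof.
move=> c0 H; rewrite leNgt; apply/negP => b0.
have d0 : 0 < c - b + 1 by lra.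
pose t := - b / (2 * (c - b + 1)).
have t0 : 0 < t by rewrite divr_gt0; lra.
have tE : t * (2 * (c - b + 1)) = - b by rewrite /t mulfVK //; lra.
have t1 : t <= 1 by rewrite leNgt; apply/negP => ?; nra.
have := H t (ltW t0) t1.
have -> : t * b + t ^+ 2 * c = t * (b + t * c) by ring.
by rewrite pmulr_rge0 // => ?; nra.
Qed.

(** By compactness, finitely many of the functions already exceed alpha somewhere
    at each point of the cube. For these, minimise the sum of the squared positive
    parts of a_s - alpha. At a minimiser w0 the positive parts of a_s w0 - alpha,
    normalised, are the weights: their combination exceeds alpha at w0, and the
    first-order condition says that it does not decrease from w0 to any other
    point of the cube. *)
Lemma cube_minimax (a : S -> W -> R) (alpha : R) :
  (forall s, continuous (a s)) -> (forall s, affine_on (a s)) ->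
  (forall w, cube w -> exists s, alpha < a s w) ->
  exists r p, prob_weights r p /\
    forall w, cube w -> alpha <= \sum_(s <- r) p s * a s w.
Proof.
move=> ca aa H.
pose f s : set W := a s @^-1` [set x | alpha < x].
have [D _ Dcov] : finite_subset_cover setT f cube.
  have := compact_cube; rewrite (@compact_cover W); apply.
    move=> s _; apply: open_comp; first by move=> ? _; exact: ca.
    exact: open_gt.
  by move=> w /H[s ?]; exists s.
have {Dcov} Dcov w : cube w -> exists2 s, s \in D & alpha < a s w.
  by move=> /Dcov[s]; exists s.
pose q s w := Num.max (a s w - alpha) 0.
pose Phi (w : W) : R := \sum_(s <- D) q s w ^+ 2.
have cPhi : continuous Phi.
  by apply: cont_sum => s; exact: cont_max0_sqr.
have cube0 : cube !=set0 by exists (fun=> 0) => j; rewrite normr0.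
have [w0] := compact_EVT_min cube0 compact_cube (continuous_subspaceT cPhi).
move=> /set_mem w0c w0min.
have q0 s w : 0 <= q s w by rewrite /q le_max lexx orbT.
have var w : cube w -> 0 <= \sum_(s <- D) 2 * q s w0 * (a s w - a s w0).
  move=> cw; apply: (@quad_slope_ge0 _ (\sum_(s <- D) (a s w - a s w0) ^+ 2)).
    by apply: sumr_ge0 => s _; exact: sqr_ge0.
  move=> t t0 t1.
  have /le_trans le1 := w0min _ (mem_set (cube_convex w0c cw t0 t1)).
  have {le1} : Phi w0 <= Phi w0 + (t * (\sum_(s <- D) 2 * q s w0 * (a s w - a s w0))
     + t ^+ 2 * \sum_(s <- D) (a s w - a s w0) ^+ 2).
    apply: le1.
    rewrite /Phi !mulr_sumr -!big_split /=; apply: ler_sum => s _.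
    rewrite /q aa.
    have -> : a s w0 + t * (a s w - a s w0) - alpha =
      (a s w0 - alpha) + t * (a s w - a s w0) by ring.
    apply: le_trans (sqr_max0_le _ _) _.
    by rewrite le_eqVlt; apply/orP; left; apply/eqP; ring.
  by rewrite lerDl.
pose Q : R := \sum_(s <- D) q s w0.
have Q0 : 0 < Q.
  have [s sD sa] := Dcov w0 w0c.
  rewrite /Q (big_rem s)//= ltr_pwDl//; last exact: sumr_ge0.
  by rewrite /q lt_max subr_gt0 sa.
exists D, (fun s => if s \in D then q s w0 / Q else 0); split.
  split=> //; first by move=> s; case: ifP => // _; rewrite divr_ge0 // ltW.
    by move=> s; case: ifP.
  rewrite [LHS](_ : _ = \sum_(s <- D) q s w0 / Q); last first.
    by apply: eq_big_seq => s ->.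
  by rewrite -mulr_suml divff // gt_eqF.
move=> w cw.
rewrite [leRHS](_ : _ = (\sum_(s <- D) q s w0 * a s w) / Q); last first.
  rewrite mulr_suml; apply: eq_big_seq => s ->; rewrite -!mulrA; congr (_ * _).
  by rewrite mulrC.
rewrite ler_pdivlMr // /Q mulr_sumr.
have h := var w cw; rewrite -subr_ge0 -sumrB.
suff : 0 <= 2 * \sum_(s <- D) (q s w0 * a s w - alpha * q s w0) by rewrite pmulr_rge0.
rewrite mulr_sumr; apply: le_trans h _; apply: ler_sum => s _.
rewrite /q; case: (lerP (a s w0 - alpha) 0) => hs;
  first by rewrite !(mulr0, mul0r) subr0 mulr0.
by nra.
Qed.

End Minimax.

(** * Invariant means and almost invariant weights *)

Section Cube.
Variables (R : realType) (J : choiceType).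
Local Notation W := (prod_topology (fun _ : J => R^o)).

Definition eval_at (j : J) (w : W) : R := w j.

Lemma eval_at_continuous (j : J) : continuous (eval_at j).
Proof. exact: (@proj_continuous J (fun=> R^o) j). Qed.

Lemma eval_at_affine (j : J) : affine_on (eval_at j).
Proof. by []. Qed.

Lemma affine_cst (c : R) : affine_on (fun _ : W => c).
Proof. by move=> w w' t; rewrite subrr mulr0 addr0. Qed.

Lemma affineD (a b : W -> R) : affine_on a -> affine_on b ->
  affine_on (fun w => a w + b w).
Proof. by move=> ha hb w w' t; rewrite ha hb; ring. Qed.

Lemma affineZ (c : R) (a : W -> R) : affine_on a ->
  affine_on (fun w => c * a w).
Proof. by move=> ha w w' t; rewrite ha; ring. Qed.

Lemma affine_sum (I : Type) (r : seq I) (a : I -> W -> R) :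
  (forall i, affine_on (a i)) -> affine_on (fun w => \sum_(i <- r) a i w).
Proof.
move=> ha w w' t; rewrite -sumrB mulr_sumr -big_split /=.
by apply: eq_bigr => i _; rewrite ha.
Qed.

End Cube.

Section Mean.
Variables (R : realType) (G : groupType) (m : (G -> R^o) -> R).
Hypothesis mean : invariant_mean m.

Lemma bounded_fun_le (f : G -> R^o) M : (forall x, `|f x| <= M) -> bounded_fun f.
Proof.
move=> fM; exists M; split; first exact: num_real.
by move=> x Mx y _ /=; apply: le_trans (fM y) (ltW Mx).
Qed.

Lemma mean0 : m 0 = 0.
Proof.
have [lin _ _ _] := mean.
have b0 : bounded_fun (0 : G -> R^o) by apply: (@bounded_fun_le _ 0) => x; rewrite normr0.
by have /eqP := lin 1 0 0 b0 b0;
  rewrite scaler0 addr0 mul1r -subr_eq subrr eq_sym => /eqP.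
Qed.

Lemma mean_shift_sum (ts : seq G) (w : G -> G -> R) :
  (forall t s, `|w t s| <= 1) ->
  m (fun s => \sum_(t <- ts) (w t s - w t (t * s)%g)) = 0.
Proof.
move=> w1; have [lin _ _ inv] := mean.
have bw t : bounded_fun (w t : G -> R^o) by exact: bounded_fun_le (w1 t).
have bwt t : bounded_fun ((fun s => w t (t * s)%g) : G -> R^o).
  by apply: (@bounded_fun_le _ 1) => s.
elim: ts => [|t ts IH].
  rewrite [X in m X](_ : _ = 0) ?mean0//; apply/funext => s; by rewrite big_nil.
have bd (f : G -> R) : (exists M, forall s, `|f s| <= M) -> bounded_fun (f : G -> R^o).
  by move=> [M]; exact: bounded_fun_le.
have bsum : bounded_fun (fun s => \sum_(t <- ts) (w t s - w t (t * s)%g) : R^o).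
  apply: (@bounded_fun_le _ (\sum_(t <- ts) 2)) => s.
  apply: le_trans (ler_norm_sum _ _ _) _; apply: ler_sum => u _.
  apply: le_trans (ler_normB _ _) _.
  by have := w1 u s; have := w1 u (u * s)%g; lra.
rewrite [X in m X](_ : _ = 1 *: (w t : G -> R^o) +
   ((-1) *: ((fun s => w t (t * s)%g) : G -> R^o)
     + (fun s => \sum_(t <- ts) (w t s - w t (t * s)%g) : R^o))); last first.
  apply/funext => s; rewrite big_cons !fctE scale1r scaleN1r addrA.
  by [].
rewrite !lin //; last first.
  apply: (@bounded_fun_le _ (1 + \sum_(t <- ts) 2)) => s.
  rewrite !fctE scaleN1r; apply: le_trans (ler_normD _ _) _; rewrite normrN lerD//.
  apply: le_trans (ler_norm_sum _ _ _) _; apply: ler_sum => u _.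
  apply: le_trans (ler_normB _ _) _.
  by have := w1 u s; have := w1 u (u * s)%g; lra.
rewrite IH.
have := inv (w t) t^-1%g (bw t); rewrite invgK => ->.
by rewrite addr0 mul1r mulN1r subrr.
Qed.

Lemma mean_ge_cst (f : G -> R) M d : (forall s, `|f s| <= M) ->
  (forall s, d <= f s) -> d <= m (f : G -> R^o).
Proof.
move=> fM df; have [lin pos m1 _] := mean.
have bf : bounded_fun (f : G -> R^o) by exact: bounded_fun_le fM.
have b1 : bounded_fun (cst 1 : G -> R^o).
  by apply: (@bounded_fun_le _ 1) => s; rewrite normr1.
have := lin (- d) (cst 1) (f : G -> R^o) b1 bf; rewrite m1 mulr1 => h.
rewrite -subr_ge0 addrC -h; apply: pos.
  apply: (@bounded_fun_le _ (`|d| + M)) => s; rewrite !fctE.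
  apply: le_trans (ler_normD _ _) _; apply: lerD => //.
  by rewrite normrZ normr1 mulr1 normrN.
move=> s; rewrite !fctE; change (0 <= - d * 1 + f s); have := df s; lra.
Qed.

End Mean.

Section Reiter.
Variables (R : realType) (G : groupType).

(** Reiter's condition in dual form: the displacement of the weights under ts is
    tested against all families of functions bounded by 1, which is how it is used
    below. If no weights achieved d, the minimax principle would produce one family
    whose total displacement is at least d at every point, while its mean is 0. *)
Lemma amenable_reiter : amenable R G -> forall (ts : seq G) (d : R), 0 < d ->
  exists r p, prob_weights r p /\ forall w : G -> G -> R, (forall t s, `|w t s| <= 1) ->
    \sum_(s <- r) p s * \sum_(t <- ts) (w t s - w t (t * s)%g) <= d.
Proof.
move=> [m mean] ts d d0.
pose W := prod_topology (fun _ : G * G => R^o).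
pose a s (w : W) : R := - 1 *
    \sum_(t <- ts) (eval_at (t, s) w + (-1) * eval_at (t, (t * s)%g) w).
have [|||r [p [rp H]]] := @cube_minimax R G (G * G)%type a (- d).
- move=> s; apply: contZ; apply: cont_sum => t; apply: contD;
  first exact: eval_at_continuous.
  by apply: contZ; exact: eval_at_continuous.
- by move=> s; apply: affineZ; apply: affine_sum => t; apply: affineD;
  last (apply: affineZ); exact: eval_at_affine.
- move=> w cw; apply: contrapT => /forallNP H.
  have w1 t s : `|w (t, s)| <= 1 by exact: cw.
  have h s : d <= \sum_(t <- ts) (w (t, s) - w (t, (t * s)%g)).
    have /negP := H s; rewrite -leNgt /a mulN1r lerN2.
    by under eq_bigr do rewrite mulN1r.
  (* The bound 2 on each summand only serves to make the function bounded. *)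
  have := mean_ge_cst mean (M := \sum_(t <- ts) 2) _ h.
  rewrite (mean_shift_sum mean ts (w := fun t s => w (t, s))) // => /(_ _)/le_gtF;
    rewrite d0.
  move=> F; suff: true = false by []. 
  apply: F => s; apply: le_trans (ler_norm_sum _ _ _) _; apply: ler_sum => u _.
  apply: le_trans (ler_normB _ _) _.
  by have := w1 u s; have := w1 u (u * s)%g; lra.
exists r, p; split=> // w w1.
have := H (fun ts => w ts.1 ts.2) (fun j => w1 _ _).
rewrite /a -lerN2 opprK; apply: le_trans; rewrite -sumrN; apply: ler_sum => s _.
rewrite -mulrN mulN1r opprK le_eqVlt; apply/orP; left; apply/eqP; congr (_ * _).
by apply: eq_bigr => t _; rewrite mulN1r.
Qed.

End Reiter.

(** * Separating functions or overlapping densities *)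

Lemma prob_weights_const (R : realType) (S : choiceType) (r : seq S) (p : S -> R) c :
  prob_weights r p -> \sum_(s <- r) p s * c = c.
Proof. by move=> [_ _ _ p1]; rewrite -mulr_suml p1 mul1r. Qed.

(** The image of p under left translation by a has density x |-> p (a^-1 x). *)
Lemma prob_weights_shift (R : realType) (G : groupType) (r E : seq G) (p : G -> R) (a : G)
  (phi : G -> R) : prob_weights r p -> uniq E ->
  (forall x, x \in r -> (a * x)%g \in E) ->
  \sum_(x <- r) p x * phi (a * x)%g = \sum_(x <- E) p (a^-1 * x)%g * phi x.
Proof.
move=> [ur _ p0 _] uE rE.
rewrite [RHS](bigID (fun x => (a^-1 * x)%g \in r))/= [X in _ + X]big1 ?addr0; last first.
  by move=> x /p0 ->; rewrite mul0r.
rewrite -[RHS]big_filter; set E' := [seq _ <- _ | _].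
have : perm_eq E' [seq (a * x)%g | x <- r].
  apply: uniq_perm; first exact: filter_uniq.
    by rewrite map_inj_uniq //; exact: mulgI.
  move=> x; rewrite mem_filter; apply/andP/mapP => [[h _]|[y yr ->]].
    exists (a^-1 * x)%g; [exact: h|by rewrite mulVKg].
  by rewrite mulKg; split; rewrite ?rE.
move=> /(perm_big _) ->; rewrite big_map; apply: eq_bigr => x _.
by rewrite mulKg.
Qed.

Section Dichotomy.
Variables (R : realType) (G : groupType) (L : groupClosed G).
Local Notation Ls := (subgroup_of L).

(** If m is a finitely additive L-invariant probability on G, integrating the two
    inequalities gives m(f) <= eps and m(1 - f(g .)) <= eps: f is almost 0 for m
    and almost 1 for its translate by g. A separating function thus expresses,
    uniformly in all such m, that m and its translate are almost singular. *)
Definition separating (g : G) (eps : R) (f : G -> R) (r : seq Ls) (p : Ls -> R) :=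
  [/\ prob_weights r p, forall x, 0 <= f x <= 1 & forall y,
    \sum_(s <- r) p s * f (val s * y)%g <= eps /\
    \sum_(s <- r) p s * (1 - f (g * (val s * y))%g) <= eps].

Lemma half_unit (x : R) : `|x| <= 1 -> 0 <= (1 + x) / 2 <= 1.
Proof. by rewrite ler_norml => /andP[? ?]; apply/andP; split; lra. Qed.

(** The minimax principle is applied to the unknown made of f = (1 + w) / 2 and of
    one function u_t for each t in ts, the factor 1 / d penalising the lack of
    invariance under ts. If some choice kept the payoff below eps / 3 everywhere,
    averaging it over almost invariant weights would remove the penalty term up to
    eps / 3 and leave a separating function. *)
Lemma minimax_overlap (g : G) (eps d : R) (ts : seq Ls) :
  amenable R Ls -> 0 < eps -> 0 < d ->
  (forall f r p, ~ separating g eps f r p) ->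
  exists (r : seq G) p, prob_weights r p /\
    forall (w : G -> R) (u : Ls -> G -> R), (forall x, `|w x| <= 1) ->
      (forall t x, `|u t x| <= 1) ->
    eps / 3 <= \sum_(x <- r) p x * ((1 + w x) / 2 + (1 - w (g * x)%g) / 2
      - d^-1 * \sum_(t <- ts) (u t x - u t (val t * x)%g)).
Proof.
move=> am eps0 d0 nc.
pose J : choiceType := (option Ls * G)%type.
pose W := prod_topology (fun _ : J => R^o).
pose a x (w : W) : R :=
  1 + (2^-1 * (eval_at (None, x) w + (-1) * eval_at (None, (g * x)%g) w)
   + (- d^-1) * \sum_(t <- ts)
       (eval_at (Some t, x) w + (-1) * eval_at (Some t, (val t * x)%g) w)).
have aE x w : a x w = 1 + (2^-1 * (w (None, x) - w (None, (g * x)%g))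
    - d^-1 * \sum_(t <- ts) (w (Some t, x) - w (Some t, (val t * x)%g))).
  by rewrite /a mulN1r mulNr; under eq_bigr do rewrite mulN1r.
have e3 : 0 < eps * d / 3 by rewrite divr_gt0 ?mulr_gt0.
have [|||r [p [rp H]]] := @cube_minimax R G J a (eps / 3).
- move=> x; apply: contD; first exact: cont_cst.
  apply: contD; apply: contZ.
    by apply: contD; [exact: eval_at_continuous|apply: contZ; exact: eval_at_continuous].
  apply: cont_sum => t.
  by apply: contD; [exact: eval_at_continuous|apply: contZ; exact: eval_at_continuous].
- move=> x; apply: affineD; first exact: affine_cst.
  apply: affineD; apply: affineZ; first by apply: affineD; last (apply: affineZ);
    exact: eval_at_affine.
  by apply: affine_sum => t; apply: affineD; last (apply: affineZ); exact: eval_at_affine.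
- move=> w cw; apply: contrapT => /forallNP H.
  have {}H x : a x w <= eps / 3 by rewrite leNgt; apply/negP; exact: H.
  pose f x := (1 + w (None, x)) / 2.
  have [r [p [rp Hr]]] := amenable_reiter am ts e3.
  have f01 x : 0 <= f x <= 1 by apply: half_unit; exact: cw.
  have p_ge0 s : 0 <= p s by case: rp.
  apply: (nc f r p); split=> // y.
  have := Hr (fun t s => w (Some t, (val s * y)%g)) (fun _ _ => cw _) => {Hr}.
  set Z := \sum_(s <- r) _ => hZ.
  (* At s y the payoff is at most eps / 3; average over s. *)
  have key : \sum_(s <- r) p s * f (val s * y)%g
     + \sum_(s <- r) p s * (1 - f (g * (val s * y))%g) <= eps / 3 + d^-1 * Z.
    rewrite -(prob_weights_const (eps / 3) rp) -big_split/= /Z mulr_sumr -big_split/=.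
    apply: ler_sum => s _.
    rewrite -mulrDr [d^-1 * _]mulrCA -mulrDr ler_wpM2l//.
    have := H (val s * y)%g; rewrite aE /f.
    under [X in _ -> _ <= _ + _ * X]eq_bigr do rewrite -mulgA.
    by set U := \sum_(_ <- _) _; lra.
  have dZ : d^-1 * Z <= eps / 3.
    by rewrite ler_pdivrMl// (le_trans hZ)// mulrA [d * eps]mulrC.
  have s1 : 0 <= \sum_(s <- r) p s * f (val s * y)%g.
    by apply: sumr_ge0 => s _; apply: mulr_ge0 => //; have /andP[] := f01 (val s * y)%g.
  have s2 : 0 <= \sum_(s <- r) p s * (1 - f (g * (val s * y))%g).
    apply: sumr_ge0 => s _; apply: mulr_ge0 => //; rewrite subr_ge0.
    by have /andP[] := f01 (g * (val s * y))%g.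
  by split; lra.
exists r, p; split=> // w u w1 u1.
have cw : cube (fun j : J => if j.1 is Some t then u t j.2 else w j.2).
  by move=> -[[t|] x] /=.
apply: le_trans (H _ cw) _.
apply: ler_sum => x _; rewrite ler_wpM2l//; first by case: rp.
rewrite aE /=.
by set U := \sum_(_ <- _) _; lra.
Qed.

(** The weights p of the previous lemma, tested against the best functions: for the
    indicator of p x < p (g^-1 x) the first part becomes the overlap of p and its
    translate by g, and for signs the penalty becomes 1 / d times the sum of the
    l1 distances between p and its translates. As the overlap is at most 1, these
    distances add up to at most d. *)
Lemma almost_invariant_overlap (g : G) (eps d : R) (ts : seq Ls) :
  amenable R Ls -> 0 < eps -> 0 < d ->
  (forall f r p, ~ separating g eps f r p) ->
  exists (E : seq G) (p : G -> R), [/\ prob_weights E p,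
    forall x, x \notin E -> p (g^-1 * x)%g = 0,
    forall x t, x \notin E -> t \in ts -> p ((val t)^-1 * x)%g = 0,
    eps / 3 <= \sum_(x <- E) Num.min (p x) (p (g^-1 * x)%g) &
    forall t, t \in ts -> \sum_(x <- E) `|p x - p ((val t)^-1 * x)%g| <= d].
Proof.
move=> am eps0 d0 nc.
have [r [p [rp H]]] := minimax_overlap ts am eps0 d0 nc.
have [ur p0 pr p1] := rp.
pose E := undup (r ++ [seq (g * x)%g | x <- r] ++
   flatten [seq [seq (val t * x)%g | x <- r] | t <- ts]).
have uE : uniq E by exact: undup_uniq.
have rE x : x \in r -> x \in E by rewrite mem_undup mem_cat => ->.
have gE x : x \in r -> (g * x)%g \in E.
  by move=> xr; rewrite mem_undup !mem_cat (map_f (fun x => g * x)%g xr) orbT.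
have tE t x : t \in ts -> x \in r -> (val t * x)%g \in E.
  move=> tt xr; rewrite mem_undup !mem_cat; apply/orP; right; apply/orP; right.
  apply/flattenP; exists [seq (val t * x)%g | x <- r].
    exact: (map_f (fun t => [seq (val t * x)%g | x <- r])).
  exact: (map_f (fun x => (val t * x)%g)).
have shift a phi : (forall x, x \in r -> (a * x)%g \in E) ->
  \sum_(x <- r) p x * phi (a * x)%g = \sum_(x <- E) p (a^-1 * x)%g * phi x.
  exact: prob_weights_shift.
have shift1 phi : \sum_(x <- r) p x * phi x = \sum_(x <- E) p x * phi x.
  transitivity (\sum_(x <- r) p x * phi (1 * x)%g).
    by apply: eq_bigr => x _; rewrite mul1g.
  rewrite shift => [|x]; last by rewrite mul1g; exact: rE.
  by apply: eq_bigr => x _; rewrite invg1 mul1g.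
have supp a x : (forall y, y \in r -> (a * y)%g \in E) -> x \notin E ->
  p (a^-1 * x)%g = 0.
  move=> aE xE; apply: pr; apply: contra xE => /aE; by rewrite mulVKg.
have pE : prob_weights E p.
  split=> //.
    by move=> x xE; apply: pr; apply: contra xE; exact: rE.
  have := shift1 (fun=> 1); rewrite (prob_weights_const 1 rp) => h; rewrite [RHS]h.
  by apply: eq_bigr => x _; rewrite mulr1.
exists E, p.
pose w x := if p x < p (g^-1 * x)%g then 1 else -1 : R.
pose u (t : Ls) x := if p ((val t)^-1 * x)%g <= p x then 1 else -1 : R.
have w1 x : `|w x| <= 1 by rewrite /w; case: ifP => _; rewrite ?normrN normr1.
have u1 t x : `|u t x| <= 1 by rewrite /u; case: ifP => _; rewrite ?normrN normr1.
(* With w and u both terms of the payoff are computed over E, which carries p and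
   its translates. *)
have main : eps / 3 <= \sum_(x <- E) Num.min (p x) (p (g^-1 * x)%g)
   - d^-1 * \sum_(t <- ts) \sum_(x <- E) `|p x - p ((val t)^-1 * x)%g|.
  apply: le_trans (H w u w1 u1) _; rewrite le_eqVlt; apply/orP; left; apply/eqP.
  under [LHS]eq_bigr do rewrite mulrBr mulrDr.
  rewrite sumrB big_split/= (shift1 (fun x => (1 + w x) / 2)).
  rewrite (shift g (fun x => (1 - w x) / 2))// -big_split/=; congr (_ - _).
    apply: eq_bigr => x _; rewrite /w minElt; case: ltP => _; by field.
  under [LHS]eq_bigr do rewrite mulrCA.
  rewrite -mulr_sumr; congr (_ * _).
  under [LHS]eq_bigr do rewrite mulr_sumr.
  rewrite exchange_big/=; apply: eq_big_seq => t tts.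
  under [LHS]eq_bigr do rewrite mulrBr.
  rewrite sumrB (shift1 (u t)) (shift (val t) (u t)); last by move=> x; exact: tE.
  rewrite -sumrB; apply: eq_bigr => x _; rewrite -mulrBl /u.
  by case: lerP => h; ring.
have T0 : 0 <= \sum_(t <- ts) \sum_(x <- E) `|p x - p ((val t)^-1 * x)%g|.
  by apply: sumr_ge0 => t _; apply: sumr_ge0.
have di0 : 0 < d^-1 by rewrite invr_gt0.
have m1 : \sum_(x <- E) Num.min (p x) (p (g^-1 * x)%g) <= 1.
  by rewrite -(let: And4 _ _ _ h := pE in h); apply: ler_sum => x _; rewrite ge_min lexx.
split=> //.
- by move=> x xE; apply: supp.
- by move=> x t xE tt; apply: supp => // y; exact: tE.
- by apply: le_trans main _; rewrite lerBlDr lerDl mulr_ge0// ltW.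
- move=> t tt; apply: (@le_trans _ _
    (\sum_(t <- ts) \sum_(x <- E) `|p x - p ((val t)^-1 * x)%g|)).
    rewrite [leRHS](big_rem t)//= lerDl; apply: sumr_ge0 => ? _; exact: sumr_ge0.
  have : d^-1 * (\sum_(t <- ts) \sum_(x <- E) `|p x - p ((val t)^-1 * x)%g|) <= 1.
    apply: le_trans m1; rewrite -subr_ge0; apply: le_trans main; lra.
  by rewrite ler_pdivrMl// mulr1.
Qed.

End Dichotomy.

(** * Unordered sums *)

#[local] Existing Instance summability.totally_filter.

Section HasSum.
Variables (R : realType) (G : choiceType).
Implicit Types (h k : G -> R[i]) (l : R[i]).

Lemma sum_fset_le (a : G -> R) (A B : {fset G}) : (forall i, 0 <= a i) ->
  (A `<=` B)%fset -> \sum_(i <- A) a i <= \sum_(i <- B) a i.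
Proof.
move=> a0 AB; rewrite (@le_trans _ _ (\sum_(i <- B) if i \in A then a i else 0))//.
  rewrite -(big_fset_incl _ AB); last by move=> i _ /negbTE ->.
  by rewrite le_eqVlt; apply/orP; left; apply/eqP/eq_big_seq => i ->.
by apply: ler_sum => i _; case: ifP.
Qed.

(** Convergence of an unordered sum along the finite sets, spelled out so that the
    algebra of sums needs no filter. *)
Definition has_sum h l := forall e : R, 0 < e ->
  exists J0 : {fset G}, forall J : {fset G}, (J0 `<=` J)%fset ->
    normc (\sum_(i <- J) h i - l) < e.

Lemma normc_real (x : R) : normc x%:C = `|x|.
Proof. by rewrite /normc/= expr0n addr0 sqrtr_sqr. Qed.

Lemma normCE (z : R[i]) : `|z| = (normc z)%:C.
Proof. by []. Qed.

Lemma normc_ge_re (z : R[i]) : `|complex.Re z| <= normc z.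
Proof. by rewrite -lecR; exact: normc_ge_Re. Qed.

Lemma normc_ge_im (z : R[i]) : `|complex.Im z| <= normc z.
Proof.
case: z => a b /=; rewrite -sqrtr_sqr ler_wsqrtr// lerDr; exact: sqr_ge0.
Qed.

Lemma normc_conj (z : R[i]) : normc z^*%R = normc z.
Proof. by apply: complexI; have := norm_conjC z; rewrite !normCE. Qed.

Lemma normc_sub (x y : R[i]) : normc (x - y) = normc (y - x).
Proof. by rewrite -normcN opprB. Qed.

Lemma has_sum_le h l M : has_sum h l ->
  (forall J : {fset G}, normc (\sum_(i <- J) h i) <= M) -> normc l <= M.
Proof.
move=> hl hM; apply/ler_addgt0Pr => e e0.
have [J0 /(_ J0 (fsubset_refl _)) hJ] := hl e e0.
rewrite -(addrNK (\sum_(i <- J0) h i) l); apply: le_trans (le_normcD _ _) _.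
by rewrite addrC lerD// normc_sub ltW.
Qed.

Lemma has_sumD h k l m : has_sum h l -> has_sum k m ->
  has_sum (fun i => h i + k i) (l + m).
Proof.
move=> hl km e e0; have e2 : 0 < e / 2 by rewrite divr_gt0.
have [J1 H1] := hl _ e2; have [J2 H2] := km _ e2.
exists (J1 `|` J2)%fset => J; rewrite fsubUset => /andP[/H1 a1 /H2 a2].
rewrite big_split/= opprD addrACA; apply: le_lt_trans (le_normcD _ _) _; lra.
Qed.

Lemma has_sumZ h l c : has_sum h l -> has_sum (fun i => c * h i) (c * l).
Proof.
move=> hl e e0; have c1 : 0 < normc c + 1 by have := normc_ge0 c; lra.
have [J0 H] := hl (e / (normc c + 1)) (divr_gt0 e0 c1).
exists J0 => J /H; rewrite ltr_pdivlMr// => a.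
rewrite -mulr_sumr -mulrBr normcM mulrC; apply: le_lt_trans a.
by rewrite ler_wpM2l ?normc_ge0// lerDl.
Qed.

Lemma has_sum_conj h l : has_sum h l -> has_sum (fun i => (h i)^*%R) l^*%R.
Proof.
move=> hl e e0; have [J0 H] := hl e e0.
by exists J0 => J /H; rewrite -rmorph_sum -rmorphB normc_conj.
Qed.

Lemma has_sum_unique h l m : has_sum h l -> has_sum h m -> l = m.
Proof.
move=> hl hm; apply/eqP; rewrite -subr_eq0; apply/eqP/eq0_normc/eqP.
rewrite eq_le normc_ge0 andbT.
have hm' := has_sumZ (-1) hm; have := has_sumD hl hm'.
have -> : l + -1 * m = l - m by rewrite mulN1r.
move=> /has_sum_le; apply => J.
rewrite big1 ?normc0// => i _; by rewrite mulN1r subrr.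
Qed.

Lemma has_sum_ge0 (a : G -> R) M : (forall i, 0 <= a i) ->
  (forall J : {fset G}, \sum_(i <- J) a i <= M) ->
  has_sum (fun i => (a i)%:C)
    (sup [set \sum_(i <- J) a i | J in [set: {fset G}]])%:C.
Proof.
move=> a0 aM; set A := [set _ | _ in _].
have supA : has_sup A.
  by split; [exists (\sum_(i <- fset0) a i), fset0|exists M => _ [J _ <-]].
move=> e e0; have [_ [J0 _ <-] hJ0] := sup_adherent e0 supA.
exists J0 => J J0J; rewrite (_ : _ - _ = (\sum_(i <- J) a i - sup A)%:C); last first.
  by rewrite rmorphB rmorph_sum.
rewrite normc_real ler0_norm; last first.
  rewrite subr_le0; apply: ub_le_sup; first exact: supA.2.
  by exists J.
rewrite opprB ltrBlDr -ltrBlDl; apply: lt_le_trans hJ0 _.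
exact: sum_fset_le.
Qed.

(** An absolutely bounded family is a combination of four nonnegative ones, the
    positive and negative parts of its real and imaginary parts. *)
Lemma has_sum_ex h M : (forall J : {fset G}, \sum_(i <- J) normc (h i) <= M) ->
  exists l, has_sum h l.
Proof.
move=> hM.
have part (u : R[i] -> R) : (forall z, 0 <= u z <= normc z) ->
    exists l, has_sum (fun i => (u (h i))%:C) l.
  move=> u01; eexists; apply: (@has_sum_ge0 _ M) => [i|J].
    by have /andP[] := u01 (h i).
  apply: le_trans (hM J); apply: ler_sum => i _; by have /andP[] := u01 (h i).
have [|l1 H1] := part (fun z => Num.max (complex.Re z) 0).
  move=> z; rewrite le_max lexx orbT/= ge_max normc_ge0 andbT.
  exact: le_trans (ler_norm _) (normc_ge_re z).
have [|l2 H2] := part (fun z => Num.max (- complex.Re z) 0).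
  move=> z; rewrite le_max lexx orbT/= ge_max normc_ge0 andbT.
  by apply: le_trans (ler_norm _) _; rewrite normrN; exact: (normc_ge_re z).
have [|l3 H3] := part (fun z => Num.max (complex.Im z) 0).
  move=> z; rewrite le_max lexx orbT/= ge_max normc_ge0 andbT.
  exact: le_trans (ler_norm _) (normc_ge_im z).
have [|l4 H4] := part (fun z => Num.max (- complex.Im z) 0).
  move=> z; rewrite le_max lexx orbT/= ge_max normc_ge0 andbT.
  by apply: le_trans (ler_norm _) _; rewrite normrN; exact: (normc_ge_im z).
have := has_sumD (has_sumD H1 (has_sumZ (-1) H2))
  (has_sumZ 'i (has_sumD H3 (has_sumZ (-1) H4))).
set l := (X in has_sum _ X) => H; exists l; move: H; congr (has_sum _ _).
apply/funext => i; rewrite [RHS]complexE !mulN1r -!rmorphB/=.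
have pn (x : R) : Num.max x 0 - Num.max (- x) 0 = x.
  by rewrite maxC /Num.max; case: ltP => ?; case: ltP => ?; lra.
by rewrite !pn.
Qed.

Lemma sum_has_sum (h : G -> R[i]^o) l : has_sum h l -> summability.sum h = l.
Proof.
move=> hl; rewrite /summability.sum; apply: cvg_lim; first exact: norm_hausdorff.
apply/cvgrPdist_lt => -[e e'] /=; rewrite ltcE/= => /andP[/eqP -> e0].
have [J0 H] := hl e e0; exists J0 => // J /H.
rewrite /summability.partial_sum -(big_seq_fsetE _ _ xpredT h)/= => hJ.
by rewrite distrC normCE ltcR.
Qed.

End HasSum.

(** * The inner product *)

Section Inner.
Variables (R : realType) (G : choiceType).
Implicit Types (f h k : l2 R G) (J : {fset G}).

Lemma sumsq_fset_le (h : G -> R[i]) (J : {fset G}) :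
  ((\sum_(i <- J) normc (h i) ^+ 2)%:E <= sumsq h)%E.
Proof.
rewrite -sumEFin; apply: ereal_sup_ubound; exists [set` J]; first by split.
by rewrite fsbig_finite ?set_fsetK.
Qed.

Lemma sumsq_le (h : G -> R[i]) (M : R) :
  (forall J : {fset G}, \sum_(i <- J) normc (h i) ^+ 2 <= M) -> (sumsq h <= M%:E)%E.
Proof.
move=> hM; apply: ge_ereal_sup => _ [X [finX _] <-].
by rewrite fsbig_finite// sumEFin lee_fin.
Qed.

Lemma l2_sum_le f J : \sum_(i <- J) normc (f i) ^+ 2 <= l2norm f ^+ 2.
Proof. by rewrite -lee_fin sqr_l2norm sumsq_fset_le. Qed.

Lemma l2norm_sqr_le f (M : R) :
  (forall J, \sum_(i <- J) normc (f i) ^+ 2 <= M) -> l2norm f ^+ 2 <= M.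
Proof. by move=> /sumsq_le; rewrite -lee_fin sqr_l2norm. Qed.

Lemma normc_le_l2norm f i : normc (f i) <= l2norm f.
Proof.
rewrite -ler_sqr ?nnegrE ?l2norm_ge0 ?normc_ge0//.
by have := l2_sum_le f [fset i]%fset; rewrite big_seq_fset1.
Qed.

Lemma has_sum_inner f h : has_sum (fun i => f i * (h i)^*%R : R[i]) (inner f h).
Proof.
have [l hl] : exists l, has_sum (fun i => f i * (h i)^*%R : R[i]) l.
  apply: (@has_sum_ex _ _ _ (l2norm f ^+ 2 + l2norm h ^+ 2)) => J.
  apply: le_trans (lerD (l2_sum_le f J) (l2_sum_le h J)).
  rewrite -big_split/=; apply: ler_sum => i _; rewrite normcM normc_conj.
  by have := sqr_ge0 (normc (f i) - normc (h i)); nra.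
by rewrite /inner (sum_has_sum hl).
Qed.

Lemma innerDl f h k : inner (f + h) k = inner f k + inner h k.
Proof.
apply: has_sum_unique (has_sum_inner _ _) _.
rewrite (_ : (fun i => _) = (fun i => f i * (k i)^*%R + h i * (k i)^*%R : R[i])).
  exact: has_sumD (has_sum_inner _ _) (has_sum_inner _ _).
by apply/funext => i; rewrite -mulrDl.
Qed.

Lemma innerZl c f k : inner (c *: f) k = c * inner f k.
Proof.
apply: has_sum_unique (has_sum_inner _ _) _.
rewrite (_ : (fun i => _) = (fun i => c * (f i * (k i)^*%R) : R[i])).
  exact: has_sumZ (has_sum_inner _ _).
by apply/funext => i; rewrite mulrA.
Qed.

Lemma inner_conj f h : (inner f h)^*%R = inner h f.
Proof.
apply: has_sum_unique (has_sum_inner _ _).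
rewrite (_ : (fun i => _) = (fun i => (f i * (h i)^*%R)^*%R : R[i])).
  exact: has_sum_conj (has_sum_inner _ _).
by apply/funext => i; rewrite rmorphM /= conjCK mulrC.
Qed.

Lemma innerDr f h k : inner f (h + k) = inner f h + inner f k.
Proof. by rewrite -inner_conj innerDl rmorphD /= !inner_conj. Qed.

Lemma innerZr c f k : inner f (c *: k) = c^*%R * inner f k.
Proof. by rewrite -inner_conj innerZl rmorphM /= inner_conj. Qed.

Lemma innerNl f k : inner (- f) k = - inner f k.
Proof. by rewrite -scaleN1r innerZl mulN1r. Qed.

Lemma innerBl f h k : inner (f - h) k = inner f k - inner h k.
Proof. by rewrite innerDl innerNl. Qed.

Lemma innerBr f h k : inner f (h - k) = inner f h - inner f k.
Proof. by rewrite -inner_conj innerBl rmorphB /= !inner_conj. Qed.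

Lemma inner_norm f : inner f f = (l2norm f ^+ 2)%:C.
Proof.
have H := @has_sum_ge0 R G (fun i => normc (f i) ^+ 2) _
  (fun i => sqr_ge0 _) (l2_sum_le f).
rewrite (_ : l2norm f ^+ 2 =
    sup [set \sum_(i <- J) normc (f i) ^+ 2 | J in [set: {fset G}]]).
  apply: has_sum_unique (has_sum_inner f f) _.
  rewrite (_ : (fun i => _) = (fun i => (normc (f i) ^+ 2)%:C)) //.
  by apply/funext => i; rewrite -normCK normCE rmorphXn.
apply/eqP; rewrite eq_le; apply/andP; split.
  apply: l2norm_sqr_le => J; apply: ub_le_sup; last by exists J.
  by exists (l2norm f ^+ 2) => _ [K _ <-]; exact: l2_sum_le.
apply: ge_sup; first by exists (\sum_(i <- fset0) normc (f i) ^+ 2), fset0.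
by move=> _ [K _ <-]; exact: l2_sum_le.
Qed.

(** Positivity of the square norm of f - (<f, h> / |h|^2) h. *)
Lemma inner_cauchy_schwarz f h : normc (inner f h) <= l2norm f * l2norm h.
Proof.
have [/eqP/l2norm_eq0 ->|h0] := boolP (l2norm h == 0).
  rewrite -(scale0r 0) innerZr conjC0 mul0r normc0 scale0r.
  by rewrite mulr_ge0 ?l2norm_ge0.
have {}h0 : 0 < l2norm h by rewrite lt_def h0 l2norm_ge0.
set z := inner f h; set b := l2norm h ^+ 2.
have b0 : 0 < b by rewrite exprn_gt0.
pose k := f - (z / b%:C) *: h.
have : 0 <= inner k k by rewrite inner_norm ler0c sqr_ge0.
have bC : b%:C != 0 :> R[i] by rewrite eq_complex /= gt_eqF.
have conjR (x : R) : (x%:C)^*%R = x%:C :> R[i].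
  by apply: CrealP; rewrite complex_real.
have -> : inner k k = (l2norm f ^+ 2)%:C - `|z| ^+ 2 / b%:C.
  rewrite /k innerBl !innerBr !innerZl !innerZr -(inner_conj f h) !inner_norm -/z -/b.
  have -> : (z / b%:C)^*%R = z^*%R / b%:C 
    by rewrite -fmorphV; apply: etrans (rmorphM _ _ _) _; congr (_ * _); exact: conjR.
  by rewrite normCK; field.
rewrite normCE -rmorphXn -fmorphV -rmorphM -rmorphB ler0c subr_ge0 ler_pdivrMr//.
by rewrite -exprMn ler_sqr // nnegrE ?mulr_ge0 ?normc_ge0 ?l2norm_ge0.
Qed.

Lemma inner_fin f h (E : seq G) : uniq E -> (forall x, x \notin E -> f x = 0) ->
  inner f h = \sum_(x <- E) f x * (h x)^*%R.
Proof.
move=> uE fE; apply: has_sum_unique (has_sum_inner f h) _ => e e0.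
exists [fset x in E]%fset => J sJ.
rewrite -(big_fset_incl _ sJ) => [|x _]; last first.
  by rewrite !inE => /fE ->; rewrite mul0r.
rewrite (perm_big E)/=; first by rewrite subrr normc0.
by apply: uniq_perm => // x; rewrite inE.
Qed.

Lemma l2norm_fin f (E : seq G) : uniq E -> (forall x, x \notin E -> f x = 0) ->
  l2norm f ^+ 2 = \sum_(x <- E) normc (f x) ^+ 2.
Proof.
move=> uE fE; apply: complexI; rewrite -inner_norm (inner_fin _ uE fE) rmorph_sum.
by apply: eq_bigr => x _; rewrite -normCK normCE rmorphXn.
Qed.

End Inner.

Section Translate.
Variables (R : realType) (G : groupType).
Implicit Types (f h : l2 R G) (g : G).

Lemma has_sum_translate (h : G -> R[i]) l g : has_sum h l ->
  has_sum (fun x => h (g * x)%g) l.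
Proof.
move=> hl e e0; have [J0 H] := hl e e0.
exists [fset (g^-1 * x)%g | x in J0]%fset => J sJ.
have := H [fset (g * x)%g | x in J]%fset; rewrite big_imfset/=;
  last by move=> x y _ _ /mulgI.
apply; apply/fsubsetP => x xJ0; apply/imfsetP; exists (g^-1 * x)%g;
  last by rewrite mulVKg.
by apply: (fsubsetP sJ); apply/imfsetP; exists x.
Qed.

Lemma inner_lambda g f h : inner (lambda R g f) h = inner f (lambda R g^-1%g h).
Proof.
apply: has_sum_unique (has_sum_inner _ _).
rewrite (_ : (fun x => _) = (fun x => (fun y => lambda R g f y * (h y)^*%R) (g * x)%g)).
  exact: has_sum_translate (has_sum_inner _ _).
by apply/funext => x; rewrite /= mulKg invgK.
Qed.

Lemma lambda_adjoint g : adjoint (lambda R g) (lambda R g^-1%g).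
Proof. by move=> f h; exact: inner_lambda. Qed.

End Translate.

(** * Square roots of densities *)

Section SqrtVector.
Variables (R : realType) (G : groupType).

Lemma fin_supp_sum_le (a : G -> R) (E : seq G) : (forall x, 0 <= a x) ->
  uniq E -> (forall x, x \notin E -> a x = 0) ->
  forall J : {fset G}, \sum_(x <- J) a x <= \sum_(x <- E) a x.
Proof.
move=> a0 uE aE J.
have -> : \sum_(x <- E) a x = \sum_(x <- [fset x in E]%fset) a x.
  by apply: perm_big; apply: uniq_perm => [||x]; rewrite ?fset_uniq// inE.
rewrite (big_fset_incl _ (fsubsetUr J [fset x in E]%fset)).
  by apply: sum_fset_le => //; exact: fsubsetUl.
by move=> x _; rewrite inE => /aE.
Qed.

Lemma sqrt_vector (E : seq G) (p : G -> R) : prob_weights E p ->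
  exists xi : l2 R G, forall x, xi x = (Num.sqrt (p x))%:C.
Proof.
move=> [uE p0 pE p1].
have S : square_summable (fun x => (Num.sqrt (p x))%:C : R[i]^o).
  apply: le_lt_trans (ltry 1); apply: sumsq_le => J; rewrite -p1.
  under eq_bigr do rewrite normc_real ger0_norm ?sqrtr_ge0// sqr_sqrtr//.
  exact: fin_supp_sum_le.
by exists (L2 S).
Qed.

(** With the next lemma, this passes from densities to their square roots: close
    densities have close roots, and overlapping densities have non-orthogonal
    roots. *)
Lemma sqr_sqrtB_le (a b : R) : 0 <= a -> 0 <= b ->
  (Num.sqrt a - Num.sqrt b) ^+ 2 <= `|a - b|.
Proof.
move=> a0 b0.
suff H (u v : R) : 0 <= u -> 0 <= v -> (u - v) ^+ 2 <= `|u ^+ 2 - v ^+ 2|.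
  by have := H _ _ (sqrtr_ge0 a) (sqrtr_ge0 b); rewrite !sqr_sqrtr.
move=> u0 v0.
rewrite -(real_normK (num_real (u - v))) expr2 subr_sqr normrM ler_wpM2l//.
by rewrite (ger0_norm (addr_ge0 u0 v0)) ler_norml; apply/andP; split; lra.
Qed.

Lemma min_le_sqrtM (a b : R) : 0 <= a -> 0 <= b ->
  Num.min a b <= Num.sqrt a * Num.sqrt b.
Proof.
move=> a0 b0.
suff H (u v : R) : 0 <= u -> 0 <= v -> Num.min (u ^+ 2) (v ^+ 2) <= u * v.
  by have := H _ _ (sqrtr_ge0 a) (sqrtr_ge0 b); rewrite !sqr_sqrtr.
move=> u0 v0.
rewrite ge_min; case: (lerP u v) => uv; apply/orP; [left|right]; nra.
Qed.

Variables (L : groupClosed G).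
Local Notation Ls := (subgroup_of L).

(** The vector is the square root of the density of [almost_invariant_overlap]. *)
Lemma overlap_vector (g : G) (eps d : R) (ts : seq Ls) :
  amenable R Ls -> 0 < eps -> 0 < d ->
  (forall f r p, ~ @separating R G L g eps f r p) ->
  exists xi : l2 R G, [/\ l2norm xi = 1,
    forall t, t \in ts -> l2norm (lambda R (val t) xi - xi) <= d
    & eps / 3 <= normc (inner (lambda R g xi) xi)].
Proof.
move=> am eps0 d0 nc.
have d20 : 0 < d ^+ 2 by rewrite exprn_gt0.
have [E [p [pE gE tE ming mint]]] := almost_invariant_overlap ts am eps0 d20 nc.
have [xi xiE] := sqrt_vector pE; have [uE p0 pz p1] := pE.
have xi0 x : x \notin E -> xi x = 0 by move=> /pz; rewrite xiE => ->; rewrite sqrtr0.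
exists xi; split.
- apply/eqP; rewrite -(@eqrXn2 _ 2)// ?l2norm_ge0// expr1n (l2norm_fin uE xi0) -p1.
  apply/eqP/eq_bigr => x _.
  by rewrite xiE normc_real ger0_norm ?sqrtr_ge0// sqr_sqrtr.
- move=> t tt; rewrite -(@ler_pXn2r _ 2)// ?nnegrE ?l2norm_ge0 ?(ltW d0)//.
  rewrite (@l2norm_fin _ _ _ E)//; last first.
    move=> x xE; rewrite -[LHS]/(xi ((val t)^-1 * x)%g - xi x) !xiE
        (tE _ _ xE tt) (pz _ xE).
    by rewrite sqrtr0 subrr.
  apply: le_trans (mint t tt); apply: ler_sum => x _.
  rewrite -[X in normc X]/(xi ((val t)^-1 * x)%g - xi x) !xiE -rmorphB normc_real.
  by rewrite real_normK ?num_real// distrC sqr_sqrtB_le.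
- rewrite (@inner_fin _ _ _ _ E)//; last first.
    by move=> x xE; rewrite -[LHS]/(xi (g^-1 * x)%g) xiE gE// sqrtr0.
  rewrite (_ : \sum_(x <- E) _ =
      (\sum_(x <- E) Num.sqrt (p (g^-1 * x)%g) * Num.sqrt (p x))%:C).
    rewrite normc_real; apply: le_trans (ler_norm _); apply: le_trans ming _.
    by apply: ler_sum => x _; rewrite mulrC min_le_sqrtM.
  rewrite rmorph_sum; apply: eq_bigr => x _; rewrite rmorphM.
  rewrite -[lambda R g xi x]/(xi (g^-1 * x)%g) !xiE; congr (_ * _).
  by apply: CrealP; rewrite complex_real.
Qed.

(** The last of the four conditions, for a single g. *)
Definition vanishing_coefficients (g : G) :=
  forall (I : Type) (le : I -> I -> Prop) (xi : I -> l2 R G),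
    directed le -> almost_invariant L le xi ->
    (inner (lambda R g (xi n)) (xi n) : R[i]^o) @[n --> tails le] --> (0 : R[i]^o).

Lemma directed_filter (I : Type) (le : I -> I -> Prop) : directed le ->
  ProperFilter (tails le).
Proof.
move=> [[i0 _] refl trans dir].
apply: filter_from_proper; last by move=> i _; exists i => /=.
apply: filter_fromT_filter; first by exists i0.
move=> i j; have [k [ik jk]] := dir i j.
by exists k => l /= kl; split; [exact: trans ik kl|exact: trans jk kl].
Qed.

(** Otherwise [overlap_vector] gives, for every finite list of elements of L and
    every precision, a vector whose coefficient at g is at least eps / 3; directed
    by inclusion and precision, these vectors form an almost invariant net. *)
Lemma vanishing_separating (g : G) (eps : R) : amenable R Ls -> 0 < eps ->
  vanishing_coefficients g -> exists f r p, @separating R G L g eps f r p.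
Proof.
move=> am eps0 van; apply: contrapT => nc.
have {}nc f r p : ~ @separating R G L g eps f r p by move=> ?; apply: nc; exists f, r, p.
pose I := (seq Ls * nat)%type.
pose le (i j : I) := {subset i.1 <= j.1} /\ (i.2 <= j.2)%N.
have d0 n : 0 < n.+1%:R^-1 :> R by rewrite invr_gt0 ltr0n.
pose xi (i : I) := projT1 (cid (@overlap_vector g eps _ i.1 am eps0 (d0 i.2) nc)).
have xiP (i : I) : [/\ l2norm (xi i) = 1,
    forall t, t \in i.1 -> l2norm (lambda R (val t) (xi i) - xi i) <= i.2.+1%:R^-1
    & eps / 3 <= normc (inner (lambda R g (xi i)) (xi i))].
  by rewrite /xi; case: cid.
have dir : directed le.
  split.
  - by exists ([::], 0%N).
  - by move=> i; split.
  - move=> i j k [ij ij'] [jk jk']; split; last exact: leq_trans ij' jk'.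
    by move=> t /ij /jk.
  - move=> i j; exists (i.1 ++ j.1, maxn i.2 j.2); split; split=> /=.
    + by move=> t ti; rewrite mem_cat ti.
    + exact: leq_maxl.
    + by move=> t ti; rewrite mem_cat ti orbT.
    + exact: leq_maxr.
have FF := directed_filter dir.
have ai : almost_invariant L le xi.
  split=> [i|t tL]; first by have [] := xiP i.
  apply/cvgrPdist_le => e e0.
  have [n _ hn] := near_infty_natSinv_lt (PosNum e0).
  exists ([:: SubgroupOf tL], n) => // i [ti ni] /=.
  rewrite sub0r normrN ger0_norm ?l2norm_ge0//.
  have [_ /(_ (SubgroupOf tL)) h _] := xiP i.
  apply: le_trans (h _) _; first by apply: ti; rewrite mem_head.
  exact/ltW/hn.
have := van I le xi dir ai.
have e3 : 0 < (eps / 3)%:C :> R[i] by rewrite ltcR divr_gt0.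
move=> /cvgrPdist_lt/(_ _ e3) h; have [i hi] := @filter_ex _ _ FF _ h.
have [_ _ hx] := xiP i; move: hi hx.
by rewrite sub0r normrN normCE ltcR leNgt => ->.
Qed.

End SqrtVector.

(** * Norms of averaged conjugates *)

Section ConvexHull.
Variables (R : realType) (M : lmodType R[i]).

(** Convexity over the complex field uses weights of an interval type; for real
    weights it takes the usual form. *)
Lemma convex_setI (A : set M) : @convex_set _ M A ->
  forall (t : R) x y, 0 <= t <= 1 -> A x -> A y ->
    A (t%:C *: x + (1 - t)%:C *: y).
Proof.
move=> cA t x y /andP[t0 t1] Ax Ay.
have t0' : 0 <= t%:C :> R[i] by rewrite ler0c.
have t1' : t%:C <= 1 :> R[i] by rewrite (lecR t 1).
have := cA x y (Itv01 t0' t1') (mem_set Ax) (mem_set Ay) => /set_mem.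
rewrite /conv /=; congr (A (_ + _ *: _)).
by rewrite rmorphB.
Qed.

Lemma convex_setE (A : set M) :
  (forall (t : R) x y, 0 <= t <= 1 -> A x -> A y ->
    A (t%:C *: x + (1 - t)%:C *: y)) -> @convex_set _ M A.
Proof.
move=> H x y l /set_mem Ax /set_mem Ay; apply/mem_set.
have l0 : 0 <= l%:inum by []. have l1 : l%:inum <= 1 by [].
change (A (l%:inum *: x + (1 - l%:inum) *: y)).
move: (l%:inum) l0 l1 => c c0 c1.
have cE : c = (complex.Re c)%:C by rewrite RRe_real// ger0_real.
rewrite cE -(rmorph1 (real_complex R)) -rmorphB; apply: H => //.
by rewrite -(ler0c (complex.Re _)) -(lecR _ 1) -cE c0 c1.
Qed.

(** Induction on the list, for combinations normalised by their partial total
    weight. *)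
Lemma convex_hull_sum (A : set M) (S : eqType) (r : seq S) (p : S -> R) (X : S -> M) :
  (forall s, s \in r -> A (X s)) -> (forall s, 0 <= p s) ->
  \sum_(s <- r) p s = 1 ->
  conv_hull A (\sum_(s <- r) (p s)%:C *: X s).
Proof.
move=> AX p0 p1 C [/= cC AC].
suff H : forall r', {subset r' <= r} -> 0 < \sum_(s <- r') p s ->
    C ((\sum_(s <- r') p s)^-1%:C *: \sum_(s <- r') (p s)%:C *: X s).
  by have := H r (fun x => id); rewrite p1 invr1 scale1r; apply.
elim=> [|s r' IH] sub; first by rewrite big_nil ltxx.
have {}IH := IH (fun x xr => sub x (mem_behead (s := s :: r') xr)).
have CX : C (X s) by apply/AC/AX/sub; rewrite mem_head.
rewrite !big_cons; set P := \sum_(_ <- _) p _ in IH *.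
have P0 : 0 <= P by apply: sumr_ge0.
have [P0'|P0'] := eqVneq P 0.
  rewrite P0' addr0 => ps.
  have z s' : s' \in r' -> p s' = 0.
    move=> s'r; apply/eqP; move/eqP: P0'; rewrite /P psumr_eq0//.
    by move/allP => /(_ s' s'r).
  rewrite [X in _ + X]big_seq big1 ?addr0 => [|s' /z ->]; last by rewrite scale0r.
  by rewrite scalerA -rmorphM mulVf ?gt_eqF// scale1r.
move=> sP.
have {}P0 : 0 < P by rewrite lt_def P0'.
have -> : (p s + P)^-1%:C *: ((p s)%:C *: X s + \sum_(j <- r') (p j)%:C *: X j) =
  (p s / (p s + P))%:C *: X s + (1 - p s / (p s + P))%:C *:
   (P^-1%:C *: \sum_(j <- r') (p j)%:C *: X j).
  rewrite scalerDr !scalerA -!rmorphM [_^-1 * p s]mulrC; congr (_ + _%:C *: _).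
  by field; rewrite !gt_eqF.
apply: convex_setI => //; last exact: IH.
by rewrite divr_ge0 ?(ltW sP)//= ler_pdivrMr// mul1r lerDl ltW.
Qed.

End ConvexHull.

Section Averaging.
Variables (R : realType).

Lemma weighted_cauchy_schwarz (S : Type) (r : seq S) (w a : S ->
  R) : (forall s, 0 <= w s) ->
  (\sum_(s <- r) w s * a s) ^+ 2 <=
  (\sum_(s <- r) w s) * \sum_(s <- r) w s * a s ^+ 2.
Proof.
move=> w0; elim: r => [|s r IH]; first by rewrite !big_nil expr0n mul0r.
rewrite !big_cons.
have W0 : 0 <= \sum_(s <- r) w s by apply: sumr_ge0.
have S0 : 0 <= \sum_(s <- r) w s * a s ^+ 2.
  by apply: sumr_ge0 => j _; rewrite mulr_ge0 ?sqr_ge0.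
move: (\sum_(j <- r) w j * a j ^+ 2) (\sum_(j <- r) w j * a j) (\sum_(j <- r) w j)
  W0 S0 IH => Q M W W0 Q0 IH.
have key : 2 * M * a s <= W * a s ^+ 2 + Q.
  have [W00|Wn0] := eqVneq W 0.
    have : M ^+ 2 <= 0 by move: IH; rewrite W00 mul0r.
    rewrite le_eqVlt ltNge sqr_ge0 orbF sqrf_eq0 => /eqP ->.
    by rewrite W00 mulr0 !mul0r add0r.
  have {}W0 : 0 < W by rewrite lt_def Wn0.
  rewrite -subr_ge0 -(pmulr_rge0 _ W0).
  by have := sqr_ge0 (W * a s - M); nra.
have := ler_wpM2l (w0 s) key; nra.
Qed.

Variables (G : groupType) (L : groupClosed G).
Local Notation Ls := (subgroup_of L).

Definition average_conj (g : G) (r : seq Ls) (p : Ls -> R) : bop R G :=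
  \sum_(s <- r) (p s)%:C *: lambda R ((val s)^-1 * g * val s)%g.

Lemma bop_sumE (S : Type) (r : seq S) (X : S -> bop R G) (xi : l2 R G) x :
  (\sum_(s <- r) X s : bop R G) xi x = \sum_(s <- r) X s xi x.
Proof.
elim: r => [|s r IH]; first by rewrite !big_nil.
by rewrite !big_cons -IH.
Qed.

(** Split 1 as f (s x) + (1 - f (s x)) in front of each term. In the first part the
    weights p s * f (s x) have total at most eps; in the second one the factors
    1 - f (s x) are kept for the summation over x. *)
Lemma separating_pointwise (g : G) eps f r p (xi : l2 R G) x : 0 < eps ->
  @separating R G L g eps f r p ->
  normc (average_conj g r p xi x) ^+ 2 <=
    2 * eps * \sum_(s <- r) p s * normc (xi ((val s)^-1 * g^-1 * val s * x)%g) ^+ 2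
   + 2 * \sum_(s <- r) p s * (1 - f (val s * x)%g) *
       normc (xi ((val s)^-1 * g^-1 * val s * x)%g) ^+ 2.
Proof.
move=> e0 [[_ p0 _ p1] f01 H].
pose a (s : Ls) := normc (xi ((val s)^-1 * g^-1 * val s * x)%g).
have a0 s : 0 <= a s by exact: normc_ge0.
have f0 y : 0 <= f y by have /andP[] := f01 y.
have f1 y : 0 <= 1 - f y by rewrite subr_ge0; have /andP[] := f01 y.
pose A := \sum_(s <- r) p s * f (val s * x)%g * a s.
pose B := \sum_(s <- r) p s * (1 - f (val s * x)%g) * a s.
have A0 : 0 <= A by apply: sumr_ge0 => s _; rewrite !mulr_ge0.
have B0 : 0 <= B by apply: sumr_ge0 => s _; rewrite !mulr_ge0.
have TAB : normc (average_conj g r p xi x) <= A + B.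
  rewrite /average_conj bop_sumE.
  have : normc (\sum_(s <- r)
      ((p s)%:C *: lambda R ((val s)^-1 * g * val s)%g : bop R G) xi x)
    <= \sum_(s <- r) p s * a s.
    elim: (r) => [|s r' IH]; first by rewrite !big_nil normc0.
    rewrite !big_cons; apply: le_trans (le_normcD _ _) (lerD _ IH).
    change (normc ((p s)%:C * xi (((val s)^-1 * g * val s)^-1 * x)%g) <= p s * a s).
    rewrite normcM normc_real ger0_norm// /a !invgM invgK !mulgA.
    by [].
  move/le_trans; apply; rewrite /A /B -big_split/= le_eqVlt; apply/orP; left; apply/eqP.
  by apply: eq_bigr => s _; ring.
have A2 : A ^+ 2 <= eps * \sum_(s <- r) p s * a s ^+ 2.
  apply: le_trans (weighted_cauchy_schwarz r a (fun s => mulr_ge0 (p0 s) (f0 _))) _.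
  apply: ler_pM.
  - by apply: sumr_ge0 => s _; rewrite mulr_ge0.
  - by apply: sumr_ge0 => s _; rewrite !mulr_ge0.
  - by have [] := H x.
  - apply: ler_sum => s _; rewrite ler_wpM2r ?sqr_ge0// ler_piMr//.
    by have /andP[] := f01 (val s * x)%g.
have B2 : B ^+ 2 <= \sum_(s <- r) p s * (1 - f (val s * x)%g) * a s ^+ 2.
  apply: le_trans (weighted_cauchy_schwarz r a (fun s => mulr_ge0 (p0 s) (f1 _))) _.
  apply: ler_piMl; first by apply: sumr_ge0 => s _; rewrite !mulr_ge0.
  rewrite -p1; apply: ler_sum => s _; rewrite ler_piMr//.
  by have := f0 (val s * x)%g; lra.
have : normc (average_conj g r p xi x) ^+ 2 <= (A + B) ^+ 2.
  by rewrite ler_sqr ?nnegrE ?addr_ge0 ?normc_ge0.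
move/le_trans; apply; rewrite -mulrA -mulrDr.
apply: (@le_trans _ _ (2 * (A ^+ 2 + B ^+ 2))); first by have := sqr_ge0 (A - B); nra.
by rewrite ler_wpM2l// lerD.
Qed.

(** In the second part of [separating_pointwise], the substitution
    y = s^-1 g^-1 s x turns f (s x) into f (g s y), so that summing over s first
    produces the second separating inequality at y. *)
Lemma separating_opnorm (g : G) eps f r p : 0 < eps ->
  @separating R G L g eps f r p ->
  opnorm (average_conj g r p) <= Num.sqrt (4 * eps).
Proof.
move=> e0 con; have [[_ p0 _ p1] f01 H] := con.
have f1 y : 0 <= 1 - f y by rewrite subr_ge0; have /andP[] := f01 y.
apply: opnorm_le; first exact: sqrtr_ge0.
move=> xi.
apply: l2norm_le; first by rewrite mulr_ge0 ?sqrtr_ge0 ?l2norm_ge0.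
rewrite -sqr_l2norm lee_fin exprMn [X in _ <= X * _]sqr_sqrtr ?mulr_ge0 ?(ltW e0)//.
apply: l2norm_sqr_le => J.
pose c (s : Ls) : G := ((val s)^-1 * g^-1 * val s)%g.
pose K := [fset y in flatten [seq [seq (c s * x)%g | x <- J] | s <- r]]%fset.
(* For each s the substitution maps J into K. *)
have JK s (h : G -> R) : s \in r -> (forall y, 0 <= h y) ->
    \sum_(x <- J) h (c s * x)%g <= \sum_(y <- K) h y.
  move=> sr h0.
  have -> : \sum_(x <- J) h (c s * x)%g =
      \sum_(y <- [fset (c s * x)%g | x in J]%fset) h y.
    by rewrite big_imfset//= => x y _ _ /mulgI.
  apply: sum_fset_le => //; apply/fsubsetP => _ /imfsetP[x /= xJ ->].
  rewrite inE; apply/flattenP; exists [seq (c s * x)%g | x <- J].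
    exact: (map_f (fun s => [seq (c s * x)%g | x <- J])).
  exact: (map_f (fun x => (c s * x)%g)).
pose n y := normc (xi y) ^+ 2.
have n0 y : 0 <= n y by exact: sqr_ge0.
apply: (@le_trans _ _ (\sum_(x <- J) (2 * eps * \sum_(s <- r) p s * n (c s * x)%g
   + 2 * \sum_(s <- r) p s * (1 - f (val s * x)%g) * n (c s * x)%g))).
  by apply: ler_sum => x _; exact: separating_pointwise con.
rewrite big_split/= -!mulr_sumr.
have -> : 4 * eps * l2norm xi ^+ 2 =
  2 * eps * l2norm xi ^+ 2 + 2 * (eps * l2norm xi ^+ 2) by ring.
apply: lerD.
  rewrite ler_wpM2l ?mulr_ge0 ?(ltW e0)// exchange_big/=.
  rewrite -[leRHS]mul1r -p1 mulr_suml; rewrite big_seq [leRHS]big_seq;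
    apply: ler_sum => s sr.
  rewrite -mulr_sumr ler_wpM2l//.
  exact: le_trans (JK s n sr n0) (l2_sum_le xi K).
rewrite ler_wpM2l// exchange_big/=.
apply: (@le_trans _ _ (\sum_(s <- r) \sum_(y <- K)
    p s * (1 - f (g * (val s * y))%g) * n y)).
  rewrite big_seq [leRHS]big_seq; apply: ler_sum => s sr.
  have := JK s (fun y => p s * (1 - f (g * (val s * y))%g) * n y) sr
    (fun y => mulr_ge0 (mulr_ge0 (p0 s) (f1 _)) (n0 y)).
  apply: le_trans.
  rewrite le_eqVlt; apply/orP; left; apply/eqP; apply: eq_bigr => x _.
  by rewrite /c !mulgA mulgK mulgV mul1g.
rewrite exchange_big/=; apply: (@le_trans _ _ (\sum_(y <- K) eps * n y)).
  apply: ler_sum => y _; rewrite -mulr_suml ler_wpM2r//.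
  by have [] := H y.
by rewrite -mulr_sumr ler_wpM2l ?(ltW e0)//; exact: l2_sum_le.
Qed.

Lemma separating_conv_hull (g : G) :
  (forall eps, 0 < eps -> exists f r p, @separating R G L g eps f r p) ->
  closure (conv_hull [set lambda R (t * g * t^-1)%g | t in [set` L]]) (0 : bop R G).
Proof.
move=> H B /nbhs_ballP[e /= e0 eB].
have eE : e = (complex.Re e)%:C by rewrite RRe_real// gtr0_real.
have {}e0 : 0 < complex.Re e by rewrite -ltcR -eE.
have d0 : 0 < complex.Re e ^+ 2 / 8 by rewrite divr_gt0// exprn_gt0.
have [f [r [p con]]] := H _ d0; have [[_ p0 _ p1] _ _] := con.
exists (average_conj g r p); split.
  apply: convex_hull_sum => // s _ /=; exists (val s)^-1%g; last by rewrite invgK.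
  by rewrite /= gpredV; exact: subgroupP.
apply: eB; rewrite -ball_normE /= sub0r normrN opnormE eE ltcR.
apply: le_lt_trans (separating_opnorm d0 con) _.
rewrite -[ltRHS]ger0_norm ?(ltW e0)// -sqrtr_sqr ltr_sqrt ?exprn_gt0//.
by move: (complex.Re e ^+ 2) (exprn_gt0 2 e0) => z z0; clear -z0; lra.
Qed.

End Averaging.

(** * A singular action built from separating sets *)

(** The pointwise inequality is integrated against mu. *)
Lemma probability_sum_le (d : measure_display) (T : measurableType d) (R : realType)
    (mu : probability T R) (S : Type) (r : seq S) (p : S -> R) (A : S -> set T) (e : R) :
  (forall s, 0 <= p s) -> (forall s, measurable (A s)) ->
  (forall x, \sum_(s <- r) p s * \1_(A s) x <= e) ->
  (\sum_(s <- r) (p s)%:E * mu (A s) <= e%:E)%E.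
Proof.
move=> p0 mA H.
have -> : (\sum_(s <- r) (p s)%:E * mu (A s) =
    \int[mu]_x (\sum_(s <- r) (p s * \1_(A s) x)%:E))%E.
  rewrite ge0_integral_sum//.
  - apply: eq_bigr => s _; under eq_integral do rewrite EFinM.
    rewrite ge0_integralZl//; first by rewrite integral_indic// setIT.
    + by apply/measurable_EFinP; exact: measurable_indic.
    + by rewrite lee_fin.
  - move=> s; apply/measurable_EFinP; apply: measurable_funM => //.
  - by move=> s x _; rewrite lee_fin mulr_ge0.
apply: (@le_trans _ _ (\int[mu]_x (cst e%:E x))%E).
  apply: ge0_le_integral => //.
  - by move=> x _; rewrite sumEFin lee_fin sumr_ge0// => s _; rewrite mulr_ge0.
  - apply: emeasurable_sum => s; apply/measurable_EFinP; apply: measurable_funM => //.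
  - by move=> x _; rewrite sumEFin lee_fin.
have m1 : mu setT = 1%E by exact: probability_setT.
by rewrite integral_cst// -[leRHS]mule1 -m1.
Qed.

Section SubtypeTopology.
Variables (X : topologicalType) (A : set X).

(** A cluster point in A of the image filter is a cluster point in the subtype. *)
Lemma compact_set_type : compact A -> compact [set: set_type A].
Proof.
move=> cA F FF _.
have FA : F (set_val @^-1` A).
  by apply: filterS filterT => x _; exact: (set_mem (valP x)).
have [q [Aq clq]] := cA (set_val @ F) _ FA.
exists (exist _ q (mem_set Aq)); split=> // C D FC.
rewrite nbhsE => -[D' [[W Wop WD] D'q] D'D].
have Wq : nbhs q W.
  by apply: open_nbhs_nbhs; split=> //; have : D' (exist _ q (mem_set Aq)) by [];
    rewrite -WD.
have FC' : F (set_val @^-1` (set_val @` C)) by apply: filterS FC => x Cx /=; exists x.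
have [_ [[x Cx <-] Wx]] := clq _ _ FC' Wq.
by exists x; split=> //; apply: D'D; rewrite -WD.
Qed.

Lemma hausdorff_set_type : hausdorff_space X -> hausdorff_space (set_type A).
Proof.
move=> hX x y xy; apply: val_inj; apply: hX => C D Cx Dy.
have [z [Cz Dz]] := xy _ _ (@initial_continuous _ _ set_val x _ Cx)
   (@initial_continuous _ _ set_val y _ Dy).
by exists (set_val z).
Qed.

Lemma continuous_to_set_type (Y : topologicalType) (f : Y -> set_type A) :
  continuous (set_val \o f) -> continuous f.
Proof.
move=> cf; apply/continuousP => _ [W Wop <-].
by move/continuousP: cf => /(_ _ Wop).
Qed.

End SubtypeTopology.

Section Product.
Variables (I : eqType) (K : I -> topologicalType).

Lemma continuous_to_product (Y : topologicalType) (f : Y -> prod_topology K) :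
  (forall i, continuous (fun y => f y i)) -> continuous f.
Proof.
move=> cf y; apply/cvg_sup => i.
move: y; apply/(@continuousP _ (initial_topology (@^~ i))) => _ [B oB <-].
by move/continuousP: (cf i) => /(_ _ oB).
Qed.

End Product.

Lemma bool_continuous (T : topologicalType) (h : bool -> T) : continuous h.
Proof. by move=> b A nA; apply/principal_filterP; exact: nbhs_singleton nA. Qed.

Lemma borel_preimage (X Y : ptopologicalType) (f : X -> Y) : continuous f ->
  forall A : set (borel Y), measurable A -> measurable (f @^-1` A : set (borel X)).
Proof.
move=> cf; apply: smallest_sub.
  split=> [|A mA|F mF].
  - by rewrite /= preimage_set0; exact: measurable0.
  - by rewrite /= setTD preimage_setC; exact: measurableC.
  - by rewrite /= preimage_bigcup; exact: bigcupT_measurable.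
move=> A Aop; apply: sub_sigma_algebra.
by move/continuousP: cf => /(_ _ Aop).
Qed.

Section Shift.
Variables (R : realType) (G : groupType) (L : groupClosed G).
Local Notation Ls := (subgroup_of L).
Local Notation tol n := (1 / (2 ^ n)%:R : R).

(** The separating inequalities for a set, given by its indicator function phi. *)
Definition admissible (g : G) (e : R) (r : seq Ls) (p : Ls -> R) (phi : G -> bool) :=
  forall y, \sum_(s <- r) p s * (phi (val s * y)%g)%:R <= e /\
    \sum_(s <- r) p s * (~~ phi (g * (val s * y))%g)%:R <= e.

(** Rounding f at 1/2 at most doubles f on the set where f > 1/2, and 1 - f on its
    complement. *)
Lemma separating_admissible (g : G) (e : R) f r p :
  @separating R G L g (e / 2) f r p -> admissible g e r p (fun x => 2^-1 < f x).
Proof.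
move=> [[_ p0 _ _] f01 H] y; have [H1 H2] := H y.
have le2 (z : Ls -> R) (b : Ls -> bool) : (forall s, (b s)%:R <= 2 * z s) ->
    \sum_(s <- r) p s * z s <= e / 2 -> \sum_(s <- r) p s * (b s)%:R <= e.
  move=> bz; rewrite ler_pdivlMr// mulr_suml; apply: le_trans.
  by apply: ler_sum => s _; rewrite -mulrA ler_wpM2l// mulrC.
split; [apply: le2 H1 => s|apply: le2 H2 => s].
  by have /andP[? ?] := f01 (val s * y)%g; case: ltP => /= ?; lra.
by have /andP[? ?] := f01 (g * (val s * y))%g; case: ltP => /= ?; lra.
Qed.

(** One separating set for each g outside L and each of the summable tolerances
    2^-(n+1). Bundling the proofs makes the space built from it a pointed type. *)
Record separating_family := SeparatingFamily {
  fam_set : G * nat -> G -> bool;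
  fam_seq : G * nat -> seq Ls;
  fam_wgt : G * nat -> Ls -> R;
  fam_prob : forall gn, gn.1 \notin L -> prob_weights (fam_seq gn) (fam_wgt gn);
  fam_adm : forall gn, gn.1 \notin L ->
    admissible gn.1 (tol gn.2.+1) (fam_seq gn) (fam_wgt gn) (fam_set gn) }.

Lemma separating_familyP :
  (forall g, g \notin L -> forall eps, 0 < eps ->
    exists f r p, @separating R G L g eps f r p) -> inhabited separating_family.
Proof.
move=> H.
have tol0 n : 0 < tol n by rewrite divr_gt0// ltr0n expn_gt0.
have /choice[D HD] : forall gn : G * nat, exists D : (G -> bool) * seq Ls * (Ls -> R),
    gn.1 \notin L -> prob_weights D.1.2 D.2 /\
      admissible gn.1 (tol gn.2.+1) D.1.2 D.2 D.1.1.
  move=> [g n] /=; have [gL|gL] := boolP (g \in L).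
    by exists (fun=> true, [::], fun=> 0).
  have [f [r [p con]]] := H g gL _ (divr_gt0 (tol0 n.+1) (ltr0n R 2)).
  exists ((fun x => 2^-1 < f x), r, p) => _ /=; split; first by case: con.
  exact: separating_admissible con.
apply: inhabits; apply: (@SeparatingFamily (fun gn => (D gn).1.1)
  (fun gn => (D gn).1.2) (fun gn => (D gn).2)) => gn /HD[] //.
Qed.

Variable D : separating_family.

(** All families of subsets of G, indexed like those of a separating family and
    encoded by their indicator functions. *)
Definition shift_config : Type := prod_topology (fun _ : G * nat * G => bool).
HB.instance Definition _ := Pointed.on shift_config.
HB.instance Definition _ := Nbhs.on shift_config.
HB.instance Definition _ := Topological.on shift_config.

(** The families that satisfy the same inequalities as the given one. They form a
    closed set, each inequality involving finitely many coordinates, and are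
    preserved by right translations, because the inequalities are required at all
    points and only involve left multiplications. *)
Definition shift_set : set shift_config := [set phi | forall gn, gn.1 \notin L ->
  admissible gn.1 (tol gn.2.+1) (fam_seq D gn) (fam_wgt D gn) (fun y => phi (gn, y))].

Definition shift_space : Type := set_type shift_set.
HB.instance Definition _ := Topological.on shift_space.

Lemma shift_point_proof : (fun j => fam_set D j.1 j.2) \in shift_set.
Proof. by apply/mem_set => gn; exact: fam_adm. Qed.

Definition shift_point : shift_space :=
  exist (fun phi => phi \in shift_set) _ shift_point_proof.

HB.instance Definition _ := isPointed.Build shift_space shift_point.

Lemma config_coord_continuous j : continuous (fun phi : shift_config => phi j).
Proof. exact: (@proj_continuous _ (fun=> bool) j). Qed.

Lemma closed_shift_set : closed shift_set.
Proof.
pose S1 (h : bool -> bool) (k : Ls -> G) (gn : G * nat) :=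
  [set phi : shift_config | \sum_(s <- fam_seq D gn) fam_wgt D gn s *
     (h (phi (gn, k s)))%:R <= tol gn.2.+1].
have cS1 h k gn : closed (S1 h k gn).
  apply: (@closed_comp _ _ (fun phi : shift_config =>
      \sum_(s <- fam_seq D gn) fam_wgt D gn s *
     (h (phi (gn, k s)))%:R) [set x | x <= tol gn.2.+1]); last exact: closed_le.
  move=> phi _; move: phi; apply: cont_sum => s; apply: contZ => phi.
  apply: (@continuous_comp shift_config bool R (fun phi => phi (gn, k s))
    (fun b => (h b)%:R)); first exact: config_coord_continuous.
  exact: bool_continuous.
have -> : shift_set = \bigcap_(gn in [set gn | gn.1 \notin L]) \bigcap_y
    (S1 id (fun s => val s * y)%g gn `&` S1 negb (fun s => gn.1 * (val s * y))%g gn).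
  apply/seteqP; split=> [phi H gn gnL y _|phi H gn gnL y].
    exact: (H gn gnL y).
  exact: (H gn gnL y I).
apply: closed_bigI => gn _; apply: closed_bigI => y _.
by apply: closedI; exact: cS1.
Qed.

Lemma compact_shift_space : compact [set: shift_space].
Proof.
apply: compact_set_type; apply: (@subclosed_compact _ _ setT) => //.
  exact: closed_shift_set.
have := @tychonoff (G * nat * G)%type (fun=> bool) (fun=> setT) (fun=> bool_compact).
by congr (compact _); rewrite eqEsubset.
Qed.

Lemma hausdorff_shift_space : hausdorff_space shift_space.
Proof.
apply: hausdorff_set_type; apply: hausdorff_product => ?; exact: discrete_hausdorff.
Qed.

Lemma shift_act_proof (a : G) (x : shift_space) :
  (fun j => val x (j.1, j.2 * a)%g) \in shift_set.
Proof.
apply/mem_set => gn gnL y; have /set_mem/(_ gn gnL (y * a)%g) := valP x.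
move=> [h1 h2]; split; [apply: le_trans h1|apply: le_trans h2];
  by apply: ler_sum => s _; rewrite /= !mulgA.
Qed.

Definition shift_act (a : G) (x : shift_space) : shift_space :=
  exist (fun phi => phi \in shift_set) _ (shift_act_proof a x).

Lemma shift_val_continuous j : continuous (fun x : shift_space => val x j).
Proof.
move=> x; apply: (@continuous_comp _ _ _ (set_val : shift_space -> shift_config)
  (fun phi : shift_config => phi j)); last exact: config_coord_continuous.
exact: initial_continuous.
Qed.

Lemma shift_action : continuous_action shift_act.
Proof.
split=> [x|g h x|g].
- by apply/val_inj/funext => -[j y] /=; rewrite mulg1.
- by apply/val_inj/funext => -[j y] /=; rewrite mulgA.
- apply: continuous_to_set_type; apply: continuous_to_product => j.
  exact: shift_val_continuous.
Qed.

(** This event plays the role of the separating set itself: the translates of a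
    configuration move every coordinate to the unit. *)
Definition coord_true (gn : G * nat) : set (borel shift_space) :=
  [set x : shift_space | val x (gn, 1%g)].

Lemma open_val j (b : bool) : open [set x : shift_space | val x j = b].
Proof.
have /continuousP/(_ [set b]) := @shift_val_continuous j; apply.
exact: discrete_open.
Qed.

Lemma measurable_coord_true gn : measurable (coord_true gn).
Proof. by apply: sub_sigma_algebra; exact: open_val. Qed.

(** For an L-invariant mu all the events occurring in an averaged inequality have
    the same measure. At the unit, the inequalities therefore say that
    [coord_true (g, n)] has measure at most 2^-(n+1) for mu, and its complement for
    the translate of mu by g. By the Borel-Cantelli lemma the upper limit of these
    events is null for mu, and its complement is null for the translate. *)
Lemma singular_shift : singular_wrt R L shift_act.
Proof.
move=> mu [_ inv] g gL.
pose E n := coord_true (g, n).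
have mE n : measurable (E n) by exact: measurable_coord_true.
have mact h (A : set (borel shift_space)) : measurable A ->
  measurable (shift_act h @^-1` A : set (borel shift_space)).
  by apply: borel_preimage; have [_ _] := shift_action.
have prob n : prob_weights (fam_seq D (g, n)) (fam_wgt D (g, n)) by exact: fam_prob.
have key n (A : set (borel shift_space)) : measurable A ->
    (forall x, \sum_(s <- fam_seq D (g, n)) fam_wgt D (g, n) s *
       \1_(shift_act (val s) @^-1` A) x <= tol n.+1) ->
    (mu A <= (tol n.+1)%:E)%E.
  move=> mA H; have [_ p0 _ p1] := prob n.
  have := probability_sum_le mu p0 (fun s : Ls => mact (val s) A mA) H.
  apply: le_trans; rewrite (eq_bigr (fun s => (fam_wgt D (g, n) s)%:E * mu A)%E).
    rewrite -ge0_sume_distrl; last by move=> s _; rewrite lee_fin.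
    by rewrite sumEFin p1 mul1e.
  move=> s _; congr (_ * _)%E; exact: (inv (val s) (subgroupP s) A mA).
(* The inequalities at the unit, averaged over L, for the event and its complement. *)
have muE n : (mu (E n) <= (tol n.+1)%:E)%E.
  apply: key => // x; have /set_mem/(_ (g, n) gL 1%g)[+ _] := valP x.
  apply: le_trans; apply: ler_sum => s _; rewrite ler_wpM2l//; first by case: (prob n).
  rewrite indicE ler_nat; case: (boolP (_ \in _)) => // /set_mem /=.
  by rewrite /E /coord_true /= mul1g mulg1 => ->.
have gmuE n : (mu (shift_act g @^-1` (~` E n)) <= (tol n.+1)%:E)%E.
  apply: key; first by apply: mact; exact: measurableC.
  move=> x; have /set_mem/(_ (g, n) gL 1%g)[_] := valP x.
  apply: le_trans; apply: ler_sum => s _; rewrite ler_wpM2l//; first by case: (prob n).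
  rewrite indicE ler_nat; case: (boolP (_ \in _)) => // /set_mem /=.
  by rewrite /E /coord_true /= mul1g mulg1 => /negP/negbTE ->.
have sum_tol (F : (set (borel shift_space))^nat) :
    (forall n, (mu (F n) <= (tol n.+1)%:E)%E) ->
   (\sum_(n <oo) mu (F n) < +oo)%E.
  move=> H; apply: (@le_lt_trans _ _ (\sum_(n <oo) (tol n.+1)%:E)%E).
    by apply: lee_nneseries => n _ //; exact: H.
  by apply: le_lt_trans (epsilon_trick0 xpredT ler01) _; rewrite ltry.
have mgE n : measurable (shift_act g @^-1` (~` E n) : set (borel shift_space)).
  by apply: mact; exact: measurableC.
have mlim (F : (set (borel shift_space))^nat) : (forall n, measurable (F n)) ->
    measurable (lim_sup_set F).
  move=> mF; apply: bigcapT_measurable => n; apply: bigcup_measurable => k _; exact: mF.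
exists (~` lim_sup_set E); split.
- by apply: measurableC; exact: mlim.
- have z := lim_sup_set_cvg0 mgE (sum_tol _ gmuE).
  change (mu (shift_act g @^-1` (~` lim_sup_set E)) = 0%E).
  apply/eqP; rewrite eq_le; apply/andP; split; last exact: measure_ge0.
  rewrite -z; apply: le_measure.
  + by apply/mem_set; apply: mact; apply: measurableC; exact: mlim.
  + by apply/mem_set; exact: mlim.
  + move=> x /= nx m _; apply: contrapT => h; apply: nx => k _.
    exists (maxn k m) => /=; first exact: leq_maxl.
    apply: contrapT => h'; apply: h; exists (maxn k m) => //=; exact: leq_maxr.
- by rewrite setCK; exact: lim_sup_set_cvg0 (sum_tol _ muE).
Qed.

End Shift.

Lemma separating_singular (R : realType) (G : groupType) (L : groupClosed G) :
  (forall g, g \notin L -> forall eps : R, 0 < eps ->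
    exists f r p, @separating R G L g eps f r p) ->
  singular_subgroup R L.
Proof.
move=> /separating_familyP[D].
exists (shift_space D), (@shift_act R G L D); split.
- exact: compact_shift_space.
- exact: hausdorff_shift_space.
- exact: shift_action.
- exact: singular_shift.
Qed.

(** * Completeness of the Hilbert space *)

Section Geometric.
Variables (R : realType) (C r : R).
Hypotheses (C0 : 0 <= C) (r0 : 0 <= r) (r1 : r < 1).
Local Notation K := (C / (1 - r)).

Lemma geometric_KS n : K * r ^+ n.+1 = K * r ^+ n - C * r ^+ n.
Proof. by rewrite exprS; field; rewrite subr_eq0 gt_eqF. Qed.

Lemma geometric_K_ge0 : 0 <= K.
Proof. by rewrite divr_ge0// subr_ge0 ltW. Qed.

Lemma geometric_small e : 0 < e -> exists N, forall n, (N <= n)%N -> r ^+ n < e.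
Proof.
move=> e0; have : (fun n => r ^+ n) @ \oo --> (0 : R).
  by apply: cvg_expr; rewrite ger0_norm.
move=> /cvgrPdist_lt/(_ e e0)[N _ HN]; exists N => n Nn.
by have := HN n Nn; rewrite /= sub0r normrN ger0_norm// exprn_ge0.
Qed.

Lemma geometric_le0 (a M : R) : (forall n, a <= M * r ^+ n) -> a <= 0.
Proof.
move=> H; apply/ler_addgt0Pr => e e0; rewrite add0r.
have M0 : 0 < `|M| + 1 by have := normr_ge0 M; lra.
have [N HN] := geometric_small (divr_gt0 e0 M0).
have := HN N (leqnn N); rewrite ltr_pdivlMr// => h.
apply: le_trans (H N) _; apply: le_trans (ltW h).
have := exprn_ge0 N r0; move: (r ^+ N) => z z0; have := ler_norm M; nra.
Qed.

(** The intervals of radius K r^n around u n are nested; the limit is the supremum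
    of their left ends. *)
Lemma geometric_limit (u : nat -> R) : (forall n, `|u n.+1 - u n| <= C * r ^+ n) ->
  exists l, forall n, `|l - u n| <= K * r ^+ n.
Proof.
move=> H.
have lo n m : (n <= m)%N -> u n - K * r ^+ n <= u m - K * r ^+ m.
  elim: m => [|m IH]; first by rewrite leqn0 => /eqP ->.
  rewrite leq_eqVlt => /orP[/eqP -> //|/IH/le_trans]; apply.
  have := H m; rewrite ler_norml => /andP[h _].
  by rewrite geometric_KS; lra.
have hi n m : (n <= m)%N -> u m + K * r ^+ m <= u n + K * r ^+ n.
  elim: m => [|m IH]; first by rewrite leqn0 => /eqP ->.
  rewrite leq_eqVlt => /orP[/eqP -> //|/IH]; apply: le_trans.
  have := H m; rewrite ler_norml => /andP[_ h].
  by rewrite geometric_KS; lra.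
have Kr n : 0 <= K * r ^+ n by rewrite mulr_ge0 ?exprn_ge0// geometric_K_ge0.
have lohi n m : u n - K * r ^+ n <= u m + K * r ^+ m.
  have /orP[nm|mn] := leq_total n m.
    by have := lo _ _ nm; have := Kr m; lra.
  by have := hi _ _ mn; have := Kr n; lra.
pose A := [set u n - K * r ^+ n | n in [set: nat]].
have A0 : A !=set0 by exists (u 0%N - K * r ^+ 0%N), 0%N.
exists (sup A) => n; rewrite ler_norml; apply/andP; split.
  suff : u n - K * r ^+ n <= sup A by lra.
  apply: ub_le_sup; last by exists n.
  by exists (u 0%N + K * r ^+ 0%N) => _ [k _ <-].
suff : sup A <= u n + K * r ^+ n by lra.
by apply: ge_sup => // _ [k _ <-].
Qed.

Lemma geometric_dist (d : nat -> nat -> R) :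
  (forall n, d n n = 0) -> (forall n m, d n m.+1 <= d n m + d m m.+1) ->
  (forall n, d n n.+1 <= C * r ^+ n) -> forall n m, (n <= m)%N -> d n m <= K * r ^+ n.
Proof.
move=> d0 tri H n m nm.
suff : d n m <= K * r ^+ n - K * r ^+ m.
  have : 0 <= K * r ^+ m by rewrite mulr_ge0 ?exprn_ge0// geometric_K_ge0.
  lra.
elim: m nm => [|m IH]; first by rewrite leqn0 => /eqP ->; rewrite d0 subrr.
rewrite leq_eqVlt => /orP[/eqP ->|/IH h]; first by rewrite d0 subrr.
apply: le_trans (tri _ _) _; have := H m; rewrite geometric_KS; lra.
Qed.

Variables (G : choiceType).
Implicit Types (f : nat -> l2 R G).

Lemma l2norm_sub (x y : l2 R G) : l2norm (x - y) = l2norm (y - x).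
Proof. by rewrite -opprB -scaleN1r l2normZ normcN normc1 mul1r. Qed.

Lemma normcD_sqr_le (x y : R[i]) :
  normc (x + y) ^+ 2 <= 2 * normc x ^+ 2 + 2 * normc y ^+ 2.
Proof. by have := normc_sqrD x y (@ltr01 R); rewrite invr1. Qed.

(** Completeness for sequences with geometrically decreasing steps. The limit is
    taken pointwise; the norm estimate is first proved on finite sets, comparing
    with a far term of the sequence, where crude constants suffice. *)
Lemma l2_complete f : (forall n, l2norm (f n.+1 - f n) <= C * r ^+ n) ->
  exists g, forall n, l2norm (g - f n) <= 2 * K * r ^+ n.
Proof.
move=> H.
have Hx n x : normc (f n.+1 x - f n x) <= C * r ^+ n.
  exact: le_trans (normc_le_l2norm (f n.+1 - f n) x) (H n).
have Hre x : exists a, forall n, `|a - complex.Re (f n x)| <= K * r ^+ n.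
  apply: geometric_limit => n; apply: le_trans (Hx n x).
  by rewrite -raddfB; exact: normc_ge_re.
have Him x : exists a, forall n, `|a - complex.Im (f n x)| <= K * r ^+ n.
  apply: geometric_limit => n; apply: le_trans (Hx n x).
  by rewrite -raddfB; exact: normc_ge_im.
have [a Ha] := choice Hre; have [b Hb] := choice Him.
pose g0 x : R[i]^o := (a x +i* b x).
have g0f n x : normc (g0 x - f n x) <= 2 * K * r ^+ n.
  rewrite [X in normc X](_ : _ =
      (a x - complex.Re (f n x))%:C + 'i * (b x - complex.Im (f n x))%:C); last first.
    by rewrite [LHS]complexE !raddfB.
  apply: le_trans (le_normcD _ _) _; rewrite normcM !normc_real.
  have -> : normc ('i : R[i]) = 1 by rewrite /= expr0n add0r expr1n sqrtr1.
  by have := Ha x n; have := Hb x n; lra.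
have fd n m : (n <= m)%N -> l2norm (f m - f n) <= K * r ^+ n.
  move=> nm; apply: (@geometric_dist (fun n m => l2norm (f m - f n))) => //.
    by move=> k; rewrite subrr l2norm0.
  move=> k l; rewrite [leRHS]addrC (_ : f l.+1 - f k = (f l.+1 - f l) + (f l - f k)).
    exact: ler_l2normD.
  by rewrite addrA subrK.
(* Compare with the term of index m = n + k and let k grow. *)
have fatou n (J : {fset G}) :
    \sum_(x <- J) normc (g0 x - f n x) ^+ 2 <= 2 * (K * r ^+ n) ^+ 2.
  rewrite -subr_le0.
  apply: (@geometric_le0 _ ((\sum_(x <- J) 2 * (2 * K) ^+ 2) * r ^+ n)) => k.
  rewrite -[leRHS]mulrA -exprD; set m := (n + k)%N;
    have nm : (n <= m)%N by exact: leq_addr.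
  rewrite lerBlDr; apply: (@le_trans _ _ (\sum_(x <- J)
       (2 * normc (g0 x - f m x) ^+ 2 + 2 * normc (f m x - f n x) ^+ 2))).
    apply: ler_sum => x _; apply: le_trans (normcD_sqr_le _ _).
    by rewrite addrA subrK.
  rewrite big_split/= lerD//.
    rewrite mulr_suml; apply: ler_sum => x _; rewrite -mulrA ler_wpM2l//.
    apply: (@le_trans _ _ ((2 * K * r ^+ m) ^+ 2)).
      by rewrite !expr2 ler_pM ?normc_ge0.
    rewrite exprMn ler_wpM2l ?sqr_ge0// expr2 ler_piMl ?exprn_ge0//.
    by rewrite exprn_ile1// ltW.
  rewrite -mulr_sumr ler_wpM2l//; apply: le_trans (l2_sum_le (f m - f n) J) _.
  rewrite ler_sqr ?nnegrE ?l2norm_ge0//; first exact: fd.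
  by rewrite mulr_ge0 ?exprn_ge0 ?geometric_K_ge0.
have S : square_summable (fun x => g0 x - f 0%N x : R[i]^o).
  by apply: le_lt_trans (sumsq_le (fatou 0%N)) _; rewrite ltry.
exists (L2 S + f 0%N) => n.
have E x : (L2 S + f 0%N - f n) x = g0 x - f n x.
  by change (g0 x - f 0%N x + f 0%N x - f n x = g0 x - f n x); rewrite subrK.
have Kr : 0 <= K * r ^+ n by rewrite mulr_ge0 ?exprn_ge0 ?geometric_K_ge0.
rewrite -ler_sqr ?nnegrE ?l2norm_ge0//; last by rewrite -mulrA mulr_ge0.
apply: (@le_trans _ _ (2 * (K * r ^+ n) ^+ 2)).
  apply: l2norm_sqr_le => J; apply: le_trans (fatou n J).
  by apply: ler_sum => x _; rewrite E.
by rewrite -mulrA; move: (K * r ^+ n) Kr => z z0; nra.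
Qed.

End Geometric.

(** * Bounded operators and square roots *)

Section Operators.
Variables (R : realType) (G : choiceType).
Local Notation B := (bop R G).
Implicit Types (S T U : B) (A : set B).

Lemma bop_ext S T : (forall x, S x = T x) -> S = T.
Proof. by move=> ST; apply/val_inj/funext. Qed.

Lemma bopDE S T x : (S + T : B) x = S x + T x. Proof. by []. Qed.
Lemma bopZE (a : R[i]) S x : (a *: S : B) x = a *: S x. Proof. by []. Qed.
Lemma bop_compE S T x : bop_comp S T x = S (T x). Proof. by []. Qed.
Lemma bop_idE x : bop_id R G x = x. Proof. by []. Qed.
Lemma bop0E x : (0 : B) x = 0. Proof. by []. Qed.
Lemma bopNE S x : (- S : B) x = - S x. Proof. by []. Qed.

Lemma opnormN T : opnorm (- T) = opnorm T.
Proof. by rewrite -scaleN1r opnormZ normcN normc1 mul1r. Qed.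

Lemma opnorm_sub S T : opnorm (S - T) = opnorm (T - S).
Proof. by rewrite -opnormN opprB. Qed.

Lemma opnorm_comp S T : opnorm (bop_comp S T) <= opnorm S * opnorm T.
Proof.
apply: opnorm_le; first by rewrite mulr_ge0 ?opnorm_ge0.
move=> x /=; apply: le_trans (le_opnorm _ _) _.
by rewrite -mulrA ler_wpM2l ?opnorm_ge0 ?le_opnorm.
Qed.

Lemma bop_compBl S T U : bop_comp (S - T) U = bop_comp S U - bop_comp T U.
Proof. exact: bop_ext. Qed.

Lemma bop_compBr S T U : bop_comp S (T - U) = bop_comp S T - bop_comp S U.
Proof. by apply: bop_ext => x; rewrite /= raddfB. Qed.

Lemma inner0l (x : l2 R G) : inner 0 x = 0.
Proof. by rewrite -(scale0r x) innerZl mul0r. Qed.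

Lemma inner0r (x : l2 R G) : inner x 0 = 0.
Proof. by rewrite -inner_conj inner0l conjC0. Qed.

Lemma adjoint_sym S T : adjoint S T -> adjoint T S.
Proof. by move=> ST x y; rewrite -inner_conj -ST inner_conj. Qed.

Lemma adjointD S S' T T' : adjoint S S' -> adjoint T T' -> adjoint (S + T) (S' + T').
Proof. by move=> hS hT x y; rewrite !bopDE innerDl innerDr hS hT. Qed.

Lemma adjointZ (a : R[i]) S S' : adjoint S S' -> adjoint (a *: S) (a^*%R *: S').
Proof. by move=> hS x y; rewrite !bopZE innerZl innerZr hS conjCK. Qed.

Lemma adjoint_comp S S' T T' : adjoint S S' -> adjoint T T' ->
  adjoint (bop_comp S T) (bop_comp T' S').
Proof. by move=> hS hT x y; rewrite /= hS hT. Qed.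

Lemma adjoint_id : adjoint (bop_id R G) (bop_id R G).
Proof. by move=> x y; exact: erefl. Qed.

Lemma adjointN S S' : adjoint S S' -> adjoint (- S) (- S').
Proof.
move=> h; rewrite -(scaleN1r S) -(scaleN1r S'); have := adjointZ (-1) h.
by rewrite rmorphN1.
Qed.

Lemma opnorm_adjoint_le S T : adjoint S T -> opnorm T <= opnorm S.
Proof.
move=> ST; apply: opnorm_le; first exact: opnorm_ge0.
move=> y; have [->|ty] := eqVneq (l2norm (T y)) 0.
  by rewrite mulr_ge0 ?opnorm_ge0 ?l2norm_ge0.
have {}ty : 0 < l2norm (T y) by rewrite lt_def ty l2norm_ge0.
rewrite -(ler_pM2l ty).
have -> : l2norm (T y) * l2norm (T y) = normc (inner (T y) (T y)).
  by rewrite inner_norm normc_real ger0_norm ?sqr_ge0.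
rewrite -ST; apply: le_trans (inner_cauchy_schwarz _ _) _.
rewrite [leRHS]mulrA [X in _ <= X * _]mulrC.
by rewrite ler_wpM2r ?l2norm_ge0// le_opnorm.
Qed.

Lemma closed_approx A T : closed A ->
  (forall e, 0 < e -> exists2 S, A S & opnorm (T - S) < e) -> A T.
Proof.
move=> cA H; apply: cA => V /nbhs_ballP[e /= e0 eV].
have eE : e = (complex.Re e)%:C by rewrite RRe_real// gtr0_real.
have {}e0 : 0 < complex.Re e by rewrite -ltcR -eE.
have [S AS hS] := H _ e0; exists S; split=> //; apply: eV.
by rewrite -ball_normE /= opnormE eE ltcR.
Qed.

(** The limit is taken at each vector, and inherits linearity and boundedness. *)
Lemma bop_complete (C r : R) (T : nat -> B) : 0 <= C -> 0 <= r -> r < 1 ->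
  (forall n, opnorm (T n.+1 - T n) <= C * r ^+ n) ->
  exists U, forall n, opnorm (U - T n) <= 2 * (C / (1 - r)) * r ^+ n.
Proof.
move=> C0 r0 r1 H.
have pt x : exists y,
    forall n, l2norm (y - T n x) <= 2 * (C / (1 - r)) * l2norm x * r ^+ n.
  have [||y Hy] := @l2_complete R (C * l2norm x) r _ r0 r1 G (fun n => T n x).
  - by rewrite mulr_ge0 ?l2norm_ge0.
  - move=> n; apply: le_trans (le_opnorm (T n.+1 - T n) x) _.
    by rewrite mulrAC ler_wpM2r ?l2norm_ge0.
  exists y => n; apply: le_trans (Hy n) _; rewrite le_eqVlt; apply/orP; left; apply/eqP.
  by ring.
have [U HU] := choice pt; set K := 2 * (C / (1 - r)) in HU *.
have K0 : 0 <= K by rewrite mulr_ge0 ?geometric_K_ge0.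
have linU : linear U.
  move=> a x y; apply/eqP; rewrite -subr_eq0; apply/eqP/l2norm_eq0/eqP.
  rewrite eq_le l2norm_ge0 andbT.
  apply: (@geometric_le0 _ r r0 r1 _ (K * l2norm (a *: x + y) +
    (normc a * (K * l2norm x) + K * l2norm y))) => n.
  have -> : U (a *: x + y) - (a *: U x + U y) =
     (U (a *: x + y) - T n (a *: x + y)) + (a *: (T n x - U x) + (T n y - U y)).
    by rewrite ((bopP (T n)).1 a x y) scalerBr [X in _ = _ + X]addrACA
        -opprD [RHS]addrA subrK.
  apply: le_trans (ler_l2normD _ _) _; rewrite [leRHS]mulrDl lerD//.
  apply: le_trans (ler_l2normD _ _) _; rewrite [leRHS]mulrDl lerD//.
    by rewrite l2normZ -mulrA ler_wpM2l ?normc_ge0// l2norm_sub.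
  by rewrite l2norm_sub.
have bU : bounded_operator U.
  split=> //; exists (K + opnorm (T 0%N)) => x.
  rewrite -(subrK (T 0%N x) (U x)) mulrDl.
  apply: le_trans (ler_l2normD _ _) (lerD _ (le_opnorm _ _)).
  by have := HU x 0%N; rewrite expr0 mulr1.
have Up : `[< bounded_operator U >] by exact/asboolP.
exists (Bop Up) => n; apply: opnorm_le; first by rewrite mulr_ge0 ?exprn_ge0.
move=> x; apply: le_trans (HU x n) _.
by rewrite le_eqVlt; apply/orP; left; apply/eqP; ring.
Qed.

End Operators.

Section CstarSubalgebra.
Variables (R : realType) (G : choiceType) (A : set (bop R G)).
Hypothesis cA : cstar_subalgebra A.
Implicit Types (S T : bop R G).

Lemma cstarD S T : A S -> A T -> A (S + T).
Proof. by case: cA => _ [_ lin] _ _ AS AT; rewrite -[S]scale1r; exact: lin. Qed.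

Lemma cstarZ (a : R[i]) S : A S -> A (a *: S).
Proof. by case: cA => _ [A0 lin] _ _ AS; rewrite -[_ *: _]addr0; exact: lin. Qed.

Lemma cstarN S : A S -> A (- S).
Proof. by move=> AS; rewrite -scaleN1r; exact: cstarZ. Qed.

Lemma cstarM S T : A S -> A T -> A (bop_comp S T).
Proof. by case: cA => _ _ + _; apply. Qed.

(** The conclusion says that 1 - T is the square of 1 - Y. The element Y is the
    fixed point of Y |-> (T + Y^2) / 2, which maps the ball of radius r to itself
    and is r-Lipschitz there; starting from 0 all iterates are self-adjoint
    elements of A. This replaces the functional calculus of A. *)
Lemma sqrt_one_minus T (r : R) : A T -> adjoint T T -> 0 <= r -> r < 1 -> opnorm T <= r ->
  exists Y, [/\ A Y, adjoint Y Y & T = Y *+ 2 - bop_comp Y Y].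
Proof.
move=> AT TT r0 r1 Tr.
pose half : R[i] := (2^-1)%:C.
pose Phi Y : bop R G := half *: (T + bop_comp Y Y).
pose Y n := iter n Phi 0.
have half_norm : normc half = 2^-1 by rewrite normc_real ger0_norm.
have Yr n : opnorm (Y n) <= r.
  elim: n => [|n IH]; first by apply: opnorm_le => // x;
    rewrite bop0E l2norm0 mulr_ge0 ?l2norm_ge0.
  rewrite /= opnormZ half_norm ler_pdivrMl//.
  apply: le_trans (ler_opnormD _ _) _.
  apply: (@le_trans _ _ (r + r * r)); last by nra.
  apply: lerD => //; apply: le_trans (opnorm_comp _ _) _.
  by apply: ler_pM; rewrite ?opnorm_ge0.
have AY n : A (Y n).
  elim: n => [|n IH]; first by case: cA => _ [].
  by apply: cstarZ; apply: cstarD => //; exact: cstarM.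
have YY n : adjoint (Y n) (Y n).
  elim: n => [|n IH]; first by move=> x y; rewrite !bop0E inner0l inner0r.
  have := adjointZ half (adjointD TT (adjoint_comp IH IH)).
  have -> // : half^*%R = half by apply: CrealP; rewrite complex_real.
(* U^2 - V^2 = U (U - V) + (U - V) V, as U and V need not commute. *)
have PhiB U V : Phi U - Phi V = half *: (bop_comp U (U - V) + bop_comp (U - V) V).
  rewrite /Phi -scalerBr; congr (_ *: _); rewrite bop_compBl bop_compBr.
  by rewrite opprD addrACA subrr add0r subrKA.
have dPhi U V (a b : R) : opnorm U <= a -> opnorm V <= b ->
    opnorm (Phi U - Phi V) <= 2^-1 * ((a + b) * opnorm (U - V)).
  move=> Ua Vb; rewrite PhiB opnormZ half_norm ler_wpM2l//.
  apply: le_trans (ler_opnormD _ _) _; rewrite mulrDl lerD//.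
    by apply: le_trans (opnorm_comp _ _) _; rewrite ler_wpM2r ?opnorm_ge0.
  apply: le_trans (opnorm_comp _ _) _; rewrite mulrC ler_wpM2r ?opnorm_ge0//.
have dY n : opnorm (Y n.+1 - Y n) <= r * r ^+ n.
  elim: n => [|n IH]; first by rewrite expr0 mulr1 subr0; exact: (Yr 1%N).
  apply: le_trans (dPhi _ _ _ _ (Yr n.+1) (Yr n)) _.
  have -> z : 2^-1 * ((r + r) * z) = r * z by field.
  by rewrite exprS ler_wpM2l.
have [Z HZ] := bop_complete r0 r0 r1 dY; set K := 2 * _ in HZ.
have K0 : 0 <= K by rewrite mulr_ge0 ?geometric_K_ge0.
exists Z; split.
- apply: closed_approx; first by case: cA.
  move=> e e0; have K1 : 0 < K + 1 by lra.
  have [N HN] := geometric_small r0 r1 (divr_gt0 e0 K1).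
  exists (Y N); first exact: AY.
  have := HN N (leqnn N); rewrite ltr_pdivlMr// => h.
  apply: le_lt_trans (HZ N) _; apply: le_lt_trans h.
  have := exprn_ge0 N r0; move: (r ^+ N) => z z0; nra.
- move=> x y; apply/eqP; rewrite -subr_eq0; apply/eqP/eq0_normc/eqP.
  rewrite eq_le normc_ge0 andbT.
  apply: (@geometric_le0 _ r r0 r1 _
      (K * l2norm x * l2norm y + l2norm x * (K * l2norm y))) => n.
  have -> : inner (Z x) y - inner x (Z y) = inner ((Z - Y n) x) y + inner x ((Y n - Z) y).
    by rewrite !bopDE !bopNE innerBl innerBr (YY n x y) addrA subrK.
  apply: le_trans (le_normcD _ _) _; rewrite [leRHS]mulrDl lerD//.
    apply: le_trans (inner_cauchy_schwarz _ _) _.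
    rewrite mulrAC ler_wpM2r ?l2norm_ge0//; apply: le_trans (le_opnorm _ _) _.
    by rewrite mulrAC ler_wpM2r ?l2norm_ge0.
  apply: le_trans (inner_cauchy_schwarz _ _) _.
  rewrite -mulrA ler_wpM2l ?l2norm_ge0//; apply: le_trans (le_opnorm _ _) _.
  by rewrite mulrAC ler_wpM2r ?l2norm_ge0// opnorm_sub.
- have fix_Z : Z = Phi Z.
    apply/eqP; rewrite -subr_eq0; apply/eqP/opnorm_eq0/eqP.
    rewrite eq_le opnorm_ge0 andbT.
    apply: (@geometric_le0 _ r r0 r1 _ (K + 2^-1 * ((r + opnorm Z) * K))) => n.
    have -> : Z - Phi Z = (Z - Y n.+1) + (Phi (Y n) - Phi Z) by rewrite addrA subrK.
    apply: le_trans (ler_opnormD _ _) _; rewrite [leRHS]mulrDl lerD//.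
      apply: le_trans (HZ n.+1) _; rewrite ler_wpM2l// exprS ler_piMl ?exprn_ge0//.
      exact: ltW.
    apply: le_trans (dPhi _ _ _ _ (Yr n) (lexx _)) _.
    rewrite -[leRHS]mulrA -[X in _ <= _ * X]mulrA
        ler_wpM2l// ler_wpM2l ?addr_ge0 ?opnorm_ge0// opnorm_sub.
    exact: HZ.
  have -> : Z *+ 2 = T + bop_comp Z Z.
    rewrite {1}fix_Z /Phi -scaler_nat scalerA (_ : _ * _ = 1) ?scale1r//.
    by rewrite /half -(rmorph_nat (real_complex R)) -rmorphM mulfV// rmorph1.
  by rewrite addrK.
Qed.

End CstarSubalgebra.

(** * Invariant states *)

Section State.
Variables (R : realType) (G : choiceType) (A : set (bop R G)).
Hypotheses (cA : cstar_subalgebra A) (A1 : A (bop_id R G)).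
Variable phi : bop R G -> R[i].
Hypothesis st : state A phi.
Implicit Types S T : bop R G.

Lemma conjE (z : R[i]) : z^*%R = conjc z.
Proof. by []. Qed.

Lemma stateD S T : A S -> A T -> phi (S + T) = phi S + phi T.
Proof. by case: st => lin _ _ AS AT; rewrite -{1}[S]scale1r lin// mul1r. Qed.

Lemma state0 : phi 0 = 0.
Proof.
have A0 : A 0 by case: cA => _ [].
by have /eqP := stateD A0 A0;
  rewrite addr0 -subr_eq0 opprD addrA subrr sub0r oppr_eq0 => /eqP.
Qed.

Lemma stateZ (a : R[i]) S : A S -> phi (a *: S) = a * phi S.
Proof.
case: st => lin _ _ AS; have A0 : A 0 by case: cA => _ [].
by rewrite -[a *: S]addr0 lin// state0 addr0.
Qed.

Lemma stateN S : A S -> phi (- S) = - phi S.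
Proof. by move=> AS; rewrite -scaleN1r stateZ// mulN1r. Qed.

(** Positivity of the state at T + w. *)
Lemma state_shift T T' (w : R[i]) : A T -> adjoint T T' ->
  0 <= phi (bop_comp T' T) + w * phi T' + w^*%R * phi T + w * w^*%R.
Proof.
move=> AT TT'; have [_ pos p1] := st.
have AT' : A T' by case: cA => _ _ _ /(_ _ _ AT TT').
have A1w := cstarZ cA w A1.
have := pos (T + w *: bop_id R G) (T' + w^*%R *: bop_id R G) (cstarD cA AT A1w)
  (adjointD TT' (adjointZ w (@adjoint_id R G))).
have -> : bop_comp (T' + w^*%R *: bop_id R G) (T + w *: bop_id R G) =
   bop_comp T' T + w *: T' + w^*%R *: T + (w * w^*%R) *: bop_id R G.
  apply: bop_ext => x; rewrite !(bop_compE, bopDE, bopZE, bop_idE)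
      linearD linearZ /= scalerDr scalerA.
  by rewrite !addrA [w^*%R * w]mulrC.
have AM := cstarM cA AT' AT; have AZ := cstarZ cA.
by rewrite !stateD ?stateZ ?p1 ?mulr1//; repeat (apply: (cstarD cA)) => //; apply: AZ.
Qed.

(** The values at w = 1 and w = i of the nonnegative quantity in [state_shift] have
    zero imaginary part. *)
Lemma state_adjoint T T' : A T -> adjoint T T' -> phi T' = (phi T)^*%R.
Proof.
move=> AT TT'; have [_ pos _] := st.
have /ger0_Im := pos _ _ AT TT'.
have /ger0_Im := state_shift 1 AT TT'.
have /ger0_Im := state_shift 'i AT TT'.
rewrite !conjE; case: (phi T) => a b; case: (phi T') => c d; case: (phi _) => e f.
rewrite /= => h1 h2 h3; congr (_ +i* _); lra.
Qed.

(** [state_shift] at w = - phi T. *)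
Lemma state_cauchy_schwarz T T' : A T -> adjoint T T' ->
  normc (phi T) ^+ 2 <= complex.Re (phi (bop_comp T' T)).
Proof.
move=> AT TT'; have := state_shift (- phi T) AT TT'.
rewrite (state_adjoint AT TT').
have -> (P z : R[i]) : P + - z * z^*%R + (- z)^*%R * z + - z * (- z)^*%R = P - z * z^*%R.
  by rewrite rmorphN /=; ring.
rewrite -normCK normCE -rmorphXn => h.
have := h; rewrite lecE => /andP[_]; rewrite raddfB /= subr_ge0.
by [].
Qed.

(** Dividing by 2 c instead of c makes X = T'T / (4 c^2) a strict contraction. Then
    1 - X = (1 - Y)^2 with Y self-adjoint in A, so phi X <= 1, and the
    Cauchy-Schwarz inequality concludes. *)
Lemma state_bound T T' (c : R) : 0 < c -> A T -> adjoint T T' -> opnorm T <= c ->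
  normc (phi T) <= 2 * c.
Proof.
move=> c0 AT TT' Tc.
have AT' : A T' by case: cA => _ _ _ /(_ _ _ AT TT').
pose a : R := (4 * c ^+ 2)^-1.
have c20 : 0 < 4 * c ^+ 2 by rewrite mulr_gt0 ?exprn_gt0.
have a0 : 0 < a by rewrite invr_gt0.
have AM := cstarM cA AT' AT.
pose X := a%:C *: bop_comp T' T.
have AX : A X by exact: cstarZ.
have XX : adjoint X X.
  have := adjointZ a%:C (adjoint_comp (adjoint_sym TT') TT').
  by have -> // : (a%:C)^*%R = a%:C :> R[i] by apply: CrealP; rewrite complex_real.
have Xn : opnorm X <= 4^-1.
  rewrite opnormZ normc_real gtr0_norm// ler_pdivrMl//.
  rewrite mulrAC divff ?mul1r//.
  apply: le_trans (opnorm_comp _ _) _; rewrite expr2.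
  apply: ler_pM; rewrite ?opnorm_ge0//; exact: le_trans (opnorm_adjoint_le TT') Tc.
have [||Y [AY YY XE]] := sqrt_one_minus cA AX XX _ _ Xn; [lra|lra|].
have [_ pos p1] := st.
have A1Y : A (bop_id R G - Y) by apply: (cstarD cA) => //; exact: cstarN.
have := pos _ _ A1Y (adjointD (@adjoint_id R G) (adjointN YY)).
have -> : bop_comp (bop_id R G - Y) (bop_id R G - Y) = bop_id R G - X.
  rewrite XE bop_compBl !bop_compBr; apply: bop_ext => x.
  by rewrite mulr2n !(bopDE, bopNE, bop_compE, bop_idE) !opprD !opprK !addrA.
rewrite stateD ?stateN ?p1//; last exact: cstarN.
rewrite stateZ// => h.
have {h} : a * complex.Re (phi (bop_comp T' T)) <= 1.
  move: h; rewrite lecE => /andP[_]; case: (phi _) => u v /=; rewrite mul0r subr0; lra.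
rewrite ler_pdivrMl// mulr1 => h.
rewrite -ler_sqr ?nnegrE ?normc_ge0//; last by rewrite mulr_ge0// ltW.
apply: le_trans (state_cauchy_schwarz AT TT') _; apply: le_trans h _.
by rewrite exprMn -natrX.
Qed.

End State.

Section ReducedAlgebra.
Variables (R : realType) (G : groupType).

Lemma cstar_generated_subalgebra (S : set (bop R G)) :
    cstar_subalgebra (cstar_generated S).
Proof.
split.
- by apply: closed_bigI => B [[cB _ _ _] _].
- split; first by move=> B [[_ [B0 _] _ _] _].
  by move=> a X Y AX AY B BS; case: (BS) => -[_ [_ lin] _ _] _; apply: lin;
    [exact: AX|exact: AY].
- by move=> X Y AX AY B BS; case: (BS) => -[_ _ mul _] _; apply: mul;
  [exact: AX|exact: AY].
- by move=> X X' AX XX' B BS; case: (BS) => -[_ _ _ adj] _; apply: (adj X) => //;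
  exact: AX.
Qed.

Lemma Cstar_r_subalgebra : cstar_subalgebra (@Cstar_r R G).
Proof. exact: cstar_generated_subalgebra. Qed.

Lemma Cstar_r_lambda g : @Cstar_r R G (lambda R g).
Proof. by move=> B [_]; apply; exists g. Qed.

Lemma lambda1 : lambda R 1%g = bop_id R G.
Proof.
apply: bop_ext => x; apply/val_inj/funext => y /=.
by rewrite invg1 mul1g.
Qed.

Lemma Cstar_r_id : @Cstar_r R G (bop_id R G).
Proof. by rewrite -lambda1; exact: Cstar_r_lambda. Qed.

Lemma lambdaM g h : lambda R (g * h)%g = bop_comp (lambda R g) (lambda R h) :> bop R G.
Proof.
apply: bop_ext => x; apply/val_inj/funext => y /=.
by rewrite invgM mulgA.
Qed.

Variable L : groupClosed G.

(** An invariant state takes on the whole convex hull its value at lambda g, and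
    it is bounded by a multiple of the norm. *)
Lemma conv_hull_state_vanish (phi : bop R G -> R[i]) (g : G) :
  invariant_state L phi ->
  closure (conv_hull [set lambda R (t * g * t^-1)%g | t in [set` L]]) (0 : bop R G) ->
  phi (lambda R g) = 0.
Proof.
move=> [st inv] cl; have cA := Cstar_r_subalgebra.
pose P T := [/\ Cstar_r T, exists T', adjoint T T' & phi T = phi (lambda R g)].
have HP T : conv_hull [set lambda R (t * g * t^-1)%g | t in [set` L]] T -> P T.
  apply; split.
    apply: convex_setE => t x y _ [Ax [x' xx'] px] [Ay [y' yy'] py]; split.
    - by apply: (cstarD cA); exact: (cstarZ cA).
    - by eexists; apply: adjointD; exact: adjointZ.
    - rewrite (stateD st) ?(stateZ cA st)//; try exact: (cstarZ cA).
      by rewrite px py -mulrDl -rmorphD addrC subrK mul1r.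
  move=> _ [t tL <-]; split; first exact: Cstar_r_lambda.
    by exists (lambda R (t * g * t^-1)^-1%g); exact: lambda_adjoint.
  rewrite -mulgA !lambdaM; exact: (inv t tL _ (Cstar_r_lambda g)).
apply/eq0_normc/eqP; rewrite eq_le normc_ge0 andbT.
apply/ler_addgt0Pr => e e0; rewrite add0r.
have e20 : 0 < (e / 2)%:C :> R[i] by rewrite ltcR divr_gt0.
have [T [/HP [AT [T' TT'] <-]]] := cl _ (nbhsx_ballx (0 : bop R G) _ e20).
rewrite -ball_normE /= sub0r normrN opnormE ltcR => hT.
have e2 : 0 < e / 2 by rewrite divr_gt0.
have := state_bound cA Cstar_r_id st e2 AT TT' (ltW hT).
by move=> /le_trans; apply; lra.
Qed.

End ReducedAlgebra.

(** * Limits along ultrafilters *)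

Section UltraLimit.
Variables (R : realType) (I : Type) (U : set_system I).
Context {UU : UltraFilter U}.
Implicit Types u v : I -> R.

Definition bounded_family u := exists M, forall i, `|u i| <= M.

Definition ulim u : R := lim (u @ U).

Lemma ulim_cvg u : bounded_family u -> u @ U --> ulim u.
Proof.
move=> [M uM]; have PU := @ultra_proper _ _ UU.
have [|p [_ clp]] := @segment_compact R (- M) M (u @ U) (fmap_proper_filter u PU).
  suff : U (u @^-1` `[- M, M]) by [].
  by apply: filterS filterT => i _ /=; rewrite in_itv/= -ler_norml.
have cvp : u @ U --> p.
  move=> V Vp; case: (in_ultra_setVsetC (u @^-1` V) UU) => // UC.
  by have [x []] := clp (~` V) V UC Vp.
by apply/cvg_ex; exists p.
Qed.

Lemma ulim_eq u l : u @ U --> l -> ulim u = l.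
Proof. by move=> ul; apply: cvg_lim => //; exact: norm_hausdorff. Qed.

Lemma ulim_cst c : ulim (fun=> c) = c.
Proof. by apply: ulim_eq; exact: cvg_cst. Qed.

Lemma ulim_linear (a : R) u v : bounded_family u -> bounded_family v ->
  ulim (fun i => a * u i + v i) = a * ulim u + ulim v.
Proof.
move=> /ulim_cvg hu /ulim_cvg hv; apply: ulim_eq; apply: cvgD => //.
by apply: cvgM => //; exact: cvg_cst.
Qed.

Lemma bounded_linear (a : R) u v : bounded_family u -> bounded_family v ->
  bounded_family (fun i => a * u i + v i).
Proof.
move=> [M uM] [N vN]; exists (`|a| * M + N) => i.
by apply: le_trans (ler_normD _ _) _; rewrite normrM lerD// ler_wpM2l.
Qed.

Lemma ulim_close u v (d : I -> R) : bounded_family u -> bounded_family v ->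
  (forall i, `|u i - v i| <= d i) -> d @ U --> 0 -> ulim u = ulim v.
Proof.
move=> bu bv uvd d0; have hv := ulim_cvg bv; apply: ulim_eq.
have -> : u = (fun i => (u i - v i) + v i) by apply/funext => i; rewrite subrK.
rewrite -[ulim v]add0r; apply: cvgD => //; apply: norm_cvg0.
apply: squeeze_cvgr (cvg_cst 0) d0.
by apply: nearW => i; rewrite uvd normr_ge0.
Qed.

Lemma ulim_lt_near u e : bounded_family u -> ulim u < e -> U [set i | u i < e].
Proof.
move=> /ulim_cvg hu ue; have := cvgr_lt _ hu e ue; exact.
Qed.

Lemma ulim_gt_near u e : bounded_family u -> e < ulim u -> U [set i | e < u i].
Proof.
move=> /ulim_cvg hu ue; have := cvgr_gt _ hu e ue; exact.
Qed.

Lemma ulim_le u v : bounded_family u -> bounded_family v ->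
  (forall i, u i <= v i) -> ulim u <= ulim v.
Proof.
move=> bu bv uv; rewrite leNgt; apply/negP => vu.
have [m /andP[vm mu]] : exists m, ulim v < m < ulim u.
  by exists ((ulim u + ulim v) / 2); apply/andP; split; lra.
have PU := @ultra_proper _ _ UU.
have [i [/= h1 h2]] := filter_ex (filterI (ulim_lt_near bv vm) (ulim_gt_near bu mu)).
by have := uv i; lra.
Qed.

End UltraLimit.

Section Nets.
Variables (R : realType) (G : groupType) (L : groupClosed G).

(** The ultrafilter extends the trace of the filter of tails on the indices where h
    is at least e. *)
Lemma not_small_ultra (I : Type) (le : I -> I -> Prop) (h : I -> R) (e : R) :
  directed le -> ~ tails le [set i | h i < e] ->
  exists U : set_system I, [/\ UltraFilter U, tails le `<=` U & U [set i | e <= h i]].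
Proof.
move=> dir nh; have FF := directed_filter dir.
pose A := [set i | e <= h i].
have WP : ProperFilter (within A (tails le)).
  apply: Build_ProperFilter_ex => P WP; apply: contrapT => nP; apply: nh.
  have : tails le [set i | A i -> P i] by [].
  apply: filterS => i /= AP; rewrite ltNge; apply/negP => /AP Pi.
  by apply: nP; exists i.
have [U [UU WU]] := ultraFilterLemma WP.
exists U; split=> //.
  move=> P FP; apply: WU; suff : tails le [set i | A i -> P i] by [].
  by apply: filterS FP => i Pi _.
apply: WU; suff : tails le [set i | A i -> A i] by [].
by apply: filterS filterT => i _ Ai.
Qed.

(** Convergence of the coefficients fails only if they are bounded below along some
    ultrafilter finer than the tails. *)
Lemma vanishing_from_small (g : G) :
  (forall (I : Type) (le : I -> I -> Prop) (xi : I -> l2 R G) (U : set_system I) (e : R),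
    almost_invariant L le xi -> UltraFilter U -> tails le `<=` U -> 0 < e ->
    U [set i | e <= normc (inner (lambda R g (xi i)) (xi i))] -> False) ->
  @vanishing_coefficients R G L g.
Proof.
move=> H I le xi dir ai; have FF := directed_filter dir.
apply/cvgrPdist_lt => -[e e'] /=; rewrite ltcE/= => /andP[/eqP -> e0].
have small : tails le [set i | normc (inner (lambda R g (xi i)) (xi i)) < e].
  apply: contrapT => /(not_small_ultra dir)[U [UU tU Ue]].
  exact: H ai UU tU e0 Ue.
by apply: filterS small => i /= hi; rewrite sub0r normrN normCE ltcR.
Qed.

Section UltraState.
Variables (I : Type) (le : I -> I -> Prop) (xi : I -> l2 R G) (U : set_system I).
Hypotheses (ai : almost_invariant L le xi) (UU : UltraFilter U) (tU : tails le `<=` U).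

Let c (T : bop R G) i : R[i] := inner (T (xi i)) (xi i).

(** The limit of the vector states of a net. Real and imaginary parts are taken
    separately, as limits of bounded real families along an ultrafilter. *)
Definition vector_state_limit (T : bop R G) : R[i] :=
  (ulim U (fun i => complex.Re (c T i))) +i* (ulim U (fun i => complex.Im (c T i))).

Lemma normc_coef T i : normc (c T i) <= opnorm T.
Proof.
apply: le_trans (inner_cauchy_schwarz _ _) _; rewrite ai.1 mulr1.
by have := le_opnorm T (xi i); rewrite ai.1 mulr1.
Qed.

Lemma bounded_Re T : bounded_family (fun i => complex.Re (c T i)).
Proof. by exists (opnorm T) => i; exact: le_trans (normc_ge_re _) (normc_coef T i). Qed.

Lemma bounded_Im T : bounded_family (fun i => complex.Im (c T i)).
Proof. by exists (opnorm T) => i; exact: le_trans (normc_ge_im _) (normc_coef T i). Qed.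

Lemma coef_linear (a : R[i]) S T i : c (a *: S + T) i = a * c S i + c T i.
Proof. by rewrite /c bopDE bopZE innerDl innerZl. Qed.

Lemma vector_state_limit_linear (a : R[i]) S T :
  vector_state_limit (a *: S + T) = a * vector_state_limit S + vector_state_limit T.
Proof.
rewrite /vector_state_limit; case: a => a b.
have bR := bounded_Re; have bI := bounded_Im.
have -> : (fun i => complex.Re (c ((a +i* b) *: S + T) i)) =
  (fun i => a * complex.Re (c S i) + ((- b) * complex.Im (c S i) + complex.Re (c T i))).
  apply/funext => i; rewrite coef_linear; case: (c S i) => x y; case: (c T i) => z w /=.
  ring.
have -> : (fun i => complex.Im (c ((a +i* b) *: S + T) i)) =
  (fun i => a * complex.Im (c S i) + (b * complex.Re (c S i) + complex.Im (c T i))).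
  apply/funext => i; rewrite coef_linear; case: (c S i) => x y; case: (c T i) => z w /=.
  ring.
rewrite !ulim_linear//; try exact: bounded_linear.
apply/eqP; rewrite eq_complex /=; apply/andP; split; apply/eqP; ring.
Qed.

(** The vectors xi and lambda_t^-1 xi get arbitrarily close, hence define the same
    limit state. *)
Lemma vector_state_limit_invariant : invariant_state L vector_state_limit.
Proof.
split.
  split.
  - by move=> a S T _ _; exact: vector_state_limit_linear.
  - move=> T T' _ TT'.
    have E i : c (bop_comp T' T) i = (l2norm (T (xi i)) ^+ 2)%:C.
      by rewrite /c bop_compE (adjoint_sym TT') inner_norm.
    rewrite /vector_state_limit lecE /=; apply/andP; split.
      rewrite (_ : (fun i => _) = fun=> 0) ?ulim_cst//.
      by apply/funext => i; rewrite E.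
    rewrite -(ulim_cst (UU := UU) (0 : R)); apply: ulim_le.
    + by exists 0 => i; rewrite normr0.
    + exact: bounded_Re.
    + by move=> i; rewrite E /= sqr_ge0.
  - have E i : c (bop_id R G) i = 1.
      by rewrite /c bop_idE inner_norm ai.1 expr1n.
    rewrite /vector_state_limit.
    rewrite (_ : (fun i => _) = fun=> 1); last by apply/funext => i; rewrite E.
    rewrite (_ : (fun i => complex.Im _) = fun=> 0); last by apply/funext => i; rewrite E.
    by rewrite !ulim_cst.
move=> t tL T _; set T1 := bop_comp _ _.
pose d i := 2 * opnorm T * l2norm (lambda R t^-1%g (xi i) - xi i).
have dE i : normc (c T1 i - c T i) <= d i.
  rewrite /c /T1 !bop_compE inner_lambda.
  set y := lambda R t^-1%g (xi i); set x := xi i.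
  have ny : l2norm y = 1 by rewrite /y l2norm_translate ai.1.
  have nx : l2norm x = 1 by exact: ai.1.
  have -> : inner (T y) y - inner (T x) x = inner (T (y - x)) y + inner (T x) (y - x).
    by rewrite linearB innerBl innerBr addrA subrK.
  apply: le_trans (le_normcD _ _) _.
  have h1 : normc (inner (T (y - x)) y) <= opnorm T * l2norm (y - x).
    by apply: le_trans (inner_cauchy_schwarz _ _) _; rewrite ny mulr1 le_opnorm.
  have h2 : normc (inner (T x) (y - x)) <= opnorm T * l2norm (y - x).
    apply: le_trans (inner_cauchy_schwarz _ _) _; rewrite ler_wpM2r ?l2norm_ge0//.
    by have := le_opnorm T x; rewrite nx mulr1.
  by rewrite /d -/y -/x; lra.
have d0 : d @ U --> 0.
  have tLV : t^-1%g \in L by rewrite gpredV.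
  have h : (fun i => l2norm (lambda R t^-1%g (xi i) - xi i)) @ U --> 0.
    by move=> V /(ai.2 _ tLV) /tU.
  have := cvgM (cvg_cst (2 * opnorm T)) h; rewrite mulr0; exact.
rewrite /vector_state_limit; congr (_ +i* _).
  apply: (ulim_close (UU := UU) (d := d)) => //; try exact: bounded_Re.
  by move=> i; apply: le_trans (dE i); rewrite -raddfB; exact: normc_ge_re.
apply: (ulim_close (UU := UU) (d := d)) => //; try exact: bounded_Im.
by move=> i; apply: le_trans (dE i); rewrite -raddfB; exact: normc_ge_im.
Qed.

Lemma vector_state_limit_neq0 T e : 0 < e -> U [set i | e <= normc (c T i)] ->
  vector_state_limit T <> 0.
Proof.
move=> e0 Ue [/eqP re0 /eqP im0].
have e2 : 0 < e / 2 by rewrite divr_gt0.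
have near0 u : bounded_family u -> ulim U u == 0 -> U [set i | `|u i| < e / 2].
  move=> bu /eqP u0; have := ulim_cvg (UU := UU) bu; rewrite u0 => /cvgrPdist_lt/(_ _ e2).
  by apply: filterS => i; rewrite sub0r normrN.
have h1 := near0 _ (bounded_Re T) re0; have h2 := near0 _ (bounded_Im T) im0.
have [i [[/= a1 a2] a3]] := filter_ex (filterI (filterI h1 h2) Ue).
move: a3 => /=; rewrite leNgt => /negP; apply.
rewrite [X in normc X]complexE; apply: le_lt_trans (le_normcD _ _) _.
rewrite normcM !normc_real.
have -> : normc ('i : R[i]) = 1 by rewrite /= expr0n add0r expr1n sqrtr1.
by lra.
Qed.

End UltraState.

Lemma state_vanish_coefficients (g : G) :
  (forall phi, invariant_state L phi -> phi (lambda R g) = 0) ->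
  @vanishing_coefficients R G L g.
Proof.
move=> H; apply: vanishing_from_small => I le xi U e ai UU tU e0 Ue.
exact: (vector_state_limit_neq0 ai UU e0 Ue
    (H _ (vector_state_limit_invariant ai UU tU))).
Qed.

End Nets.

(** * Regular measures from finitely additive ones *)

Section FinitelyAdditive.
Variables (R : realType).

(** Additivity is asked on all subsets, as for a limit of measures along an
    ultrafilter. *)
Record fin_additive_prob (T : Type) := FinAdditiveProb {
  fa_prob :> set T -> R;
  fa_ge0 : forall A, 0 <= fa_prob A;
  fa_setT : fa_prob setT = 1;
  faU : forall A B, A `&` B = set0 -> fa_prob (A `|` B) = fa_prob A + fa_prob B }.

Variables (T : Type) (nu : fin_additive_prob T).
Implicit Types A B : set T.

Lemma fa_le A B : A `<=` B -> nu A <= nu B.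
Proof.
move=> AB; rewrite -(setDUK AB) faU ?lerDl ?fa_ge0//.
by rewrite setDE setICA setICr setI0.
Qed.

Lemma fa_le1 A : nu A <= 1.
Proof. by rewrite -(fa_setT nu); exact: fa_le. Qed.

Lemma fa_setC A : nu (~` A) = 1 - nu A.
Proof. by rewrite -(fa_setT nu) -(setUv A) faU ?setICr// addrC addKr. Qed.

Lemma fa_set0 : nu set0 = 0.
Proof. by rewrite -setCT fa_setC fa_setT subrr. Qed.

Lemma fa_subadditive A B : nu (A `|` B) <= nu A + nu B.
Proof.
have -> : A `|` B = A `|` (B `\` A).
  by apply/seteqP; split=> x [xA|xB]; [left|have [] := pselect (A x);
    [left|right]|left|right; case: xB].
rewrite faU; last by rewrite setDE setICA setICr setI0.
by rewrite lerD2l; apply: fa_le; exact: subDsetl.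
Qed.

End FinitelyAdditive.

Section Riesz.
Variables (R : realType) (X : ptopologicalType).
Hypotheses (cX : compact [set: X]) (hX : hausdorff_space X).
Variable nu : fin_additive_prob R X.
Implicit Types U V K A : set X.

(** The value of the future measure on an open set U. *)
Definition inner_value U : R := sup [set nu K | K in [set K | closed K /\ K `<=` U]].

Let has_sup_inner U : has_sup [set nu K | K in [set K | closed K /\ K `<=` U]].
Proof.
split; first by exists (nu set0), set0 => //; split; [exact: closed0|].
by exists 1 => _ [K _ <-]; exact: fa_le1.
Qed.

Lemma le_inner_value U K : closed K -> K `<=` U -> nu K <= inner_value U.
Proof. by move=> cK KU; apply: ub_le_sup; [exact: (has_sup_inner U).2|exists K]. Qed.

Lemma inner_value_le U M : (forall K, closed K -> K `<=` U -> nu K <= M) ->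
  inner_value U <= M.
Proof.
by move=> H; apply: ge_sup; [exact: (has_sup_inner U).1|move=> _ [K [cK KU] <-];
  exact: H].
Qed.

Lemma inner_value_ge0 U : 0 <= inner_value U.
Proof. by rewrite -(fa_set0 nu); apply: le_inner_value => //; exact: closed0. Qed.

Lemma inner_value_le_fa U : inner_value U <= nu U.
Proof. by apply: inner_value_le => K _; exact: fa_le. Qed.

Lemma inner_value_mono U V : U `<=` V -> inner_value U <= inner_value V.
Proof.
move=> UV; apply: inner_value_le => K cK KU; apply: le_inner_value => //.
exact: subset_trans UV.
Qed.

Lemma inner_valueT : inner_value setT = 1.
Proof.
apply/eqP; rewrite eq_le; apply/andP; split.
  by rewrite -(fa_setT nu); exact: inner_value_le_fa.
by rewrite -(fa_setT nu); apply: le_inner_value => //; exact: closedT.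
Qed.

(** By normality, a closed subset of the union of U and V is the union of a closed
    subset of U and a closed subset of V. *)
Lemma inner_valueU U V : open U -> open V ->
  inner_value (U `|` V) <= inner_value U + inner_value V.
Proof.
move=> oU oV; apply: inner_value_le => K cK KUV.
have cKU : closed (K `\` U) by rewrite setDE; apply: closedI => //; exact: open_closedC.
have cKV : closed (K `\` V) by rewrite setDE; apply: closedI => //; exact: open_closedC.
have /(@normal_openP R) := compact_normal hX cX.
move=> /(_ _ _ cKU cKV)[|U1 [U2 [opU1 opU2 s1 s2 d12]]].
  by rewrite -subset0 => x [[Kx nU] [_ nV]]; case: (KUV x Kx).
have -> : K = (K `\` U1) `|` (K `\` U2).
  apply/seteqP; split=> x; last by case=> -[].
  move=> Kx; have [x1|x1] := pselect (U1 x); last by left.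
  right; split=> // x2; have : (U1 `&` U2) x by []. 
  by rewrite d12.
apply: le_trans (fa_subadditive nu _ _) _; apply: lerD; apply: le_inner_value.
- by rewrite setDE; apply: closedI => //; exact: open_closedC.
- by move=> x [Kx nO]; apply: contrapT => nU; apply: nO; exact: s1.
- by rewrite setDE; apply: closedI => //; exact: open_closedC.
- by move=> x [Kx nO]; apply: contrapT => nU; apply: nO; exact: s2.
Qed.

Lemma inner_value_bigU (F : (set X)^nat) n : (forall i, open (F i)) ->
  inner_value (\bigcup_(i in `I_n) F i) <= \sum_(0 <= i < n) inner_value (F i).
Proof.
move=> oF; elim: n => [|n IH].
  rewrite II0 bigcup_set0 big_nil; apply: inner_value_le => K _.
  by rewrite subset0 => ->; rewrite fa_set0.
rewrite big_nat_recr//= IIS bigcup_setU bigcup_set1.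
apply: le_trans (inner_valueU _ _) _ => //; first by apply: bigcup_open.
by rewrite lerD2r.
Qed.

(** A compact set covered by the F i is covered by finitely many of them. *)
Lemma inner_value_sigma (F : (set X)^nat) : (forall i, open (F i)) ->
  ((inner_value (\bigcup_i F i))%:E <= \sum_(i <oo) (inner_value (F i))%:E)%E.
Proof.
move=> oF.
have H K : closed K -> K `<=` \bigcup_i F i ->
    ((nu K)%:E <= \sum_(i <oo) (inner_value (F i))%:E)%E.
  move=> cK KF; have : compact K by apply: subclosed_compact cX _.
  rewrite compact_cover => /(_ nat setT F (fun i _ => oF i)) [|D _ KD].
    by move=> x /KF[i _ Fi]; exists i.
  pose n := (\max_(i <- D) i).+1.
  have Kn : K `<=` \bigcup_(i in `I_n) F i.
    move=> x /KD[i /= iD Fi]; exists i => //=; rewrite /n ltnS.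
    exact: (@leq_bigmax_seq _ _ xpredT id).
  apply: (@le_trans _ _ (\sum_(0 <= i < n) (inner_value (F i))%:E)%E).
    rewrite sumEFin lee_fin; apply: le_trans (inner_value_bigU n oF).
    exact: le_inner_value.
  apply: nneseries_lim_ge => i _ _; rewrite lee_fin; exact: inner_value_ge0.
have : (\sum_(i <oo) (inner_value (F i))%:E >= 0)%E.
  by apply: nneseries_ge0 => i _ _; rewrite lee_fin; exact: inner_value_ge0.
case E : (\sum_(i <oo) _)%E => [s| |] // _; last by rewrite leey.
rewrite lee_fin; apply: inner_value_le => K cK KF.
by have := H K cK KF; rewrite E lee_fin.
Qed.

Local Open Scope ereal_scope.

(** The outer measure attached to the inner values of open sets. Its restriction to
    the Borel sets is the regular measure representing the positive functional
    given by nu on continuous functions. *)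
Definition outer_value A : \bar R :=
  ereal_inf [set (inner_value U)%:E | U in [set U | open U /\ A `<=` U]].

Lemma outer_value_le A U : open U -> A `<=` U -> outer_value A <= (inner_value U)%:E.
Proof. by move=> oU AU; apply: ereal_inf_lbound; exists U. Qed.

Lemma le_outer_value A M : (forall U, open U -> A `<=` U -> M <= (inner_value U)%:E) ->
  M <= outer_value A.
Proof. by move=> H; apply: le_ereal_inf_tmp => _ [U [oU AU] <-]; exact: H. Qed.

Lemma outer_value_open U : open U -> outer_value U = (inner_value U)%:E.
Proof.
move=> oU; apply/eqP; rewrite eq_le outer_value_le//=.
by apply: le_outer_value => V _ UV; rewrite lee_fin inner_value_mono.
Qed.

Lemma outer_value_ge0 A : 0 <= outer_value A.
Proof. by apply: le_outer_value => U _ _; rewrite lee_fin inner_value_ge0. Qed.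

Lemma outer_value_mono : {homo outer_value : A B / A `<=` B >-> A <= B}.
Proof.
move=> A B AB; apply: le_outer_value => U oU BU; apply: outer_value_le => //.
exact: subset_trans BU.
Qed.

Lemma outer_value_set0 : outer_value set0 = 0.
Proof.
rewrite outer_value_open; last exact: open0.
congr EFin; apply/eqP; rewrite eq_le inner_value_ge0 andbT.
by rewrite -(fa_set0 nu); exact: inner_value_le_fa.
Qed.

Lemma outer_value_fin A : outer_value A \is a fin_num.
Proof.
rewrite ge0_fin_numE ?outer_value_ge0//.
apply: le_lt_trans (outer_value_le openT (@subsetT _ A)) _; exact: ltry.
Qed.

Lemma outer_value_approx A (e : R) : (0 < e)%R ->
  exists U, [/\ open U, A `<=` U & (inner_value U)%:E <= outer_value A + e%:E].
Proof.
move=> e0; have [_ [U [oU AU] <-] h] := lb_ereal_inf_adherent e0 (outer_value_fin A).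
by exists U; split=> //; exact: ltW.
Qed.

(** Cover each set by an open set up to e / 2^(n+1), and use countable subadditivity
    on open sets. *)
Lemma outer_value_sigma : sigma_subadditive outer_value.
Proof.
move=> F; apply/lee_addgt0Pr => e e0.
have e2 n : (0 < e / (2 ^ n.+1)%:R)%R by rewrite divr_gt0// ltr0n expn_gt0.
have /choice[U HU] n := outer_value_approx (F n) (e2 n).
have oU n : open (U n) by have [] := HU n.
apply: (@le_trans _ _ (inner_value (\bigcup_n U n))%:E).
  apply: outer_value_le; first exact: bigcup_open.
  by move=> x [n _ Fx]; exists n => //; have [_ + _] := HU n; apply.
apply: le_trans (inner_value_sigma oU) _.
apply: le_trans (epsilon_trick xpredT (fun n => outer_value_ge0 (F n)) (ltW e0)).
apply: lee_nneseries; first by move=> n _ _; rewrite lee_fin inner_value_ge0.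
by move=> n _; have [] := HU n.
Qed.

Definition riesz_outer : {outer_measure set X -> \bar R} :=
  HB.pack outer_value (isOuterMeasure.Build R X outer_value outer_value_set0
    outer_value_ge0 outer_value_mono outer_value_sigma).

(** A closed K in V and U nearly realises the inner value of this intersection, and
    a closed K' in V minus K nearly that of the rest; they are disjoint closed
    subsets of V. *)
Lemma caratheodory_open U : open U -> riesz_outer.-caratheodory U.
Proof.
move=> oU; apply: le_caratheodory_measurable => A.
change (outer_value (A `&` U) + outer_value (A `&` ~` U) <= outer_value A).
apply: le_outer_value => V oV AV.
have oVU : open (V `&` U) by exact: openI.
apply: (@le_trans _ _ ((inner_value (V `&` U))%:E + outer_value (V `&` ~` U))).
  apply: leeD; first by apply: outer_value_le => // x [/AV].
  by apply: outer_value_mono => x [/AV].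
rewrite -(fineK (outer_value_fin (V `&` ~` U))) -EFinD lee_fin.
rewrite -lerBrDr; apply: inner_value_le => K cK KVU; rewrite lerBrDr.
have oVK : open (V `&` ~` K) by apply: openI => //; exact: closed_openC.
apply: (@le_trans _ _ (nu K + inner_value (V `&` ~` K))%R).
  rewrite lerD2l -lee_fin (fineK (outer_value_fin _)).
  by apply: outer_value_le => // x [Vx nUx]; split=> // /KVU[].
rewrite -lerBrDl; apply: inner_value_le => K' cK' K'V; rewrite lerBrDl -faU.
  by apply: le_inner_value; [exact: closedU|move=> x [/KVU[]|/K'V[]]].
by rewrite -subset0 => x [Kx /K'V[]].
Qed.

Lemma caratheodory_borel (A : set (borel X)) : measurable A ->
  riesz_outer.-caratheodory A.
Proof.
move: A; apply: smallest_sub; last exact: caratheodory_open.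
split.
- exact: caratheodory_measurable_set0.
- by move=> A mA; rewrite setTD; exact: caratheodory_measurable_setC.
- by move=> F mF; exact: caratheodory_measurable_bigcup.
Qed.

Lemma riesz_sigma_additive : semi_sigma_additive (outer_value : set (borel X) -> \bar R).
Proof.
move=> F mF tF _; apply: (@caratheodory_measure_sigma_additive R X riesz_outer F) => //.
  by move=> n; exact: caratheodory_borel.
by apply: caratheodory_measurable_bigcup => n; exact: caratheodory_borel.
Qed.

Lemma outer_value_setT : outer_value setT = 1.
Proof. by rewrite outer_value_open ?inner_valueT//; exact: openT. Qed.

Definition riesz_measure : {measure set (borel X) -> \bar R} :=
  HB.pack (outer_value : set (borel X) -> \bar R)
    (isMeasure.Build _ _ _ (outer_value : set (borel X) -> \bar R)
      outer_value_set0 outer_value_ge0 riesz_sigma_additive).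

Definition riesz_prob : probability (borel X) R :=
  HB.pack (Measure.sort riesz_measure)
   (Measure_isProbability.Build _ _ _ (Measure.sort riesz_measure) outer_value_setT).

Lemma riesz_probE A : riesz_prob A = outer_value A.
Proof. by []. Qed.

(** Outer regularity holds by construction; inner regularity follows by complement. *)
Lemma riesz_regular : regular_measure riesz_prob.
Proof.
move=> A mA; split.
  rewrite riesz_probE /outer_value; congr ereal_inf; apply/seteqP; split.
    by move=> _ [U [oU AU] <-]; exists U => //; rewrite riesz_probE outer_value_open.
  by move=> _ [U [oU AU] <-]; exists U => //; rewrite riesz_probE outer_value_open.
apply/eqP; rewrite eq_le; apply/andP; split; last first.
  apply: ge_ereal_sup => _ [K [cK KA] <-]; exact: outer_value_mono.
apply/lee_addgt0Pr => e e0.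
(* The compact subset of A is the complement of an open set around the complement
   of A. *)
have [U [oU AU hU]] := outer_value_approx (~` A) e0.
have cK : compact (~` U).
  by apply: subclosed_compact cX _ => //; exact: open_closedC.
have mU : measurable (U : set (borel X)) by exact: sub_sigma_algebra.
apply: (@le_trans _ _ (riesz_prob (~` U) + e%:E)).
  have PU := probability_setC riesz_prob mU.
  have PA := probability_setC riesz_prob mA.
  rewrite PU; move: hU; rewrite -(outer_value_open oU) -!riesz_probE PA.
  rewrite -(fineK (fin_num_measure riesz_prob _ mU))
      -(fineK (fin_num_measure riesz_prob _ mA)).
  by rewrite -!EFinB -!EFinD !lee_fin; lra.
apply: leeD => //; apply: ereal_sup_ubound; exists (~` U) => //; split=> //.
by move=> x nU; apply: contrapT => nA; apply: nU; exact: AU.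
Qed.

(** A homeomorphism preserving nu preserves each step of the construction. *)
Lemma riesz_invariant (f g : X -> X) : continuous f -> continuous g ->
  cancel f g -> cancel g f -> (forall A, nu (f @^-1` A) = nu A) ->
  forall A, outer_value (f @^-1` A) = outer_value A.
Proof.
move=> cf cg fg gf inv.
have fgA A : f @^-1` (g @^-1` A) = A by apply/funext => x; rewrite /= /preimage/= fg.
have gfA A : g @^-1` (f @^-1` A) = A by apply/funext => x; rewrite /= /preimage/= gf.
have invg A : nu (g @^-1` A) = nu A by rewrite -inv fgA.
have one (h k : X -> X) : continuous h -> continuous k ->
  (forall A, h @^-1` (k @^-1` A) = A) ->
    (forall A, k @^-1` (h @^-1` A) = A) -> (forall A, nu (h @^-1` A) = nu A) ->
    forall A, outer_value (h @^-1` A) <= outer_value A.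
  move=> ch ck hk kh invh A; apply: le_outer_value => U oU AU.
  apply: (@le_trans _ _ (inner_value (h @^-1` U))%:E).
    apply: outer_value_le; first by move/continuousP: ch => /(_ _ oU).
    exact: preimage_subset.
  rewrite lee_fin; apply: inner_value_le => K cK KU.
  have -> : nu K = nu (k @^-1` K) by rewrite -(invh (k @^-1` K)) hk.
  apply: le_inner_value; first by apply: closed_comp => // x _; exact: ck.
  by rewrite -(kh U); exact: preimage_subset.
move=> A; apply/eqP; rewrite eq_le (one f g)//=.
by rewrite -{1}(gfA A); exact: (one g f).
Qed.

End Riesz.

(** * Measures carried by an orbit *)

Section Restriction.
Variables (R : realType) (G : choiceType).
Implicit Types (f h : l2 R G) (A B : set G).

Lemma restrict_summable B f : square_summable (fun x => if x \in B then f x else 0).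
Proof.
have H (J : {fset G}) :
    \sum_(x <- J) normc (if x \in B then f x else 0) ^+ 2 <= l2norm f ^+ 2.
  apply: le_trans (l2_sum_le f J); apply: ler_sum => x _.
  by case: ifP => // _; rewrite normc0 expr0n sqr_ge0.
by apply: le_lt_trans (sumsq_le H) _; rewrite ltry.
Qed.

Definition restrict B f : l2 R G := L2 (restrict_summable B f).

Lemma restrictE B f x : restrict B f x = if x \in B then f x else 0.
Proof. by []. Qed.

Lemma l2_ext f h : (forall x, f x = h x) -> f = h.
Proof. by move=> fh; apply/val_inj/funext. Qed.

Lemma restrictB B f h : restrict B (f - h) = restrict B f - restrict B h.
Proof.
apply: l2_ext => x; change ((if x \in B then f x - h x else 0) =
  (if x \in B then f x else 0) - (if x \in B then h x else 0)).
by case: ifP; rewrite ?subrr.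
Qed.

Lemma restrictT f : restrict setT f = f.
Proof. by apply: l2_ext => x; rewrite restrictE mem_set. Qed.

Lemma restrictU A B f : A `&` B = set0 ->
  restrict (A `|` B) f = restrict A f + restrict B f.
Proof.
move=> AB0; apply: l2_ext => x; change ((if x \in A `|` B then f x else 0) =
  (if x \in A then f x else 0) + (if x \in B then f x else 0)).
rewrite in_setU; have [/set_mem Ax|_] := boolP (x \in A); last by rewrite /= add0r.
rewrite /= memNset ?addr0// => Bx.
by have : (A `&` B) x by []; rewrite AB0.
Qed.

Lemma inner_restrict B f h : inner (restrict B f) h = inner f (restrict B h).
Proof.
apply: has_sum_unique (has_sum_inner _ _) _.
rewrite (_ : (fun i => _) = (fun i => f i * (restrict B h i)^*%R : R[i])).
  exact: has_sum_inner.
apply/funext => x; rewrite !restrictE.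
by case: ifP; rewrite ?conjC0 ?mul0r ?mulr0.
Qed.

Lemma inner_restrict_disjoint A B f : A `&` B = set0 ->
  inner (restrict A f) (restrict B f) = 0.
Proof.
move=> AB0; apply: has_sum_unique (has_sum_inner _ _) _ => e e0; exists fset0 => J _.
rewrite big1 ?subrr ?normc0// => x _; rewrite !restrictE.
have [/set_mem Ax|_] := boolP (x \in A); last by rewrite mul0r.
rewrite (memNset (A := B)) ?conjC0 ?mulr0// => Bx.
by have : (A `&` B) x by []; rewrite AB0.
Qed.

(** The measure on G with density |f|^2. *)
Definition mass B f : R := l2norm (restrict B f) ^+ 2.

Lemma mass_ge0 B f : 0 <= mass B f.
Proof. exact: sqr_ge0. Qed.

Lemma massT f : mass setT f = l2norm f ^+ 2.
Proof. by rewrite /mass restrictT. Qed.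

Lemma massU A B f : A `&` B = set0 -> mass (A `|` B) f = mass A f + mass B f.
Proof.
move=> AB0; have BA0 : B `&` A = set0 by rewrite setIC.
apply: complexI; rewrite rmorphD /= -!inner_norm restrictU// innerDl !innerDr.
by rewrite (inner_restrict_disjoint f AB0) (inner_restrict_disjoint f BA0) addr0 add0r.
Qed.

Lemma massC B f : mass (~` B) f = l2norm f ^+ 2 - mass B f.
Proof. by rewrite -massT -(setUv B) massU ?setICr// addrC addKr. Qed.

Lemma mass_le B f : mass B f <= l2norm f ^+ 2.
Proof. by have := mass_ge0 (~` B) f; rewrite massC subr_ge0. Qed.

Lemma l2norm_restrict_le B f : l2norm (restrict B f) <= l2norm f.
Proof. by rewrite -ler_sqr ?nnegrE ?l2norm_ge0//; exact: mass_le. Qed.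

Lemma mass_dist B f h : l2norm f = 1 -> l2norm h = 1 ->
  `|mass B f - mass B h| <= 2 * l2norm (f - h).
Proof.
move=> f1 h1.
have fB := l2norm_restrict_le B f; have hB := l2norm_restrict_le B h.
have fhB := l2norm_restrict_le B (f - h); have hfB := fhB.
rewrite restrictB in fhB.
have d1 := ler_l2normD (restrict B f - restrict B h) (restrict B h).
have d2 := ler_l2normD (restrict B h - restrict B f) (restrict B f).
rewrite !subrK (l2norm_sub (restrict B h)) in d1 d2.
rewrite f1 in fB; rewrite h1 in hB.
have := l2norm_ge0 (restrict B f); have := l2norm_ge0 (restrict B h).
rewrite /mass; move: (l2norm (restrict B f)) (l2norm (restrict B h))
  (l2norm (restrict B f - restrict B h)) (l2norm (f - h)) fB hB fhB d1 d2 => a b c d.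
move=> a1 b1 cd ab ba b0 a0; rewrite ler_norml; apply/andP; split; nra.
Qed.

(** Cut the sum defining the inner product along B: on B the vector h is small, on
    its complement f is. *)
Lemma coefficient_le_mass B f h (d : R) : l2norm f = 1 -> l2norm h = 1 -> 0 < d ->
  mass B h < d ^+ 2 -> mass (~` B) f < d ^+ 2 -> normc (inner f h) < 2 * d.
Proof.
move=> f1 h1 d0 hB fB.
have lt1 A k : mass A k < d ^+ 2 -> l2norm (restrict A k) < d.
  by rewrite /mass ltr_sqr// nnegrE ?l2norm_ge0// ltW.
have E : inner f h = inner f (restrict B h) + inner (restrict (~` B) f) h.
  by rewrite inner_restrict -innerDr -restrictU ?setICr// setUv restrictT.
rewrite E; apply: le_lt_trans (le_normcD _ _) _.
have := inner_cauchy_schwarz f (restrict B h).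
have := inner_cauchy_schwarz (restrict (~` B) f) h.
by rewrite f1 h1 mulr1 mul1r; have := lt1 _ _ hB; have := lt1 _ _ fB; lra.
Qed.

End Restriction.

Section SingularVanishing.
Variables (R : realType) (G : groupType) (L : groupClosed G).

Lemma mass_translate (t : G) (B : set G) (f : l2 R G) :
  mass [set x | B (t * x)%g] f = mass B (lambda R t f).
Proof.
rewrite /mass; congr (_ ^+ 2); rewrite -(l2norm_translate t); congr l2norm.
apply: l2_ext => x.
change ((if (t^-1 * x)%g \in [set x | B (t * x)%g] then f (t^-1 * x)%g else 0) =
  (if x \in B then f (t^-1 * x)%g else 0)).
suff -> : ((t^-1 * x)%g \in [set x | B (t * x)%g]) = (x \in B) by [].
by apply/idP/idP => /set_mem h; apply/mem_set; move: h; rewrite /= mulVKg.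
Qed.

Section LimitMeasure.
Variables (I : Type) (le : I -> I -> Prop) (xi : I -> l2 R G) (U : set_system I).
Hypotheses (ai : almost_invariant L le xi) (UU : UltraFilter U) (tU : tails le `<=` U).

Lemma bounded_mass B : bounded_family (fun i => mass B (xi i)).
Proof.
exists 1 => i; rewrite ger0_norm ?mass_ge0//.
by apply: le_trans (mass_le _ _) _; rewrite ai.1 expr1n.
Qed.

(** A finitely additive probability on G: the limit of the measures |xi i|^2. *)
Definition limit_mass (B : set G) : R := ulim U (fun i => mass B (xi i)).

Lemma limit_mass_ge0 B : 0 <= limit_mass B.
Proof.
rewrite -(ulim_cst (UU := UU) (0 : R)); apply: ulim_le.
- by exists 0 => i; rewrite normr0.
- exact: bounded_mass.
- by move=> i; exact: mass_ge0.
Qed.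

Lemma limit_massT : limit_mass setT = 1.
Proof.
rewrite /limit_mass (_ : (fun i => _) = fun=> 1) ?ulim_cst//.
by apply/funext => i; rewrite massT ai.1 expr1n.
Qed.

Lemma limit_massU A B : A `&` B = set0 ->
  limit_mass (A `|` B) = limit_mass A + limit_mass B.
Proof.
move=> AB0; rewrite /limit_mass -[ulim U (fun i => mass A _)]mul1r.
rewrite -ulim_linear; [|exact: bounded_mass|exact: bounded_mass].
by congr ulim; apply/funext => i; rewrite massU// mul1r.
Qed.

Lemma limit_mass_invariant t B : t \in L ->
  limit_mass [set x | B (t * x)%g] = limit_mass B.
Proof.
move=> tL; apply: (ulim_close (UU := UU)
   (d := fun i => 2 * l2norm (lambda R t (xi i) - xi i))).
- exact: bounded_mass.
- exact: bounded_mass.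
- move=> i; rewrite mass_translate; apply: mass_dist; last exact: ai.1.
  by rewrite l2norm_translate ai.1.
- have h : (fun i => l2norm (lambda R t (xi i) - xi i)) @ U --> 0.
    by move=> V /(ai.2 _ tL) /tU.
  have := cvgM (cvg_cst (2 : R)) h; rewrite mulr0; exact.
Qed.

(** A set that is almost null for the limit measure and almost full for its
    translate by g separates xi i from its translate for many indices i. *)
Lemma small_coefficient (g : G) (B : set G) (d : R) : 0 < d ->
  limit_mass B < d ^+ 2 -> 1 - d ^+ 2 < limit_mass [set x | B (g * x)%g] ->
  U [set i | normc (inner (lambda R g (xi i)) (xi i)) < 2 * d].
Proof.
move=> d0 /(ulim_lt_near (UU := UU) (bounded_mass _)) h1.
move=> /(ulim_gt_near (UU := UU) (bounded_mass _)) h2.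
apply: filterS (filterI h1 h2) => i [/= m1 m2].
have n1 : l2norm (lambda R g (xi i)) = 1 by rewrite l2norm_translate ai.1.
apply: (coefficient_le_mass (B := B)) => //; first exact: ai.1.
by rewrite massC n1 -mass_translate expr1n; lra.
Qed.

Variables (X : ptopologicalType) (act : G -> X -> X).
Hypotheses (cX : compact [set: X]) (hX : hausdorff_space X)
    (cact : continuous_action act).

Let orbit (A : set X) : set G := [set x | A (act x point)].

(** The image of the limit measure under the orbit map of a base point. *)
Definition orbit_mass : fin_additive_prob R X :=
  @FinAdditiveProb R X (fun A => limit_mass (orbit A))
   (fun A => limit_mass_ge0 (orbit A)) limit_massT
   (fun A B AB0 => @limit_massU (orbit A) (orbit B)
      (congr1 (fun C : set X => orbit C) AB0)).

Lemma orbit_act (t : G) (A : set X) :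
  orbit (act t @^-1` A) = [set x | orbit A (t * x)%g].
Proof. by case: cact => _ mul _; apply/funext => x; rewrite /orbit/= /preimage/= mul. Qed.

Lemma orbit_prob_inv : Prob_inv L act (riesz_prob cX hX orbit_mass).
Proof.
have [a1 am ac] := cact.
split; first exact: riesz_regular.
move=> t tL A _; apply: (@riesz_invariant R X orbit_mass (act t) (act t^-1%g)) => //.
- by move=> x; rewrite -am mulVg a1.
- by move=> x; rewrite -am mulgV a1.
- by move=> B; rewrite /= orbit_act limit_mass_invariant.
Qed.

(** The regular measure attached to [orbit_mass] is L-invariant, hence singular to
    its translate by g. Regularity gives a compact K1 carrying almost all of the
    translate inside an open set V of small measure, and an open W1 between K1 and V,
    with closure in V, transfers both estimates to the finitely additive measure,
    which agrees with the regular one only up to such enlargements. *)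
Lemma singular_separation (g : G) (e : R) : singular_wrt R L act -> g \notin L -> 0 < e ->
  exists W, orbit_mass W < e /\ 1 - e < orbit_mass (act g @^-1` W).
Proof.
move=> sing gL e0; have [a1 am ac] := cact.
pose mu := riesz_prob cX hX orbit_mass.
have [A [mA gA0 A0]] := sing mu orbit_prob_inv g gL.
have mgA : measurable (act g @^-1` A : set (borel X)) by exact: borel_preimage.
have [_ reg] := riesz_regular cX hX orbit_mass (measurableC mgA).
have gA1 : mu (~` (act g @^-1` A)) = 1%E.
  rewrite (probability_setC mu mgA); move: gA0;
    rewrite /translate_measure/pushforward => ->.
  by rewrite sube0.
have [_ [K [cK KA] <-] hK] : exists2 y,
    [set mu K | K in [set K : set X | compact K /\ K `<=` ~` (act g @^-1` A)]] y
        & ((1 - e)%:E < y)%E.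
  apply: ereal_sup_gt; rewrite -reg gA1 lte_fin; lra.
have Afin : outer_value orbit_mass (~` A) \is a fin_num by exact: outer_value_fin.
have [V [oV AV hV]] : exists V, [/\ open V, ~` A `<=` V & inner_value orbit_mass V < e].
  have e2 : 0 < e / 2 by rewrite divr_gt0.
  have [V [oV AV hV]] := outer_value_approx orbit_mass (~` A) e2.
  exists V; split=> //; move: hV; rewrite [outer_value _ _]A0 add0e lee_fin; lra.
(* The image of K under g. *)
pose K1 := act g^-1%g @^-1` K.
have clK : closed K by apply: compact_closed.
have cK1 : closed K1 by apply: closed_comp => // x _; exact: ac.
have K1V : K1 `<=` V.
  move=> x /KA; rewrite /= -am mulgV a1 => nA; exact: AV.
have /(@normal_openP R) := compact_normal hX cX.
move=> /(_ _ _ cK1 (open_closedC oV))[|W1 [W2 [oW1 oW2 s1 s2 d12]]].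
  by rewrite -subset0 => x [/K1V].
exists W1; split.
  apply: (@le_lt_trans _ _ (orbit_mass (~` W2))).
    apply: fa_le => x w1 w2; have : (W1 `&` W2) x by [].
    by rewrite d12.
  apply: le_lt_trans hV; apply: le_inner_value; first exact: open_closedC.
  by move=> x nw; apply: contrapT => /s2.
apply: lt_le_trans (inner_value_le_fa orbit_mass _).
rewrite -lte_fin -outer_value_open; last first.
  by have /continuousP := ac g; exact.
apply: lt_le_trans hK _; apply: outer_value_mono => x Kx; apply: s1.
by rewrite /K1 /= -am mulVg a1.
Qed.

End LimitMeasure.

(** Along an ultrafilter that keeps the coefficients at g away from 0, the squares
    of the vectors have a limit on any orbit of the singular action;
    [singular_separation] and [small_coefficient] then make the coefficients
    small. *)
Lemma singular_vanishing (g : G) : singular_subgroup R L -> g \notin L ->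
  @vanishing_coefficients R G L g.
Proof.
move=> [X [act [cX hX cact sing]]] gL.
apply: vanishing_from_small => I le xi U e ai UU tU e0 Ue.
have d0 : 0 < e / 4 by rewrite divr_gt0.
have d20 : 0 < (e / 4) ^+ 2 by rewrite exprn_gt0.
have [W [h1 h2]] := singular_separation ai UU tU cX hX cact sing gL d20.
rewrite /= (orbit_act cact) in h2.
have small := small_coefficient ai UU d0 h1 h2.
have [i [/= lt1 le1]] := filter_ex (filterI small Ue).
by have := le_lt_trans le1 lt1; lra.
Qed.

End SingularVanishing.

(** * The equivalence *)

Theorem theoremD (R : realType) (Gam : groupType) (Lam : groupClosed Gam)
    (countGam : countable [set: Gam])
    (amenLam : amenable R (subgroup_of Lam)) :
  [<-> singular_subgroup R Lam;

       forall phi : bop R Gam -> R[i], invariant_state Lam phi ->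
         forall g, g \notin Lam -> phi (lambda R g) = 0;

       forall g, g \notin Lam ->
         closure (conv_hull [set lambda R (t * g * t^-1)%g | t in [set` Lam]])
           (0 : bop R Gam);

       forall (I : Type) (le : I -> I -> Prop) (xi : I -> l2 R Gam),
         directed le -> almost_invariant Lam le xi ->
         forall g, g \notin Lam ->
           (inner (lambda R g (xi n)) (xi n) : R[i]^o) @[n --> tails le]
             --> (0 : R[i]^o)].
Proof.
have contr : (forall g, g \notin Lam -> @vanishing_coefficients R Gam Lam g) ->
    forall g, g \notin Lam -> forall eps : R, 0 < eps ->
      exists f r p, @separating R Gam Lam g eps f r p.
  move=> van g gL eps eps0; exact: vanishing_separating amenLam eps0 (van g gL).
have hull : (forall g, g \notin Lam -> @vanishing_coefficients R Gam Lam g) ->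
    forall g, g \notin Lam ->
    closure (conv_hull [set lambda R (t * g * t^-1)%g | t in [set` Lam]]) (0 : bop R Gam).
  by move=> van g gL; apply: separating_conv_hull => eps; exact: contr.
have states : (forall g, g \notin Lam ->
    closure (conv_hull [set lambda R (t * g * t^-1)%g | t in [set` Lam]])
        (0 : bop R Gam)) ->
    forall phi : bop R Gam -> R[i], invariant_state Lam phi ->
    forall g, g \notin Lam -> phi (lambda R g) = 0.
  by move=> cl phi inv g gL; exact: conv_hull_state_vanish inv (cl g gL).
have van : (forall phi : bop R Gam -> R[i], invariant_state Lam phi ->
    forall g, g \notin Lam -> phi (lambda R g) = 0) ->
    forall g, g \notin Lam -> @vanishing_coefficients R Gam Lam g.
  by move=> st g gL; apply: state_vanish_coefficients => phi inv; exact: st.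
tfae.
- move=> sing; apply: states; apply: hull => g gL; exact: singular_vanishing.
- by move=> st; apply/hull/van.
- move=> /states/van H I le xi dir ai g gL; exact: H.
- move=> H; apply: separating_singular; apply: contr => g gL I le xi dir ai; exact: H.
Qed.
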